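(* In the setting and notation of the context (arbitrary dependence of the response on the covariates, covariates $\mathbf x\sim N(\mathbf 0,\boldsymbol\Omega_0^{-1})$), assume that all the eigenvalues of $\boldsymbol\Omega_0$ are bounded away from $0$ and $\infty$ and that the smallest eigenvalue of $2\,\mathrm{diag}(\mathbf s)-\mathrm{diag}(\mathbf s)\boldsymbol\Omega_0\,\mathrm{diag}(\mathbf s)$ is bounded from below by some positive constant. Let $K_n$ be positive integers diverging with $n$, $C_2>0$ a constant and $a_n\to0$. Assume the following Lipschitz condition: there exists a constant $L>0$ such that for all $\mathcal S$ with $|\mathcal S|\le K_n$ and all $\boldsymbol\Omega$ with $\|\boldsymbol\Omega-\boldsymbol\Omega_0\|_2\le C_2a_n$, $$\big|\mathrm{FDR}_n(\mathbf H^{\boldsymbol\Omega},\mathcal S)-\mathrm{FDR}_n(\mathbf H^{\boldsymbol\Omega_0},\mathcal S)\big|\le L\,\|\mathbf H^{\boldsymbol\Omega}-\mathbf H^{\boldsymbol\Omega_0}\|_F .$$ Then $$\sup_{|\mathcal S|\le K_n,\ \|\boldsymbol\Omega-\boldsymbol\Omega_0\|_2\le C_2a_n}\big|\mathrm{FDR}_n(\mathbf H^{\boldsymbol\Omega},\mathcal S)-\mathrm{FDR}_n(\mathbf H^{\boldsymbol\Omega_0},\mathcal S)\big|\le O(K_n^{1/2}a_n).$$ Moreover, assume in addition that the estimated precision matrix $\widehat{\boldsymbol\Omega}$ used by RANK satisfies $\|\widehat{\boldsymbol\Omega}-\boldsymbol\Omega_0\|_2\le C_2a_n$ with probability $1-O(p^{-c_1})$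 for some constant $c_1>0$, that the reduced model satisfies $|\widetilde{\mathcal S}|\le K_n$, and that $K_n^{1/2}a_n\to0$. Then the FDR of RANK is bounded from above by $q+O(K_n^{1/2}a_n)+O(p^{-c_1})$, where $q\in(0,1)$ is the target FDR level.
   Context: Asymptotics. $n\to\infty$; $p$, $\boldsymbol\Omega_0$, $\mathbf s$ and derived quantities may depend on $n$. $\|\cdot\|_2$ is the spectral norm, $\|\cdot\|_F$ the Frobenius norm. Subscript $\mathcal S\subset\{1,\dots,p\}$ on a matrix means the submatrix of columns in $\mathcal S$. All $\boldsymbol\Omega$ are $p\times p$ symmetric positive definite. Data. $(\mathbf x_i,Y_i)$ are i.i.d. copies of $(\mathbf x,Y)$, $\mathbf x=(X_1,\dots,X_p)^T\sim N(\mathbf 0,\boldsymbol\Sigma_0)$, $\boldsymbol\Sigma_0=\boldsymbol\Omega_0^{-1}$; the conditional law of $Y$ given $\mathbf x$ is arbitrary. $\mathcal S_0^c$ is the set of $j$ such that $X_j$ is independent of $Y$ conditionally on $\{X_k:k\ne j\}$ and $\mathcal S_0$ is its complement. $\mathbf s\in\mathbb R^p$ is a fixed vector with nonnegative components such that $\boldsymbol\Sigma_0-2^{-1}\mathrm{diag}(\mathbf s)$ is positive definite. Knockoff matrices. $\mathbf C^{\boldsymbol\Omega}=\mathbf I_p-\boldsymbol\Omega\,\mathrm{diag}(\mathbf s)$ and $\mathbf B^{\boldsymbol\Omega}=\big(2\,\mathrm{diag}(\mathbf s)-\mathrm{diag}(\mathbf s)\boldsymbol\Omega\,\mathrm{diag}(\mathbf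 s)\big)^{1/2}$ (symmetric square root; considered when the matrix inside is positive semidefinite, which holds for large $n$ whenever $\|\boldsymbol\Omega-\boldsymbol\Omega_0\|_2\le C_2a_n$ under the assumptions). Write $\mathbf C_0=\mathbf C^{\boldsymbol\Omega_0}$, $\mathbf B_0=\mathbf B^{\boldsymbol\Omega_0}$. For a design $\mathbf X\in\mathbb R^{n\times p}$, $\widetilde{\mathbf X}^{\boldsymbol\Omega}=\mathbf X\mathbf C^{\boldsymbol\Omega}+\mathbf Z\mathbf B^{\boldsymbol\Omega}$ with $\mathbf Z\in\mathbb R^{n\times p}$ having i.i.d. $N(0,1)$ entries independent of the data; that is, rows are independent with $\widetilde{\mathbf x}_i^{\boldsymbol\Omega}\mid\mathbf x_i\sim N\big((\mathbf C^{\boldsymbol\Omega})^T\mathbf x_i,(\mathbf B^{\boldsymbol\Omega})^2\big)$. Knockoffs procedure on $\mathcal S$. Given $(\mathbf y,\mathbf X_{\mathcal S},\widetilde{\mathbf X}_{\mathcal S}^{\boldsymbol\Omega})$, compute feature importance measures $Z_j,\widetilde Z_j$ of $X_j$ and of its knockoff for $j\in\mathcal S$, and statistics $W_j=f_j(Z_j,\widetilde Z_j)$ with $f_j$ antisymmetric, $f_j(z,\tilde z)=-f_j(\tilde z,z)$; the construction is any valid one, meaning that swapping the columns $X_j$ and $\widetilde X_j$ for $j$ in a subset flips the signs of exactly those $W_j$ and leaves the others unchanged. Put $W_j=0$ for $j\notin\mathcal S$. With $\mathcal W=\{|W_j|\}\setminus\{0\}$ let $T=\min\{t\in\mathcal W:(1+|\{j:W_j\le-t\}|)/|\{j:W_j\ge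 t\}|\le q\}$ ($T=+\infty$ if empty), and select $\widehat{\mathcal S}=\{j:W_j\ge T\}$. $\mathrm{FDP}_n(\mathbf y,\mathbf X_{\mathcal S},\widetilde{\mathbf X}^{\boldsymbol\Omega}_{\mathcal S})=|\widehat{\mathcal S}\cap\mathcal S_0^c|/|\widehat{\mathcal S}|$ with $0/0=0$. FDR functions. For deterministic $\boldsymbol\Omega,\mathcal S$, $\mathrm{FDR}_n(\boldsymbol\Omega,\mathcal S)=\mathbb E[\mathrm{FDP}_n(\mathbf y,\mathbf X_{\mathcal S},\widetilde{\mathbf X}_{\mathcal S}^{\boldsymbol\Omega})]$, where $(\mathbf X,\mathbf y)$ is a sample of size $n$. Let $$\mathbf H^{\boldsymbol\Omega}=\begin{pmatrix}\mathbf I_p & \mathbf C^{\boldsymbol\Omega}_{\mathcal S}-\mathbf C_{0,\mathcal S}(\mathbf B_{0,\mathcal S}^T\mathbf B_{0,\mathcal S})^{-1/2}\big((\mathbf B^{\boldsymbol\Omega}_{\mathcal S})^T\mathbf B^{\boldsymbol\Omega}_{\mathcal S}\big)^{1/2}\\ \mathbf 0&(\mathbf B_{0,\mathcal S}^T\mathbf B_{0,\mathcal S})^{-1/2}\big((\mathbf B^{\boldsymbol\Omega}_{\mathcal S})^T\mathbf B^{\boldsymbol\Omega}_{\mathcal S}\big)^{1/2}\end{pmatrix},$$ so $\mathbf H^{\boldsymbol\Omega_0}=\mathbf I_{p+|\mathcal S|}$. Since $\mathrm{FDR}_n(\boldsymbol\Omega,\mathcal S)$ depends on $\boldsymbol\Omega$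 only through $\mathbf H^{\boldsymbol\Omega}$, it is reparametrized as $\mathrm{FDR}_n(\mathbf H^{\boldsymbol\Omega},\mathcal S):=\mathrm{FDR}_n(\boldsymbol\Omega,\mathcal S)$. RANK. Split the data randomly into two independent folds $(\mathbf X^{(1)},\mathbf y^{(1)})$, $(\mathbf X^{(2)},\mathbf y^{(2)})$ of equal size $n$ (so $n$ is half of the original sample size). From the first fold compute an estimate $\widehat{\boldsymbol\Omega}$ of $\boldsymbol\Omega_0$ and a reduced model $\widetilde{\mathcal S}\subset\{1,\dots,p\}$. On the second fold construct $\widehat{\mathbf X}=\mathbf X^{(2)}\mathbf C^{\widehat{\boldsymbol\Omega}}+\mathbf Z\mathbf B^{\widehat{\boldsymbol\Omega}}$ with fresh i.i.d. $N(0,1)$ entries in $\mathbf Z$, and run the knockoffs procedure above with $(\mathbf y^{(2)},\mathbf X^{(2)}_{\widetilde{\mathcal S}},\widehat{\mathbf X}_{\widetilde{\mathcal S}})$ to obtain $\widehat{\mathcal S}$. The FDR of RANK is $\mathbb E[|\widehat{\mathcal S}\cap\mathcal S_0^c|/|\widehat{\mathcal S}|]$. *)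

(* Defs.v *)
From HB Require Import structures.
From mathcomp Require Import all_boot all_order all_algebra.
From mathcomp Require Import all_classical all_reals all_analysis.

Set Implicit Arguments.
Unset Strict Implicit.
Unset Printing Implicit Defensive.

Import Order.TTheory GRing.Theory Num.Theory.
Import numFieldNormedType.Exports.

Local Open Scope classical_set_scope.
Local Open Scope ring_scope.

(* Matrices carry the product sigma-algebra, generated by the entries. *)
Definition measure_matrix_display : measure_display -> measure_display.
Proof. exact. Qed.

Section measurable_matrix.
Context {d : measure_display} {T : measurableType d} (m n : nat).

Definition mx_cylinders : set (set 'M[T]_(m, n)) :=
  [set B | exists i j, exists2 A : set T,
     measurable A & B = [set M : 'M[T]_(m, n) | A (M i j)]].

Let mx_set0 : <<s mx_cylinders >> set0.
Proof. exact: sigma_algebra0. Qed.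

Let mx_setC A : <<s mx_cylinders >> A -> <<s mx_cylinders >> (~` A).
Proof. exact: sigma_algebraC. Qed.

Let mx_bigcup (F : (set 'M[T]_(m, n))^nat) :
  (forall i, <<s mx_cylinders >> (F i)) ->
  <<s mx_cylinders >> (\bigcup_i (F i)).
Proof. exact: sigma_algebra_bigcup. Qed.

HB.instance Definition _ := @isMeasurable.Build (measure_matrix_display d)
  'M[T]_(m, n) <<s mx_cylinders >> mx_set0 mx_setC mx_bigcup.

End measurable_matrix.

Section matrices.
Context {R : realType}.

Definition frobenius m n (A : 'M[R]_(m, n)) : R :=
  Num.sqrt (\sum_i \sum_j A i j ^+ 2).

(* The operator norm induced by the Euclidean norm (which, on a column, is
   the Frobenius norm). *)
Definition spectral_norm m n (A : 'M[R]_(m, n)) : R :=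
  sup [set frobenius (A *m x) | x in [set x : 'cV[R]_n | frobenius x <= 1]].

Definition posdef n (A : 'M[R]_n) : Prop :=
  A^T = A /\ forall x : 'cV[R]_n, x != 0 -> 0 < (x^T *m A *m x) 0 0.

Definition possemidef n (A : 'M[R]_n) : Prop :=
  A^T = A /\ forall x : 'cV[R]_n, 0 <= (x^T *m A *m x) 0 0.

(* Symmetric square root; equal to 0 when A is not positive semidefinite. *)
Definition sqrtmx n (A : 'M[R]_n) : 'M[R]_n :=
  xget 0 [set B | possemidef B /\ B *m B = A].

Definition subcol m p (S : {set 'I_p}) (A : 'M[R]_(m, p)) : 'M[R]_(m, #|S|) :=
  colsub (fun k : 'I_#|S| => enum_val k) A.

End matrices.

Section laws.
Context d (T : measurableType d) {R : realType} (P : probability T R).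

Definition has_law d' (E : measurableType d') (V : T -> E)
    (nu : set E -> \bar R) : Prop :=
  forall A, measurable A -> P (V @^-1` A) = nu A.

Definition independent d1 d2 (E1 : measurableType d1) (E2 : measurableType d2)
    (U : T -> E1) (V : T -> E2) : Prop :=
  forall A B, measurable A -> measurable B ->
    P (U @^-1` A `&` V @^-1` B) = (P (U @^-1` A) * P (V @^-1` B))%E.

(* Subfamilies are covered by taking some of the A i to be setT. *)
Definition mutually_independent (I : finType) d' (E : measurableType d')
    (V : I -> T -> E) : Prop :=
  forall A : I -> set E, (forall i, measurable (A i)) ->
    P [set w | forall i, A i (V i w)] = (\prod_i P (V i @^-1` A i))%E.

Definition iid (I : finType) d' (E : measurableType d') (V : I -> T -> E)
    (nu : set E -> \bar R) : Prop :=
  mutually_independent V /\ forall i, has_law (V i) nu.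

Definition std_gaussian m n (Z : T -> 'M[R]_(m, n)) : Prop :=
  iid (fun (ij : 'I_m * 'I_n) w => Z w ij.1 ij.2) (normal_prob 0 1).

(* [g] is a version of the conditional probability of [E] given [V], as a
   function of the value of [V]. *)
Definition cond_prob d' (U : measurableType d') (V : T -> U) (E : set T)
    (g : U -> R) : Prop :=
  [/\ measurable_fun setT g,
      P.-integrable setT (EFin \o g \o V) &
      forall G, measurable G ->
        (\int[P]_(w in V @^-1` G) (g (V w))%:E = P (E `&` V @^-1` G))%E].

Definition cond_independent d1 d2 d3 (E1 : measurableType d1)
    (E2 : measurableType d2) (U : measurableType d3)
    (X : T -> E1) (Y : T -> E2) (V : T -> U) : Prop :=
  forall A B, measurable A -> measurable B ->
    exists gA gB : U -> R,
      [/\ cond_prob V (X @^-1` A) gA, cond_prob V (Y @^-1` B) gB &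
          cond_prob V (X @^-1` A `&` Y @^-1` B) (fun u => gA u * gB u)].

End laws.

(* N(0, Sigma) as the law of z Sigma^{1/2} for a standard Gaussian row z. *)
Definition gaussian_law (R : realType) p (Sigma : 'M[R]_p)
    (nu : set 'rV[R]_p -> \bar R) : Prop :=
  exists g : probability 'rV[R]_p R,
    std_gaussian g id /\ has_law g (fun z => z *m sqrtmx Sigma) nu.

Section knockoffs.
Context {R : realType}.

Section design_matrices.
Context {p : nat} (s : 'rV[R]_p) (Om : 'M[R]_p).

Definition Cmx : 'M[R]_p := 1%:M - Om *m diag_mx s.

Definition B2mx : 'M[R]_p :=
  2%:R *: diag_mx s - diag_mx s *m Om *m diag_mx s.

Definition Bmx : 'M[R]_p := sqrtmx B2mx.

End design_matrices.

(* The law of (X, subcol S Xt) depends on Om only through this matrix, hence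
   so does FDR below. *)
Definition Hmx p (s : 'rV[R]_p) (Om0 Om : 'M[R]_p) (S : {set 'I_p}) :
    'M[R]_(p + #|S|) :=
  let B0 := subcol S (Bmx s Om0) in
  let B := subcol S (Bmx s Om) in
  let M := invmx (sqrtmx (B0^T *m B0)) *m sqrtmx (B^T *m B) in
  block_mx 1%:M (subcol S (Cmx s Om) - subcol S (Cmx s Om0) *m M)
           0    M.

(* Null covariates, for the joint law mu of (x, Y); [col' j x] is the vector
   of the covariates other than the j-th one. *)
Definition nulls p (mu : probability ('rV[R]_p * R)%type R) : {set 'I_p} :=
  [set j | `[< cond_independent mu (fun xy => xy.1 0 j) (fun xy => xy.2)
                 (fun xy => col' j xy.1) >]]%SET.

Definition swap_cols m k (A : {set 'I_k}) (X Xt : 'M[R]_(m, k)) :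
    'M[R]_(m, k) :=
  \matrix_(i, j) (if j \in A then Xt i j else X i j).

(* Construction of the statistics W_j, j in S, from the response, the design
   restricted to S and its knockoffs. *)
Record knockoff_stat (n p : nat) (S : {set 'I_p}) := KnockoffStat {
  importance : 'cV[R]_n -> 'M[R]_(n, #|S|) -> 'M[R]_(n, #|S|) ->
               'I_#|S| -> R ;
  importance_knockoff : 'cV[R]_n -> 'M[R]_(n, #|S|) -> 'M[R]_(n, #|S|) ->
               'I_#|S| -> R ;
  contrast : 'I_#|S| -> R -> R -> R ;
  Wstat y X Xt k :=
    contrast k (importance y X Xt k) (importance_knockoff y X Xt k) ;
  contrast_antisym : forall k z zt, contrast k z zt = - contrast k zt z ;
  Wstat_swap : forall y X Xt (A : {set 'I_#|S|}) k,
    Wstat y (swap_cols A X Xt) (swap_cols A Xt X) k =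
    if k \in A then - Wstat y X Xt k else Wstat y X Xt k ;
  Wstat_measurable : forall k,
    measurable_fun [set: 'cV[R]_n * 'M[R]_(n, #|S|) * 'M[R]_(n, #|S|)]
      (fun t => Wstat t.1.1 t.1.2 t.2 k) }.

Definition extend0 p (S : {set 'I_p}) (W : 'I_#|S| -> R) (j : 'I_p) : R :=
  if [pick k : 'I_#|S| | enum_val k == j] is Some k then W k else 0.

(* The first conjunct discards ratios with a null denominator, which are
   infinite (whereas x / 0 = 0 here). *)
Definition admissible p (q : R) (W : 'I_p -> R) (t : R) : bool :=
  let pos := #|[set j | t <= W j]%SET| in
  let neg := #|[set j | W j <= - t]%SET| in
  (0 < pos)%N && ((1 + neg)%:R / pos%:R <= q).

(* A minimum over the finite set of the nonzero |W_j|, +oo if empty. *)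
Definition threshold p (q : R) (W : 'I_p -> R) : \bar R :=
  \big[Order.min/+oo%E]_(j | (W j != 0) && admissible q W `|W j|)
    (`|W j|)%:E.

Definition selected p (q : R) (W : 'I_p -> R) : {set 'I_p} :=
  [set j | (threshold q W <= (W j)%:E)%E]%SET.

Definition fdp p (S0c Shat : {set 'I_p}) : R :=
  #|Shat :&: S0c|%:R / #|Shat|%:R.

Definition knockoff_fdp n p (q : R) (S0c : {set 'I_p}) (s : 'rV[R]_p)
    (S : {set 'I_p}) (st : knockoff_stat n S) (Om : 'M[R]_p)
    (X : 'M[R]_(n, p)) (y : 'cV[R]_n) (Z : 'M[R]_(n, p)) : R :=
  let Xt := X *m Cmx s Om + Z *m Bmx s Om in
  fdp S0c (selected q (extend0 (Wstat st y (subcol S X) (subcol S Xt)))).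

Definition FDR d (T : measurableType d) (P : probability T R) n p (q : R)
    (S0c : {set 'I_p}) (s : 'rV[R]_p)
    (st : forall S : {set 'I_p}, knockoff_stat n S)
    (X : T -> 'M[R]_(n, p)) (y : T -> 'cV[R]_n) (Z : T -> 'M[R]_(n, p))
    (Om : 'M[R]_p) (S : {set 'I_p}) : R :=
  fine 'E_P[fun w => knockoff_fdp q S0c s (st S) Om (X w) (y w) (Z w)].

Definition FDR_rank d (T : measurableType d) (P : probability T R) n p (q : R)
    (S0c : {set 'I_p}) (s : 'rV[R]_p)
    (st : forall S : {set 'I_p}, knockoff_stat n S)
    (X1 : T -> 'M[R]_(n, p)) (y1 : T -> 'cV[R]_n)
    (X2 : T -> 'M[R]_(n, p)) (y2 : T -> 'cV[R]_n) (Z : T -> 'M[R]_(n, p))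
    (Omhat : 'M[R]_(n, p) * 'cV[R]_n -> 'M[R]_p)
    (Stilde : 'M[R]_(n, p) * 'cV[R]_n -> {set 'I_p}) : R :=
  fine 'E_P[fun w => let D := (X1 w, y1 w) in
    knockoff_fdp q S0c s (st (Stilde D)) (Omhat D) (X2 w) (y2 w) (Z w)].

Definition iid_sample d (T : measurableType d) (P : probability T R) n p
    (X : T -> 'M[R]_(n, p)) (y : T -> 'cV[R]_n)
    (mu : probability ('rV[R]_p * R)%type R) : Prop :=
  iid P (fun (i : 'I_n) w => (row i (X w), y w i 0)) mu.

End knockoffs.

(* Main.v *)
(**
Perturbation. With M = (B0_S^T B0_S)^(-1/2) (B_S^T B_S)^(1/2), the nonzero
blocks of H(Om) - H(Om0) are M - 1 and C_S - C0_S M. For E = D - D0 the identity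
D E + E D0 = D^2 - D0^2, paired with E, shows that the square root is Lipschitz
in Frobenius norm on matrices bounded from below, and restricting to S costs a
factor |S|^(1/2); hence |H(Om) - H(Om0)|_F = O(|S|^(1/2) |Om - Om0|_2), and the
Lipschitz condition gives the first claim.

Oracle. For Om = Om0 the FDR is at most q on every S. The pair (x, xt) is a linear
image of a standard Gaussian vector, and exchanging x_j with xt_j lifts to an
orthogonal reflection of that vector. Since Y is independent of x_j given the
other covariates when j is null, the law of (x, xt, Y) is invariant under this
exchange, so flipping the sign of one null W_j does not change the law of W. Let
T_j be the threshold computed after replacing W_j by |W_j|. The FDP is at most q
times the sum over null j of 1{W_j >= T_j} / (1 + #{k <> j null : W_k <= - T_j});
after flipping the sign of W_j in the j-th term, the sum is at most 1 pointwise,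
because all the j with W_j <= - T_j share the same T_j.

RANK. The first fold is independent of the second one and of Z, so that given the
first fold the conditional expectation of the FDP is FDR(Omhat, Stilde). It is at
most q plus the perturbation term when Omhat is close to Om0, and at most 1
otherwise.
*)
Require Import Defs.
From HB Require Import structures.
From mathcomp Require Import all_boot all_order all_algebra.
From mathcomp Require Import all_classical all_reals all_analysis.
From mathcomp Require Import measurable_realfun complex ring lra.

Set Implicit Arguments.
Unset Strict Implicit.
Unset Printing Implicit Defensive.

Import Order.TTheory GRing.Theory Num.Theory.
Import numFieldNormedType.Exports.

Local Open Scope classical_set_scope.
Local Open Scope ring_scope.

(** * Real symmetric matrices *)

(** Three obstacles shape the proof. (1) The reflection invariance of the Gaussian law is obtained
    without a change of variables in several dimensions. Weighted by exp(|z|^2/2), the standard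
    Gaussian is Lebesgue measure up to a constant; a reflection is a one-coordinate change
    conjugated by a shear, and a shear is a product of one-coordinate translations, so invariance of
    Lebesgue measure on the line suffices. As the reflection preserves |z|, the weight can then be
    removed. (2) [sqrtmx] is a choice operator with a default value, so B at an arbitrary estimate
    is not known to be measurable. It is Lipschitz on the spectral ball around Om0; the estimate is
    replaced by Om0 when it leaves the ball or the reduced model is too large, and the comparison
    with the original FDP uses only monotonicity of lower integrals. (3) Conditional independence
    gives versions of conditional probabilities event by event, possibly with negative values;
    clipped at 0 and identified almost everywhere, they yield one function h of the other covariates
    that stands for the probability of Y lying in a fixed set. *)

Lemma interpolation (F : fieldType) (s : seq F) (f : F -> F) :
  exists h : {poly F}, forall b, b \in s -> h.[b] = f b.
Proof.
elim: s => [|b s [h hE]]; first by exists 0.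
have [bs|bs] := boolP (b \in s).
  by exists h => c; rewrite inE => /predU1P[->|]; apply: hE.
(* Newton interpolation: [k] vanishes at the earlier nodes, so adding a multiple of it repairs the
   value at [b] without disturbing the others. *)
pose k := \prod_(c <- s) ('X - c%:P).
have kb : k.[b] != 0 by rewrite -[_ == _]/(root _ _) root_prod_XsubC.
exists (h + ((f b - h.[b]) / k.[b])%:P * k) => c; rewrite inE !hornerE.
move=> /predU1P[->|cs]; first by rewrite divfK// addrC subrK.
have -> : k.[c] = 0 by apply/eqP; rewrite -[_ == _]/(root _ _) root_prod_XsubC.
by rewrite mulr0 addr0 hE.
Qed.

Section spectral.
Context {R : realType}.

Lemma trmx_horner_mx n (A : 'M[R]_n.+1) (h : {poly R}) :
  A^T = A -> (horner_mx A h)^T = horner_mx A h.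
Proof.
move=> AT; elim/poly_ind: h => [|h c IH]; first by rewrite rmorph0 trmx0.
rewrite rmorphD rmorphM /= horner_mx_X horner_mx_C linearD /= tr_scalar_mx.
congr (_ + _); rewrite -[_ * _]/(_ *m _) trmx_mul IH AT.
by have := comm_mx_horner h (comm_mx_refl A).
Qed.

Local Notation toC := (real_complex R).

(* The fourth root is a polynomial in A with real coefficients, which is
   checked in an orthonormal eigenbasis over the complex numbers. *)
Lemma sym_fourth_root n (A : 'M[R]_n) :
  A^T = A -> (forall b, eigenvalue A b -> 0 <= b) ->
  exists C : 'M[R]_n, C^T = C /\ (C *m C) *m (C *m C) = A.
Proof.
case: n A => [|n] A AT A0.
  by exists 0; split; apply/matrixP => -[].
pose AC := map_mx toC A.
have ACh : AC \is hermsymmx.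
  apply: realsym_hermsym.
    by apply/is_hermitianmxP; rewrite expr0 scale1r map_mx_id// map_trmx AT.
  by apply/mxOverP => i j; rewrite mxE complex_real.
have Dreal := hermitian_spectral_diag_real ACh.
have /orthomx_spectralP := hermitian_normalmx ACh.
have := spectral_unit AC; move: Dreal.
set D := spectral_diag AC; set Q := spectralmx AC => Dreal Qu AE.
clearbody D Q.
have DE k : D 0 k = toC (complex.Re (D 0 k)).
  by rewrite RRe_real//; apply: (mxOverP Dreal).
have D0 k : 0 <= complex.Re (D 0 k).
  apply: A0; have <- := eigenvalue_map toC A (complex.Re (D 0 k)).
  have := DE k; rewrite /= => <-; apply/eigenvalueP.
  (* Row k of Q is a left eigenvector, nonzero because Q is invertible; [eigenvalue_map] has brought
     the real eigenvalue back to [A]. *)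
  exists (row k Q).
    rewrite -row_mul [map_mx _ _]AE !mulmxA mulmxV// mul1mx row_mul row_diag_mx.
    by rewrite -scalemxAl rowE.
  apply/negP => /eqP Qk0.
  have := congr1 (mulmx^~ (invmx Q)) Qk0.
  rewrite rowE -mulmxA mulmxV// mulmx1 mul0mx => /matrixP/(_ 0 k).
  by rewrite !mxE !eqxx /= => /eqP; rewrite oner_eq0.
have [h hE] := interpolation [seq complex.Re (D 0 k) | k : 'I_n.+1]
  (fun x => Num.sqrt (Num.sqrt x)).
exists (horner_mx A h); split; first exact: trmx_horner_mx.
rewrite -[LHS]/(horner_mx A h * horner_mx A h * (horner_mx A h * horner_mx A
  h)).
rewrite -!rmorphM /=; apply: (map_mx_inj (f := toC)).
rewrite map_horner_mx /= [RHS]AE [map_mx _ A]AE.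
have := @horner_mx_uconj _ _ (map_poly toC (h * h * (h * h))) (invmx Q)
  (diag_mx D); rewrite unitmx_inv invmxK => ->//.
rewrite horner_mx_diag; congr (_ *m diag_mx _ *m _); apply/rowP => k.
rewrite !mxE DE /= horner_map; congr toC.
rewrite !hornerM hE; last by apply/mapP; exists k => //; rewrite mem_enum.
by rewrite -!expr2 !sqr_sqrtr ?sqrtr_ge0.
Qed.

End spectral.

(** * Frobenius and spectral norms *)

Section frobenius_norm.
Context {R : realType}.

Lemma frobenius_ge0 m n (A : 'M[R]_(m, n)) : 0 <= frobenius A.
Proof. exact: sqrtr_ge0. Qed.

Lemma frobenius_sqr m n (A : 'M[R]_(m, n)) :
  frobenius A ^+ 2 = \sum_i \sum_j A i j ^+ 2.
Proof.
by rewrite sqr_sqrtr// sumr_ge0// => i _; rewrite sumr_ge0// => j _;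
  exact: sqr_ge0.
Qed.

Lemma mxtrace_mul_trmx m n (A B : 'M[R]_(m, n)) :
  \tr (A^T *m B) = \sum_i \sum_j A i j * B i j.
Proof.
rewrite /mxtrace exchange_big; apply: eq_bigr => j _.
by rewrite mxE; apply: eq_bigr => i _; rewrite !mxE.
Qed.

Lemma frobenius_trace m n (A : 'M[R]_(m, n)) :
  frobenius A ^+ 2 = \tr (A^T *m A).
Proof. by rewrite frobenius_sqr mxtrace_mul_trmx. Qed.

Lemma frobenius_cV n (x : 'cV[R]_n) : frobenius x ^+ 2 = (x^T *m x) 0 0.
Proof. by rewrite frobenius_trace /mxtrace big_ord1. Qed.

Lemma frobenius_eq0 m n (A : 'M[R]_(m, n)) : frobenius A = 0 -> A = 0.
Proof.
move=> A0; apply/matrixP => i j; rewrite mxE; apply/eqP.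
have /eqP := frobenius_sqr A; rewrite A0 expr0n eq_sym psumr_eq0; last first.
  by move=> k _; rewrite sumr_ge0// => l _; exact: sqr_ge0.
move=> /allP/(_ i)/=; rewrite mem_index_enum => /(_ isT).
rewrite psumr_eq0 => [|l _]; last exact: sqr_ge0.
by move=> /allP/(_ j)/=; rewrite mem_index_enum => /(_ isT); rewrite sqrf_eq0.
Qed.

Lemma frobenius_trmx m n (A : 'M[R]_(m, n)) : frobenius A^T = frobenius A.
Proof.
rewrite /frobenius exchange_big; congr Num.sqrt.
by apply: eq_bigr => i _; apply: eq_bigr => j _; rewrite mxE.
Qed.

Lemma frobeniusN m n (A : 'M[R]_(m, n)) : frobenius (- A) = frobenius A.
Proof.
congr Num.sqrt; apply: eq_bigr => i _; apply: eq_bigr => j _.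
by rewrite mxE sqrrN.
Qed.

Lemma frobenius0 m n : frobenius (0 : 'M[R]_(m, n)) = 0.
Proof.
rewrite /frobenius big1 ?sqrtr0// => i _.
by rewrite big1// => j _; rewrite mxE expr0n.
Qed.

(** Cauchy-Schwarz for the inner product tr(A^T B): the squared norm of |B| A - |A| B equals 2 |A|
    |B| (|A| |B| - tr(A^T B)). *)
Lemma mxtrace_mul_le m n (A B : 'M[R]_(m, n)) :
  \tr (A^T *m B) <= frobenius A * frobenius B.
Proof.
have [a0 b0] := (frobenius_ge0 A, frobenius_ge0 B).
have [|bn0] := eqVneq (frobenius B) 0.
  by move=> /frobenius_eq0 ->; rewrite mulmx0 mxtrace0 frobenius0 mulr0.
have [|an0] := eqVneq (frobenius A) 0.
  by move=> /frobenius_eq0 ->; rewrite trmx0 mul0mx mxtrace0 frobenius0 mul0r.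
have := sqr_ge0 (frobenius (frobenius B *: A - frobenius A *: B)).
have -> : frobenius (frobenius B *: A - frobenius A *: B) ^+ 2 =
    2 * (frobenius A * frobenius B) * (frobenius A * frobenius B - \tr (A^T
      *m B)).
  rewrite frobenius_trace [(_ - _)^T]linearB /= ![(_ *: _)^T]linearZ /=.
  rewrite mulmxBl !mulmxBr -!scalemxAl -!scalemxAr !linearB /= !linearZ /=.
  rewrite -!frobenius_trace.
  have -> : \tr (B^T *m A) = \tr (A^T *m B).
    by rewrite -mxtrace_tr trmx_mul trmxK.
  rewrite /GRing.scale /=; ring.
rewrite pmulr_rge0 ?subr_ge0// mulr_gt0// mulr_gt0// lt_neqAle.
  by rewrite eq_sym an0.
by rewrite eq_sym bn0.
Qed.

Lemma frobeniusD m n (A B : 'M[R]_(m, n)) :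
  frobenius (A + B) <= frobenius A + frobenius B.
Proof.
rewrite -(@ler_pXn2r _ 2)// ?nnegrE ?addr_ge0 ?frobenius_ge0//.
rewrite sqrrD frobenius_trace [(_ + _)^T]linearD /= mulmxDl !mulmxDr !linearD
  /=.
rewrite -!frobenius_trace.
have -> : \tr (B^T *m A) = \tr (A^T *m B).
  by rewrite -mxtrace_tr trmx_mul trmxK.
have := mxtrace_mul_le A B; lra.
Qed.

Lemma frobenius_col m n (A : 'M[R]_(m, n)) :
  frobenius A ^+ 2 = \sum_j frobenius (col j A) ^+ 2.
Proof.
rewrite frobenius_sqr exchange_big; apply: eq_bigr => j _.
by rewrite frobenius_sqr; apply: eq_bigr => i _; rewrite big_ord1 mxE.
Qed.

(** Squared Frobenius norms add over columns, so a bound on vectors passes to matrices with the same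
    constant. This is how spectral norms meet Frobenius norms below. *)
Lemma frobenius_mul_bounded m n k (A : 'M[R]_(m, n)) (B : 'M[R]_(n, k)) (c :
  R) :
  0 <= c -> (forall x : 'cV[R]_n, frobenius (A *m x) <= c * frobenius x) ->
  frobenius (A *m B) <= c * frobenius B.
Proof.
move=> c0 Ac; rewrite -(@ler_pXn2r _ 2)// ?nnegrE ?mulr_ge0 ?frobenius_ge0//.
rewrite exprMn !frobenius_col mulr_sumr; apply: ler_sum => j _.
by rewrite -exprMn ler_pXn2r// ?nnegrE ?mulr_ge0 ?frobenius_ge0// !colE -mulmxA.
Qed.

Lemma frobeniusM m n k (A : 'M[R]_(m, n)) (B : 'M[R]_(n, k)) :
  frobenius (A *m B) <= frobenius A * frobenius B.
Proof.
apply: frobenius_mul_bounded => [|x]; first exact: frobenius_ge0.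
rewrite -(@ler_pXn2r _ 2)// ?nnegrE ?mulr_ge0 ?frobenius_ge0//.
rewrite exprMn -(frobenius_trmx (A *m x)) -(frobenius_trmx A) !frobenius_col.
rewrite mulr_suml; apply: ler_sum => i _.
rewrite -!tr_row !frobenius_trmx row_mul -frobenius_col -exprMn.
rewrite ler_pXn2r// ?nnegrE ?mulr_ge0 ?frobenius_ge0//.
have -> : frobenius (row i A *m x) = `|(row i A *m x) 0 0|.
  by rewrite /frobenius !big_ord1 sqrtr_sqr.
have <- : \tr (row i A *m x) = (row i A *m x) 0 0 by rewrite /mxtrace big_ord1.
have := mxtrace_mul_le (row i A)^T x; have := mxtrace_mul_le (- (row i A)^T) x.
rewrite linearN /= trmxK mulNmx linearN /= frobeniusN frobenius_trmx => h1 h2.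
by rewrite ler_norml h2 lerNl h1.
Qed.

Lemma frobenius_entry m n (A : 'M[R]_(m, n)) i j : `|A i j| <= frobenius A.
Proof.
rewrite -(@ler_pXn2r _ 2)// ?nnegrE ?frobenius_ge0// real_normK ?num_real//.
rewrite frobenius_sqr (bigD1 i)//= (bigD1 j)//= -addrA lerDl addr_ge0//.
  by rewrite sumr_ge0// => k _; exact: sqr_ge0.
by rewrite sumr_ge0// => k _; rewrite sumr_ge0// => l _; exact: sqr_ge0.
Qed.

Lemma frobenius_le_entries m n (A : 'M[R]_(m, n)) (e : R) :
  0 <= e -> (forall i j, `|A i j| <= e) -> frobenius A <= (m * n)%:R * e.
Proof.
move=> e0 Ae; rewrite -(@ler_pXn2r _ 2)// ?nnegrE ?frobenius_ge0 ?mulr_ge0//.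
rewrite frobenius_sqr exprMn.
apply: (@le_trans _ _ (\sum_(i < m) \sum_(j < n) e ^+ 2)).
  apply: ler_sum => i _; apply: ler_sum => j _.
  by rewrite -(real_normK (num_real (A i j))) ler_pXn2r// nnegrE.
rewrite !sumr_const !card_ord -mulrnA -(mulr_natl (e ^+ 2)) mulnC.
rewrite ler_wpM2r ?sqr_ge0// -natrX ler_nat.
by case: (m * n)%N => // k; rewrite leq_pmulr.
Qed.

(** Guards against the default value of [sup]: the Frobenius norm of [A] is an upper bound. *)
Lemma spectral_norm_has_sup m n (A : 'M[R]_(m, n)) :
  has_sup [set frobenius (A *m x) | x in [set x : 'cV[R]_n | frobenius x <= 1]].
Proof.
split; first by exists (frobenius (A *m (0 : 'cV_n))), 0;
  rewrite //= frobenius0.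
exists (frobenius A) => _ [x /= x1 <-]; apply: le_trans (frobeniusM _ _) _.
by rewrite ler_piMr ?frobenius_ge0.
Qed.

Lemma spectral_norm_leP m n (A : 'M[R]_(m, n)) t :
  spectral_norm A <= t <->
  forall x : 'cV[R]_n, frobenius x <= 1 -> frobenius (A *m x) <= t.
Proof.
have hA := spectral_norm_has_sup A; split=> [At x x1|At].
  by apply: le_trans At; apply: sup_upper_bound => //; exists x.
by apply: ge_sup; [exact: hA.1|move=> _ [x x1 <-]; exact: At].
Qed.

Lemma spectral_norm_ge0 m n (A : 'M[R]_(m, n)) : 0 <= spectral_norm A.
Proof.
have /spectral_norm_leP/(_ 0) := lexx (spectral_norm A).
by rewrite mulmx0 !frobenius0; exact.
Qed.

Lemma spectral_norm_bound m n (A : 'M[R]_(m, n)) t (x : 'cV[R]_n) :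
  spectral_norm A <= t -> frobenius (A *m x) <= t * frobenius x.
Proof.
move=> At; have [x0|x0] := eqVneq (frobenius x) 0.
  by rewrite (frobenius_eq0 x0) mulmx0 !frobenius0 mulr0.
have xp : 0 < frobenius x by rewrite lt_neqAle eq_sym x0 frobenius_ge0.
have frobZ k a (v : 'cV[R]_k) : 0 <= a -> frobenius (a *: v) = a * frobenius v.
  move=> a0; apply: (@pexpIrn _ 2) => //;
    rewrite ?nnegrE ?mulr_ge0 ?frobenius_ge0//.
  rewrite exprMn !frobenius_trace !linearZ /= -scalemxAl linearZ /= mulrA.
  by rewrite expr2.
have i0 : 0 <= (frobenius x)^-1 by rewrite invr_ge0 ltW.
have := (spectral_norm_leP A t).1 At ((frobenius x)^-1 *: x).
rewrite -scalemxAr !frobZ// mulVf// lexx => /(_ isT).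
by rewrite ler_pdivrMl// mulrC.
Qed.

End frobenius_norm.

(** * Quadratic forms and symmetric square roots *)

Section quadratic_forms.
Context {R : realType}.

Lemma quad_mul n k (A : 'M[R]_n) (B : 'M[R]_(n, k)) (x : 'cV[R]_k) :
  x^T *m (B^T *m A *m B) *m x = (B *m x)^T *m A *m (B *m x).
Proof. by rewrite trmx_mul !mulmxA. Qed.

Lemma sym_square_possemidef n (B : 'M[R]_n) : B^T = B -> possemidef (B *m B).
Proof.
move=> BT; split=> [|x]; first by rewrite trmx_mul BT.
have -> : x^T *m (B *m B) *m x = (B *m x)^T *m (B *m x).
  by rewrite trmx_mul BT !mulmxA.
by rewrite -frobenius_cV sqr_ge0.
Qed.

Lemma sym_possemidef n (A : 'M[R]_n) :
  A^T = A -> (forall b, eigenvalue A b -> 0 <= b) -> possemidef A.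
Proof.
move=> AT A0; have [C [CT <-]] := sym_fourth_root AT A0.
by apply: sym_square_possemidef; rewrite trmx_mul CT.
Qed.

Lemma rV_sqr_gt0 n (v : 'rV[R]_n) : v != 0 -> 0 < (v *m v^T) 0 0.
Proof.
move=> v0; rewrite -[X in X *m _]trmxK -frobenius_cV frobenius_trmx.
rewrite exprn_gt0// lt_neqAle frobenius_ge0 andbT eq_sym.
by apply: contra v0 => /eqP/frobenius_eq0 ->.
Qed.

Lemma possemidef_eigenvalue n (A : 'M[R]_n) b :
  possemidef A -> eigenvalue A b -> 0 <= b.
Proof.
move=> [_ A0] /eigenvalueP[v vA v0].
have := A0 v^T; rewrite trmxK vA -scalemxAl mxE.
by rewrite pmulr_lge0// rV_sqr_gt0.
Qed.

(** The fourth root C shows that the choice in [sqrtmx] is not vacuous: C C is a square root of A,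
    and it is positive semidefinite as the square of a symmetric matrix. *)
Lemma sqrtmxP n (A : 'M[R]_n) : possemidef A ->
  possemidef (sqrtmx A) /\ sqrtmx A *m sqrtmx A = A.
Proof.
move=> Apsd; rewrite /sqrtmx; case: xgetP => [B _ //|/(_ _)/= H].
have [C [CT CA]] := sym_fourth_root Apsd.1 (fun b =>
  possemidef_eigenvalue Apsd).
by case: (H (C *m C)); split=> //; exact: sym_square_possemidef.
Qed.

Lemma trmx_sqrtmx n (A : 'M[R]_n) : possemidef A -> (sqrtmx A)^T = sqrtmx A.
Proof. by move=> /sqrtmxP[[]]. Qed.

(** The Loewner bound A >= c I. Unlike a bound on eigenvalues, it passes directly to compressions
    E^T A E and to small perturbations. *)
Definition quad_ge n (c : R) (A : 'M[R]_n) : Prop :=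
  A^T = A /\ forall x : 'cV[R]_n, c * frobenius x ^+ 2 <= (x^T *m A *m x) 0 0.

Lemma quad_ge_possemidef n c (A : 'M[R]_n) :
  0 <= c -> quad_ge c A -> possemidef A.
Proof.
move=> c0 [AT Ac]; split=> // x; apply: le_trans (Ac x).
by rewrite mulr_ge0// sqr_ge0.
Qed.

Lemma posdef_possemidef n (A : 'M[R]_n) : posdef A -> possemidef A.
Proof.
move=> [AT A0]; split=> // x; have [->|/A0/ltW//] := eqVneq x 0.
by rewrite mulmx0 mxE.
Qed.

Lemma quad_ge_unitmx n c (A : 'M[R]_n) : 0 < c -> quad_ge c A -> A \in unitmx.
Proof.
move=> c0 [AT Ac]; rewrite -row_free_unit -kermx_eq0;
  apply/eqP/row_matrixP => i.
rewrite row0; apply/eqP; apply: contraT => v0.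
have /sub_kermxP vA : (row i (kermx A) <= kermx A)%MS by exact: row_sub.
have := Ac (row i (kermx A))^T; rewrite trmxK vA mul0mx mxE.
have : 0 < frobenius (row i (kermx A))^T ^+ 2.
  by rewrite frobenius_cV trmxK rV_sqr_gt0.
by move=> /(mulr_gt0 c0) /lt_geF ->.
Qed.

Lemma posdef_unitmx n (A : 'M[R]_n) : posdef A -> A \in unitmx.
Proof.
move=> [AT A0]; rewrite -row_free_unit -kermx_eq0; apply/eqP/row_matrixP => i.
rewrite row0; apply/eqP; apply: contraT => v0.
have /sub_kermxP vA : (row i (kermx A) <= kermx A)%MS by exact: row_sub.
have := A0 (row i (kermx A))^T; rewrite trmxK vA mul0mx mxE ltxx; apply.
by apply: contra v0; rewrite -trmx0 => /eqP/trmx_inj ->.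
Qed.

(** The shifted matrix A - c I is symmetric with nonnegative eigenvalues, hence positive
    semidefinite. *)
Lemma eigenvalue_quad_ge n c (A : 'M[R]_n) :
  A^T = A -> (forall b, eigenvalue A b -> c <= b) -> quad_ge c A.
Proof.
move=> AT Ac; split=> // x.
have [||_ H] := @sym_possemidef n (A - c%:M).
- by rewrite linearB /= AT tr_scalar_mx.
- move=> b /eigenvalueP[v vA v0]; rewrite -(lerD2r c) add0r; apply: Ac.
  apply/eigenvalueP; exists v => //; rewrite scalerDl -vA mulmxBr mul_mx_scalar.
  by rewrite subrK.
have := H x; rewrite mulmxBr mulmxBl mul_mx_scalar -scalemxAl mxE.
by rewrite [X in _ + X]mxE [X in _ - X]mxE -frobenius_cV subr_ge0.
Qed.

(** A left eigenvector of D for b is one of A for b^2, so c <= b^2; positive semidefiniteness of D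
    selects the nonnegative root. *)
Lemma sqrtmx_quad_ge n c (A D : 'M[R]_n) :
  0 <= c -> quad_ge c A -> possemidef D -> D *m D = A -> quad_ge (Num.sqrt c) D.
Proof.
move=> c0 [AT Ac] Dpsd DA; apply: eigenvalue_quad_ge; first exact: Dpsd.1.
move=> b eb; have b0 := possemidef_eigenvalue Dpsd eb.
move/eigenvalueP: eb => [v vD v0].
have := Ac v^T; rewrite trmxK -DA mulmxA vD -scalemxAl vD scalerA -scalemxAl.
rewrite frobenius_cV trmxK [leRHS]mxE ler_pM2r ?rV_sqr_gt0// -expr2 => cb.
by rewrite -(ger0_norm b0) -sqrtr_sqr ler_wsqrtr.
Qed.

Lemma mxtrace_quad m n (F : 'M[R]_n) (E : 'M[R]_(n, m)) :
  \tr (E^T *m (F *m E)) = \sum_j ((col j E)^T *m F *m col j E) 0 0.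
Proof.
apply: eq_bigr => j _; rewrite -mulmxA [LHS]mxE [RHS]mxE.
apply: eq_bigr => k _; congr *%R; first by rewrite !mxE.
by rewrite [RHS]mxE [LHS]mxE; apply: eq_bigr => l _; rewrite [col _ _ _ _]mxE.
Qed.

(* With E = D - D0 one has D E + E D0 = D^2 - D0^2, and pairing this
   identity with E bounds E from above. *)
Lemma square_root_lipschitz n c (D D0 : 'M[R]_n) :
  0 < c -> possemidef D -> possemidef D0 -> quad_ge c (D0 *m D0) ->
  Num.sqrt c * frobenius (D - D0) <= frobenius (D *m D - D0 *m D0).
Proof.
move=> c0 Dpsd D0psd A0c.
have D0c := sqrtmx_quad_ge (ltW c0) A0c D0psd erefl.
set E := D - D0.
have ET : E^T = E by rewrite linearB /= Dpsd.1 D0psd.1.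
have [E0|E0] := eqVneq (frobenius E) 0.
  by rewrite E0 mulr0 frobenius_ge0.
have Ep : 0 < frobenius E by rewrite lt_neqAle eq_sym E0 frobenius_ge0.
have EE : D *m D - D0 *m D0 = D *m E + E *m D0.
  by rewrite mulmxBr mulmxBl addrA subrK.
rewrite -(ler_pM2l Ep); apply: le_trans (mxtrace_mul_le _ _).
have -> : \tr (E^T *m (D *m D - D0 *m D0)) =
    \tr (E^T *m (D *m E)) + \tr (E^T *m (D0 *m E)).
  have <- : \tr (E^T *m (E *m D0)) = \tr (E^T *m (D0 *m E)).
    by rewrite ET mxtrace_mulC mulmxA.
  by rewrite EE mulmxDr linearD.
have -> : frobenius E * (Num.sqrt c * frobenius E) =
    \sum_j Num.sqrt c * frobenius (col j E) ^+ 2.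
  by rewrite -mulr_sumr -frobenius_col expr2 mulrCA.
(* Only D0 needs a quantitative lower bound: the term with D is merely nonnegative. *)
rewrite !mxtrace_quad -[leLHS]add0r lerD//.
  by rewrite sumr_ge0// => j _; exact: Dpsd.2.
by apply: ler_sum => j _; exact: D0c.2.
Qed.

End quadratic_forms.

(** * Perturbation of the matrix H *)

Section design_matrix_bounds.
Context {R : realType}.

Lemma sym_quad_le n (A : 'M[R]_n) t (x : 'cV[R]_n) :
  spectral_norm A <= t -> (x^T *m A *m x) 0 0 <= t * frobenius x ^+ 2.
Proof.
move=> At; have -> : (x^T *m A *m x) 0 0 = \tr (x^T *m (A *m x)).
  by rewrite /mxtrace big_ord1 mulmxA.
apply: le_trans (mxtrace_mul_le _ _) _.
rewrite expr2 mulrCA ler_wpM2l ?frobenius_ge0//; exact: spectral_norm_bound.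
Qed.

Lemma quad_ge_frobenius n c (D : 'M[R]_n) (x : 'cV[R]_n) :
  quad_ge c D -> c * frobenius x <= frobenius (D *m x).
Proof.
move=> [_ /(_ x)]; have [x0 _|x0] := eqVneq (frobenius x) 0.
  by rewrite x0 mulr0 frobenius_ge0.
have xp : 0 < frobenius x by rewrite lt_neqAle eq_sym x0 frobenius_ge0.
have -> : (x^T *m D *m x) 0 0 = \tr (x^T *m (D *m x)).
  by rewrite /mxtrace big_ord1 mulmxA.
move=> /le_trans/(_ (mxtrace_mul_le _ _)).
by rewrite expr2 mulrCA ler_pM2l.
Qed.

(** With D the square root of A, |A x|^2 is the form of A at D x, at most |hi| |D x|^2, and |D x|^2
    is the form of A at x. The absolute value covers dimension 0, where no eigenvalue forces [hi] to
    be nonnegative. *)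
Lemma eigenvalue_frobenius_le n lo hi (A : 'M[R]_n) (x : 'cV[R]_n) :
  0 <= lo -> A^T = A -> (forall b, eigenvalue A b -> lo <= b <= hi) ->
  frobenius (A *m x) <= `|hi| * frobenius x.
Proof.
move=> lo0 AT Aev.
have Apsd : possemidef A.
  by apply: sym_possemidef => // b /Aev /andP[+ _]; exact: le_trans.
have Ahi (y : 'cV[R]_n) : (y^T *m A *m y) 0 0 <= `|hi| * frobenius y ^+ 2.
  have [|b|_ /(_ y)] := @eigenvalue_quad_ge _ _ (- `|hi|) (- A).
  - by rewrite linearN /= AT.
  - move=> /eigenvalueP[v vA v0]; rewrite lerNl (le_trans _ (ler_norm hi))//.
    have /Aev/andP[] // : eigenvalue A (- b).
    apply/eigenvalueP; exists v => //.
    by rewrite scaleNr -vA mulmxN opprK.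
  - by rewrite mulmxN mulNmx [X in _ <= X]mxE mulNr lerN2.
have [Dpsd DA] := sqrtmxP Apsd; set D := sqrtmx A in Dpsd DA *.
have DT : D^T = D := Dpsd.1.
rewrite -(@ler_pXn2r _ 2)// ?nnegrE ?mulr_ge0 ?frobenius_ge0//.
have -> : frobenius (A *m x) ^+ 2 = ((D *m x)^T *m A *m (D *m x)) 0 0.
  by rewrite frobenius_cV !trmx_mul AT DT -{1 2 3}DA !mulmxA.
apply: le_trans (Ahi _) _; rewrite exprMn expr2 -mulrA ler_wpM2l//.
apply: le_trans (Ahi x).
by rewrite -[leLHS]/(frobenius (D
  *m x) ^+ 2) frobenius_cV trmx_mul DT -DA !mulmxA.
Qed.

(** Turns the selection of columns into multiplication by a matrix with orthonormal columns, so that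
    submatrices obey matrix algebra. *)
Definition selmx p (S : {set 'I_p}) : 'M[R]_(p, #|S|) := subcol S 1%:M.

Lemma subcolE m p (S : {set 'I_p}) (A : 'M[R]_(m, p)) :
  subcol S A = A *m selmx S.
Proof. by rewrite /selmx /subcol mulmx_colsub mulmx1. Qed.

Lemma selmx_tr p (S : {set 'I_p}) : (selmx S)^T *m selmx S = 1%:M.
Proof.
apply/matrixP => i j; rewrite !mxE (bigD1 (enum_val i))//= big1 ?addr0.
  by rewrite !mxE eqxx mul1r (inj_eq enum_val_inj).
by move=> k /negPf ki; rewrite !mxE ki mul0r.
Qed.

Lemma frobenius_selmxl m p (S : {set 'I_p}) (A : 'M[R]_(#|S|, m)) :
  frobenius (selmx S *m A) = frobenius A.
Proof.
apply: (@pexpIrn _ 2) => //; rewrite ?nnegrE ?frobenius_ge0//.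
by rewrite !frobenius_trace trmx_mul mulmxA -[_ *m _
  *m selmx S]mulmxA selmx_tr mulmx1.
Qed.

(** With B = E^T A, |B|^2 is the inner product of A and E B, and E is isometric: Cauchy-Schwarz
    gives |B|^2 <= |A| |B|. *)
Lemma frobenius_tr_selmxl m p (S : {set 'I_p}) (A : 'M[R]_(p, m)) :
  frobenius ((selmx S)^T *m A) <= frobenius A.
Proof.
set B := _ *m A; have [B0|B0] := eqVneq (frobenius B) 0.
  by rewrite B0 frobenius_ge0.
have Bp : 0 < frobenius B by rewrite lt_neqAle eq_sym B0 frobenius_ge0.
rewrite -(ler_pM2r Bp) -expr2 frobenius_trace.
rewrite {1}/B trmx_mul trmxK -mulmxA -[X in _ * X](frobenius_selmxl B).
exact: mxtrace_mul_le.
Qed.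

(** The origin of the factor |S|^(1/2), hence of K_n^(1/2) in the rate. *)
Lemma frobenius_selmx p (S : {set 'I_p}) :
  frobenius (selmx S) = Num.sqrt #|S|%:R.
Proof.
apply: (@pexpIrn _ 2) => //; rewrite ?nnegrE ?frobenius_ge0 ?sqrtr_ge0//.
by rewrite frobenius_trace selmx_tr mxtrace1 sqr_sqrtr.
Qed.

Lemma frobenius_diag_mxl m p (s : 'rV[R]_p) k (A : 'M[R]_(p, m)) :
  0 <= k -> (forall j, 0 <= s 0 j <= k) ->
  frobenius (diag_mx s *m A) <= k * frobenius A.
Proof.
move=> k0 sk; rewrite -(@ler_pXn2r _ 2)// ?nnegrE ?mulr_ge0 ?frobenius_ge0//.
rewrite exprMn !frobenius_sqr mulr_sumr; apply: ler_sum => i _.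
rewrite mulr_sumr; apply: ler_sum => j _.
rewrite mul_diag_mx mxE exprMn ler_wpM2r ?sqr_ge0//.
by have /andP[_a _b] := sk i; rewrite ler_pXn2r// nnegrE.
Qed.

Lemma frobenius_block0 m p (U : 'M[R]_(m, p)) (V : 'M[R]_p) :
  frobenius (block_mx (0 : 'M[R]_m) U 0 V) <= frobenius U + frobenius V.
Proof.
rewrite -(@ler_pXn2r _ 2)// ?nnegrE ?addr_ge0 ?frobenius_ge0//.
apply: (@le_trans _ _ (frobenius U ^+ 2 + frobenius V ^+ 2)); last first.
  by rewrite sqrrD lerD2r lerDl mulrn_wge0// mulr_ge0 ?frobenius_ge0.
rewrite !frobenius_sqr big_split_ord /=; apply: lerD; apply: ler_sum => i _.
  rewrite big_split_ord /= big1 => [|j _];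
    last by rewrite block_mxEul mxE expr0n.
  by rewrite add0r; apply: ler_sum => j _; rewrite block_mxEur.
rewrite big_split_ord /= big1 => [|j _]; last by rewrite block_mxEdl mxE expr0n.
by rewrite add0r; apply: ler_sum => j _; rewrite block_mxEdr.
Qed.

Section fixed_dimension.
Variables (p : nat) (s : 'rV[R]_p) (Om0 : 'M[R]_p) (lo hi c : R).
Hypotheses (lo0 : 0 < lo) (c0 : 0 < c) (s0 : forall j, 0 <= s 0 j).
Hypothesis Om0_pd : posdef Om0.
Hypothesis Om0_ev : forall b, eigenvalue Om0 b -> lo <= b <= hi.
Hypothesis B2_ev : forall b, eigenvalue (B2mx s Om0) b -> c <= b.

Lemma trmx_B2mx (Om : 'M[R]_p) : Om^T = Om -> (B2mx s Om)^T = B2mx s Om.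
Proof.
move=> OmT.
by rewrite linearB /= linearZ /= !trmx_mul !tr_diag_mx OmT mulmxA.
Qed.

Lemma B2mx_quad_ge0 : quad_ge c (B2mx s Om0).
Proof. by apply: eigenvalue_quad_ge => //; apply: trmx_B2mx; case: Om0_pd. Qed.

Let quad_delta (A : 'M[R]_p) j :
  ((delta_mx j 0 : 'cV[R]_p)^T *m A *m (delta_mx j 0 : 'cV[R]_p)) 0 0 = A j j.
Proof.
rewrite trmx_delta -rowE [LHS]mxE (bigD1 j)//= big1 ?addr0.
  by rewrite !mxE !eqxx mulr1.
by move=> i /negPf ij; rewrite !mxE ij mulr0.
Qed.

Let delta1 j : frobenius (delta_mx j 0 : 'cV[R]_p) ^+ 2 = 1.
Proof. by rewrite frobenius_cV trmx_delta mul_delta_mx mxE !eqxx. Qed.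

(** The lower bound on [B2mx s Om0], tested on the j-th basis vector. It forces both s_j > 0 and
    Om0_jj s_j < 2, whence s_j <= 2 / lo. *)
Let B2_diag_ge j : c <= s 0 j * (2 - Om0 j j * s 0 j).
Proof.
have := B2mx_quad_ge0.2 (delta_mx j 0); rewrite quad_delta delta1 mulr1.
rewrite !mxE eqxx mulr1n mul_diag_mx.
have -> : \sum_j0 (\matrix_(i, j1) (s 0 i * Om0 i j1)) j j0 * diag_mx s j0 j =
   s 0 j * Om0 j j * s 0 j.
  rewrite (bigD1 j)//= big1 ?addr0 => [|k kj];
    first by rewrite !mxE eqxx mulr1n.
  by rewrite !mxE (negPf kj) mulr0n mulr0.
by move=> h; rewrite mulrBr mulrA (mulrC _ 2).
Qed.

Lemma s_gt0 j : 0 < s 0 j.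
Proof.
rewrite lt_neqAle eq_sym s0 andbT; apply/eqP => sj.
by have := B2_diag_ge j; rewrite sj mul0r leNgt c0.
Qed.

Lemma s_le j : s 0 j <= 2 / lo.
Proof.
have [_ /(_ (delta_mx j 0))] : quad_ge lo Om0.
  by apply: eigenvalue_quad_ge => [|b /Om0_ev/andP[]//]; case: Om0_pd.
rewrite quad_delta delta1 mulr1 => Omj.
rewrite ler_pdivlMr//; have := lt_le_trans c0 (B2_diag_ge j).
rewrite pmulr_rgt0 ?s_gt0// subr_gt0 => /ltW; apply: le_trans.
by rewrite mulrC ler_pM2r// s_gt0.
Qed.

Let k := 2 / lo.
Let k0 : 0 <= k. Proof. by rewrite divr_ge0// ltW. Qed.
Let sk j : 0 <= s 0 j <= k. Proof. by rewrite s0 s_le. Qed.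

Section perturbation.
Variables (Om : 'M[R]_p) (t : R).
Hypotheses (OmT : Om^T = Om) (Omt : spectral_norm (Om - Om0) <= t).

Let t0 : 0 <= t. Proof. exact: le_trans (spectral_norm_ge0 _) Omt. Qed.

Lemma B2mxB : B2mx s Om0 - B2mx s Om =
  diag_mx s *m (Om - Om0) *m diag_mx s.
Proof.
by rewrite mulmxBr mulmxBl /B2mx opprB addrC addrA subrK.
Qed.

(** The term diag(s) (Om - Om0) diag(s) moves the quadratic form by at most t k^2 |x|^2, so half of
    c survives. *)
Lemma B2mx_quad_ge : t * k ^+ 2 <= c / 2 -> quad_ge (c / 2) (B2mx s Om).
Proof.
move=> tk; split; first exact: trmx_B2mx.
move=> x; have := B2mx_quad_ge0.2 x.
have -> : B2mx s Om0 = B2mx s Om + diag_mx s *m (Om - Om0) *m diag_mx s.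
  by rewrite -B2mxB addrC subrK.
rewrite mulmxDr mulmxDl mxE.
have -> : x^T *m (diag_mx s *m (Om - Om0) *m diag_mx s) *m x =
    (diag_mx s *m x)^T *m (Om - Om0) *m (diag_mx s *m x).
  by rewrite trmx_mul tr_diag_mx !mulmxA.
have h1 := sym_quad_le (diag_mx s *m x) Omt.
have h2 : frobenius (diag_mx s *m x) ^+ 2 <= (k * frobenius x) ^+ 2.
  rewrite ler_pXn2r// ?nnegrE ?(mulr_ge0 k0) ?frobenius_ge0//.
  exact: frobenius_diag_mxl.
have h3 : t * frobenius (diag_mx s *m x) ^+ 2 <= c / 2 * frobenius x ^+ 2.
  apply: le_trans (ler_wpM2l t0 h2) _.
  by rewrite exprMn mulrA ler_wpM2r// sqr_ge0.
lra.
Qed.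

Section submodel.
Variable S : {set 'I_p}.

Let E := selmx S.

(** The square root B is symmetric, so it disappears from the Gram matrix, which is thus affine in
    [Om']. *)
Lemma gram_Bmx (Om' : 'M[R]_p) : possemidef (B2mx s Om') ->
  (subcol S (Bmx s Om'))^T *m subcol S (Bmx s Om') = E^T *m B2mx s Om' *m E.
Proof.
move=> B2psd; have [[BT _] BB] := sqrtmxP B2psd.
by rewrite subcolE trmx_mul /Bmx BT -[in RHS]BB !mulmxA.
Qed.

Lemma quad_ge_sel b (A : 'M[R]_p) : quad_ge b A -> quad_ge b (E^T *m A *m E).
Proof.
move=> [AT Ab]; split; first by rewrite !trmx_mul trmxK AT mulmxA.
by move=> x; rewrite quad_mul -(frobenius_selmxl x); exact: Ab.
Qed.

Let B0 := subcol S (Bmx s Om0).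
Let B := subcol S (Bmx s Om).
Let D0 := sqrtmx (B0^T *m B0).
Let D := sqrtmx (B^T *m B).

Let A0_ge : quad_ge c (B0^T *m B0).
Proof.
rewrite gram_Bmx; first exact: quad_ge_sel B2mx_quad_ge0.
by apply: quad_ge_possemidef B2mx_quad_ge0; exact: ltW.
Qed.

Let D0_spec : possemidef D0 /\ D0 *m D0 = B0^T *m B0.
Proof. by apply: sqrtmxP; apply: quad_ge_possemidef A0_ge; exact: ltW. Qed.

Let D0_ge : quad_ge (Num.sqrt c) D0.
Proof.
have [D0psd D0E] := D0_spec.
by apply: sqrtmx_quad_ge D0E => //; exact: ltW.
Qed.

Let D0_unit : D0 \in unitmx.
Proof. by apply: quad_ge_unitmx D0_ge; rewrite sqrtr_gt0. Qed.

Lemma Hmx_id : Hmx s Om0 Om0 S = 1%:M.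
Proof.
rewrite /Hmx -/B0 -/D0 mulVmx// mulmx1 subrr.
by rewrite -scalar_mx_block.
Qed.

(** Origin of the constant: the change of C_S contributes k. The block V = M - 1 is bounded by (k^2
    / c) |S|^(1/2) t, one factor c^(-1/2) coming from the inverse of D0 and the other from the
    Lipschitz bound on square roots. V occurs once alone and once behind C0_S, which costs 1 + |hi|
    k, hence 2 + |hi| k in total. *)
Lemma frobenius_Hmx_sub : t * k ^+ 2 <= c / 2 ->
  frobenius (Hmx s Om0 Om S - Hmx s Om0 Om0 S) <=
  (k + (2 + `|hi| * k) * (k ^+ 2 / c)) * Num.sqrt #|S|%:R * t.
Proof.
move=> tk; have B2_ge := B2mx_quad_ge tk.
have c20 : 0 < c / 2 by rewrite divr_gt0.
have B2psd := quad_ge_possemidef (ltW c20) B2_ge.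
have [Dpsd DE] : possemidef D /\ D *m D = B^T *m B.
  apply: sqrtmxP; rewrite gram_Bmx//.
  by apply: quad_ge_possemidef (quad_ge_sel B2_ge); exact: ltW.
have [D0psd D0E] := D0_spec.
rewrite Hmx_id /Hmx -/B0 -/B -/D0 -/D scalar_mx_block opp_block_mx add_block_mx.
rewrite subrr !subr0.
set M := invmx D0 *m D; set V := M - 1%:M.
set rS := Num.sqrt _.
have rS0 : 0 <= rS by exact: sqrtr_ge0.
have dS : frobenius (diag_mx s *m E) <= k * rS.
  by rewrite /rS -frobenius_selmx; exact: frobenius_diag_mxl.
have spec_mul m (A : 'M[R]_(p, m)) :
    frobenius ((Om - Om0) *m A) <= t * frobenius A.
  by apply: frobenius_mul_bounded => // x; exact: spectral_norm_bound.
have VE : V = invmx D0 *m (D - D0) by rewrite mulmxBr mulVmx.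
have inv_le m (A : 'M[R]_(#|S|, m)) :
    frobenius (invmx D0 *m A) <= (Num.sqrt c)^-1 * frobenius A.
  apply: frobenius_mul_bounded => [|x]; first by rewrite invr_ge0 sqrtr_ge0.
  rewrite ler_pdivlMl ?sqrtr_gt0//;
    apply: le_trans (quad_ge_frobenius _ D0_ge) _.
  by rewrite mulKVmx.
have DD0 : frobenius (D - D0) <=
    (Num.sqrt c)^-1 * (k ^+ 2 * rS * t).
  rewrite ler_pdivlMl ?sqrtr_gt0//.
  apply: le_trans (@square_root_lipschitz _ _ _ D D0 c0 Dpsd D0psd _) _.
    by rewrite D0E.
  rewrite DE D0E !gram_Bmx//; last by apply: quad_ge_possemidef B2mx_quad_ge0;
    exact: ltW.
  rewrite -mulmxBl -mulmxBr -opprB B2mxB mulmxN mulNmx frobeniusN.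
  rewrite -!mulmxA; apply: le_trans (frobenius_tr_selmxl _ _) _.
  apply: le_trans (frobenius_diag_mxl _ k0 sk) _.
  apply: le_trans (ler_wpM2l k0 (spec_mul _ _)) _.
  apply: le_trans (ler_wpM2l k0 (ler_wpM2l t0 dS)) _.
  by rewrite le_eqVlt; apply/orP; left; apply/eqP; ring.
have V_le : frobenius V <= k ^+ 2 / c * rS * t.
  rewrite VE; apply: le_trans (inv_le _ _) _.
  have ic0 : 0 <= (Num.sqrt c)^-1 by rewrite invr_ge0 sqrtr_ge0.
  apply: le_trans (ler_wpM2l ic0 DD0) _.
  rewrite mulrA -invfM -expr2 sqr_sqrtr ?(ltW c0)//.
  by rewrite le_eqVlt; apply/orP; left; apply/eqP; ring.
have C0_le : frobenius (subcol S (Cmx s Om0) *m V)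
  <= (1 + `|hi| * k) * frobenius V.
  rewrite subcolE mulmxBl mul1mx mulmxBl.
  apply: le_trans (frobeniusD _ _) _; rewrite frobeniusN frobenius_selmxl.
  rewrite mulrDl mul1r lerD2l -!mulmxA.
  have hiM m (A : 'M[R]_(p, m)) : frobenius (Om0 *m A) <= `|hi| * frobenius A.
    apply: frobenius_mul_bounded => // x.
    by apply: (@eigenvalue_frobenius_le _ lo); [exact: ltW|case: Om0_pd|].
  apply: le_trans (hiM _ _) _; rewrite -mulrA ler_wpM2l//.
  by apply: le_trans (frobenius_diag_mxl _ k0 sk) _; rewrite frobenius_selmxl.
have -> : block_mx 0 (subcol S (Cmx s Om) - subcol S (Cmx s Om0) *m M) 0 V =
  block_mx (0 : 'M[R]_p) (- ((Om - Om0) *m (diag_mx s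
    *m E)) - subcol S (Cmx s Om0) *m V) 0 V.
  have CE : subcol S (Cmx s Om) =
      subcol S (Cmx s Om0) - (Om - Om0) *m (diag_mx s *m E).
    by rewrite !subcolE /Cmx -/E mulmxA !mulmxBl opprB addrA subrK.
  by rewrite CE mulmxBr mulmx1 opprB addrA (addrC _ (subcol _ _)) addrAC.
apply: le_trans (frobenius_block0 _ _) _.
have := frobeniusD (- ((Om - Om0) *m (diag_mx s
  *m E))) (- (subcol S (Cmx s Om0) *m V)).
rewrite !frobeniusN.
have h1 := le_trans (spec_mul _ (diag_mx s *m E)) (ler_wpM2l t0 dS).
have h2 : (1 + `|hi| * k) * frobenius V
  <= (1 + `|hi| * k) * (k ^+ 2 / c * rS * t).
  by rewrite ler_wpM2l// addr_ge0// mulr_ge0.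
set X := frobenius (_ - _) => hX.
apply: (@le_trans _ _ (t * (k * rS) + (1 + `|hi| * k) * (k ^+ 2 / c * rS * t)
  + k ^+ 2 / c * rS * t)); first by lra.
by rewrite le_eqVlt; apply/orP; left; apply/eqP; ring.
Qed.

End submodel.
End perturbation.
End fixed_dimension.
End design_matrix_bounds.
(** * The threshold and the sign flips *)

Section selection.
Context {R : realType} {p : nat}.
Implicit Types (W : 'I_p -> R) (q t : R) (N : {set 'I_p}).

Definition abs_at (j : 'I_p) W : 'I_p -> R :=
  fun k => if k == j then `|W k| else W k.

Definition flip_at (j : 'I_p) W : 'I_p -> R :=
  fun k => if k == j then - W k else W k.

Lemma threshold_cases q W :
  threshold q W = +oo%E \/
  exists2 j, (W j != 0) && admissible q W `|W j| & threshold q W = (`|W j|)%:E.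
Proof.
pose K (x : \bar R) := x
  = +oo%E \/ exists2 j, (W j != 0) && admissible q W `|W j| & x = (`|W j|)%:E.
rewrite -/(K _) /threshold; apply: (big_ind K) => [|x y Hx Hy|j Hj];
  first by left.
  by rewrite minEle; case: ifP.
by right; exists j.
Qed.

Lemma threshold_le q W j :
  W j != 0 -> admissible q W `|W j| -> (threshold q W <= (`|W j|)%:E)%E.
Proof.
by move=> Wj adm; rewrite /threshold bigmin_le_cond// Wj adm.
Qed.

(* The threshold is computed with the sign of W_j forced to be positive, so
   that it does not depend on that sign. *)
Definition null_weight q N (j : 'I_p) W : R :=
  let T := threshold q (abs_at j W) in
  if (0 < W j) && (T <= (W j)%:E)%E then
    (1 + #|[set k in N | (k != j) && ((W k)%:E <= - T)%E]%SET|%:R)^-1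
  else 0.

Lemma null_weight_ge0 q N j W : 0 <= null_weight q N j W.
Proof. by rewrite /null_weight; case: ifP => // _;
  rewrite invr_ge0 addr_ge0. Qed.

Lemma fdp_ge0 N S : 0 <= fdp N S :> R.
Proof. by rewrite /fdp divr_ge0. Qed.

Lemma fdp_le1 N S : fdp N S <= 1 :> R.
Proof.
rewrite /fdp; have [->|S0] := eqVneq S finset.set0.
  by rewrite cards0 invr0 mulr0.
rewrite ler_pdivrMr ?ltr0n ?card_gt0// mul1r ler_nat.
by rewrite subset_leq_card// finset.subsetIl.
Qed.

(** Admissibility at the threshold gives 1 / #selected <= q / (1 + neg). A selected j has W_j > 0,
    so forcing its sign changes nothing and T_j is the actual threshold; counting only null indices
    in the denominator can only enlarge the weight. *)
Lemma fdp_le_null_weight q N W : 0 <= q ->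
  fdp N (selected q W) <= q * \sum_(j in N) null_weight q N j W.
Proof.
move=> q0; have [Too|[i /andP[Wi /andP[pos0 adm]] TE]] := threshold_cases q W.
  have -> : selected q W = finset.set0.
    by apply/setP => j; rewrite !inE Too leye_eq.
  rewrite /fdp cards0 invr0 mulr0 mulr_ge0// sumr_ge0// => j _.
  exact: null_weight_ge0.
set t := `|W i| in pos0 adm TE.
have t0 : 0 < t by rewrite normr_gt0.
have selE : selected q W = [set j | t <= W j]%SET.
  by apply/setP => j; rewrite !inE TE lee_fin.
rewrite /fdp selE; set neg := #|[set j | W j <= - t]%SET| in adm.
set sel := [set j | t <= W j]%SET in adm pos0 *.
apply: (@le_trans _ _ (q * (#|sel :&: N|%:R / (1 + neg)%:R))).
  rewrite mulrCA ler_wpM2l//.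
  have sp : 0 < #|sel|%:R :> R by rewrite ltr0n.
  have np : 0 < (1 + neg)%:R :> R by rewrite ltr0n.
  by rewrite ler_pdivlMr// mulrC.
rewrite ler_wpM2l// mulr_natl -sumr_const.
rewrite (big_setID sel (A := N)) /= finset.setIC -[leLHS]addr0.
apply: lerD; last by rewrite sumr_ge0// => j _; exact: null_weight_ge0.
apply: ler_sum => j; rewrite !inE => /andP[jN tj].
have Wj : 0 < W j by exact: lt_le_trans tj.
have absE : abs_at j W = W.
  by apply/funext => k; rewrite /abs_at; case: eqP => // ->; rewrite gtr0_norm.
rewrite /null_weight absE TE Wj lee_fin tj /=.
rewrite lef_pV2 ?posrE ?ltr0n// ?ltr_pwDl// -natr1 addrC lerD2r ler_nat.
by apply/subset_leq_card/fintype.subsetP => k; rewrite !inE lee_fin => /and3P[].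
Qed.

Section one_vector.
Variables (q : R) (N : {set 'I_p}) (W : 'I_p -> R).

Let T j := threshold q (abs_at j W).
(** The indices whose weight survives the flip of their own sign. *)
Let J j := (W j < 0) && (T j <= (- W j)%:E)%E.

Let T_real j : J j -> exists2 i, W i != 0 &
  admissible q (abs_at j W) `|W i| /\ T j = (`|W i|)%:E.
Proof.
move=> /andP[_ Tj]; have [Too|[i /andP[Wi adm] TE]] := threshold_cases q
  (abs_at j W).
  by move: Tj; rewrite /T Too leye_eq.
have absE : `|abs_at j W i| = `|W i|.
  by rewrite /abs_at; case: ifP; rewrite ?normr_id.
by exists i; rewrite -?absE// -normr_gt0 -absE normr_gt0.
Qed.

(** Since W_j <= - t, forcing W_j to be positive moves exactly one index from the negative count to
    the positive one. The resulting condition does not mention j. *)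
Let admissible_abs_at j t : W j < 0 -> 0 < t -> t <= - W j ->
  admissible q (abs_at j W) t =
  (((1 + (#|[set i | W i <= - t]%SET|).-1)%:R /
    (#|[set i | t <= W i]%SET|.+1)%:R : R) <= q).
Proof.
move=> Wj t0 tj; rewrite /admissible.
have -> : [set i | t <= abs_at j W i]%SET = (j |: [set i | t <= W i])%SET.
  apply/setP => i; rewrite !inE /abs_at; case: eqP => [->|//].
  by rewrite ltr0_norm.
have -> : [set i | abs_at j W i <= - t]%SET = ([set i | (W i
  <= - t)%R] :\ j)%SET.
  apply/setP => i; rewrite !inE /abs_at; case: eqP => [->|//] /=.
  by apply/negbTE; rewrite -ltNge ltr0_norm//; lra.
rewrite cardsU1 !inE leNgt (lt_trans Wj t0) /= add1n /=.
congr ((_ / _) <= q); congr ((1 + _)%:R).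
by rewrite (cardsD1 j [set i | W i <= - t]%SET) inE lerNr tj.
Qed.

(* At the level T j, forcing the sign of W_j or that of W_k changes the numbers
   of exceedances in the same way. *)
Let T_le j k : J j -> J k -> (T j <= T k)%E -> T j = T k.
Proof.
move=> Jj Jk Tjk; apply/le_anti; rewrite Tjk /=.
have [i Wi [adm TjE]] := T_real Jj.
move: Jj Jk (Jk) => /andP[Wj Tj] /andP[Wk Tk] Jk.
have t0 : 0 < `|W i| by rewrite normr_gt0.
have tj : `|W i| <= - W j by rewrite -lee_fin -TjE.
have tk : `|W i| <= - W k by rewrite -lee_fin -TjE (le_trans Tjk).
have absE : `|abs_at k W i| = `|W i|.
  by rewrite /abs_at; case: ifP; rewrite ?normr_id.
rewrite TjE -absE; apply: threshold_le; first by rewrite -normr_gt0 absE.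
by rewrite absE admissible_abs_at// -(@admissible_abs_at j).
Qed.

Let T_eq j k : J j -> J k -> T j = T k.
Proof.
move=> Jj Jk; have [jk|kj] := leP (T j) (T k); first exact: T_le.
by apply/esym/T_le => //; exact: ltW.
Qed.

Lemma sum_null_weight_flip :
  \sum_(j in N) null_weight q N j (flip_at j W) <= 1.
Proof.
have weightE j : null_weight q N j (flip_at j W) =
    if J j then (1 + #|[set k in N | (k != j) && ((W k)%:E
      <= - T j)%E]%SET|%:R)^-1
    else 0.
  rewrite /null_weight.
  have -> : abs_at j (flip_at j W) = abs_at j W.
    by apply/funext => k; rewrite /abs_at /flip_at; case: (k == j);
      rewrite ?normrN.
  rewrite {1 2}/flip_at eqxx oppr_gt0 -/(T j) -/(J j); case: ifP => // _.
  congr (1 + #|pred_of_set _|%:R)^-1; apply/setP => k; rewrite !inE /flip_at.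
  by case: (k == j); rewrite ?andbF.
under eq_bigr do rewrite weightE.
rewrite -big_mkcondr /=.
have [j0 /andP[j0N Jj0]|noJ] := pickP [pred j | (j \in N) && J j]; last first.
  by rewrite big1// => j; have := noJ j; rewrite /= => ->.
have [i Wi [adm TE]] := T_real Jj0.
set tau := `|W i| in TE.
(* Every surviving index lies in A, and its denominator 1 + #(A minus j) is the common value #A; the
   sum is then at most #A / #A. *)
pose A := [set k in N | W k <= - tau]%SET.
have JA j : (j \in N) && J j -> j \in A.
  move=> /andP[jN Jj]; rewrite inE jN /= lerNr -lee_fin -TE (T_eq Jj0 Jj).
  by case/andP: Jj.
have A0 : (0 < #|A|)%N by rewrite card_gt0; apply/set0Pn; exists j0;
  rewrite JA ?j0N.
have Ac : #|A|%:R != 0 :> R by rewrite pnatr_eq0 -lt0n.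
apply: (@le_trans _ _ (\sum_(j in A) #|A|%:R^-1)); last first.
  by rewrite sumr_const -[_ *+ _]mulr_natl mulfV.
rewrite big_mkcond [leRHS]big_mkcond; apply: ler_sum => j _.
case: ifPn => [Jj|_]; last by case: ifP; rewrite ?invr_ge0.
rewrite (JA _ Jj); have -> //: 1 + #|[set k in N | (k != j) &&
    ((W k)%:E <= - T j)%E]%SET|%:R = #|A|%:R :> R.
rewrite (cardsD1 j A) (JA _ Jj) natrD; congr (1 + #|pred_of_set _|%:R).
case/andP: Jj => _ Jj; apply/setP => k.
by rewrite !inE -(T_eq Jj0 Jj) TE lee_fin andbCA.
Qed.

End one_vector.
End selection.
(** * Measurability and laws *)

Section measurable_matrices.
Context d (T : measurableType d) {R : realType}.

Lemma measurable_fun_mx d' (E : measurableType d') m n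
    (f : T -> 'M[E]_(m, n)) :
  (forall i j, measurable_fun setT (fun x => f x i j)) -> measurable_fun setT f.
Proof.
move=> mf; apply: (measurability (@mx_cylinders _ E m n)) => //.
move=> _ [_ [i [j [A mA ->]]] <-] /=.
by have := mf i j measurableT A mA.
Qed.

Lemma measurable_mx_entry d' (E : measurableType d') m n i j :
  measurable_fun setT (fun M : 'M[E]_(m, n) => M i j).
Proof.
move=> _ A mA; rewrite setTI; apply: sub_sigma_algebra.
by exists i, j, A.
Qed.

Lemma measurable_fun_entry d' (E : measurableType d') m n
    (f : T -> 'M[E]_(m, n)) i j :
  measurable_fun setT f -> measurable_fun setT (fun x => f x i j).
Proof. by move=> mf; apply: (measurableT_comp (measurable_mx_entry i j)). Qed.

Lemma measurable_mulmx m n k (f : T -> 'M[R]_(m, n)) (g : T -> 'M[R]_(n, k)) :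
  measurable_fun setT f -> measurable_fun setT g ->
  measurable_fun setT (fun x => f x *m g x).
Proof.
move=> mf mg; apply: measurable_fun_mx => i j.
under eq_fun do rewrite mxE.
by apply: measurable_sum => l; apply: measurable_funM;
  exact: measurable_fun_entry.
Qed.

Lemma measurable_addmx m n (f g : T -> 'M[R]_(m, n)) :
  measurable_fun setT f -> measurable_fun setT g ->
  measurable_fun setT (fun x => f x + g x).
Proof.
move=> mf mg; apply: measurable_fun_mx => i j.
under eq_fun do rewrite mxE.
by apply: measurable_funD; exact: measurable_fun_entry.
Qed.

Lemma measurable_oppmx m n (f : T -> 'M[R]_(m, n)) :
  measurable_fun setT f -> measurable_fun setT (fun x => - f x).
Proof.
move=> mf; apply: measurable_fun_mx => i j.
under eq_fun do rewrite mxE.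
by apply: measurableT_comp => //; exact: measurable_fun_entry.
Qed.

Lemma measurable_subcol m p (S : {set 'I_p}) (f : T -> 'M[R]_(m, p)) :
  measurable_fun setT f -> measurable_fun setT (fun x => subcol S (f x)).
Proof.
move=> mf; apply: measurable_fun_mx => i j.
by under eq_fun do rewrite mxE; exact: measurable_fun_entry.
Qed.

Lemma measurable_row m n i (f : T -> 'M[R]_(m, n)) :
  measurable_fun setT f -> measurable_fun setT (fun x => row i (f x)).
Proof.
move=> mf; apply: measurable_fun_mx => i' j.
by under eq_fun do rewrite mxE; exact: measurable_fun_entry.
Qed.

End measurable_matrices.

Section open_matrices.
Context {R : realType} {m n : nat}.

(** Boxes with rational centre and radius 1/(k+1) form a countable family exhausting U. This links
    the sigma-algebra generated by the entries with the topology of matrices. *)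
Lemma open_mx_measurable (U : set 'M[R]_(m, n)) :
  (forall A, U A -> exists2 e : R, 0 < e &
     forall B : 'M[R]_(m, n), (forall i j, `|B i j - A i j| < e) -> U B) ->
  measurable U.
Proof.
move=> Uop.
pose box (k : nat) (Q : 'M[rat]_(m, n)) : set 'M[R]_(m, n) :=
  [set A | forall i j, `|A i j - ratr (Q i j)| < k.+1%:R^-1].
pose P k Q := box k Q `<=` U.
have -> : U = \bigcup_k \bigcup_(Q in P k) box k Q.
  apply/seteqP; split=> [A /[dup] UA /Uop[e e0 eU]|A [k _ [Q kQ]]];
    last exact: kQ.
  (* Half of e, because points of a box around Q that contains A may lie at distance up to 2/(k+1)
     from A. *)
  have [k ke] : exists k : nat, k.+1%:R^-1 < e / 2.
    exists (Num.truncn (e / 2)^-1); rewrite -[ltRHS]invrK ltf_pV2 ?posrE//.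
    - by rewrite truncnS_gt.
    - by rewrite invr_gt0 divr_gt0.
  set del := k.+1%:R^-1 in ke; have del0 : 0 < del by rewrite invr_gt0.
  have rat_near i j : exists r : rat, `|A i j - ratr r| < del.
    have [|r] := @rat_in_itvoo _ (A i j - del) (A i j + del); first by lra.
    rewrite in_itv /= => /andP[r1 r2]; exists r.
    by rewrite ltr_norml; lra.
  pose Q := \matrix_(i, j) projT1 (cid (rat_near i j)).
  have AQ : box k Q A by move=> i j; rewrite mxE;
    exact: (projT2 (cid (rat_near i j))).
  exists k => //; exists Q => //= B BQ; apply: eU => i j.
  have -> : B i j - A i j
    = (B i j - ratr (Q i j)) + (ratr (Q i j) - A i j) by ring.
  apply: le_lt_trans (ler_normD _ _) _; have := BQ i j; have := AQ i j.
  by rewrite -/del (distrC (A i j)); lra.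
have mbox k Q : measurable (box k Q).
  have -> : box k Q = \bigcap_(ij in [set: 'I_m * 'I_n])
      [set A | `|A ij.1 ij.2 - ratr (Q ij.1 ij.2)| < k.+1%:R^-1].
    apply/seteqP; split=> A; first by move=> AQ [i j] _; exact: AQ.
    by move=> AQ i j; exact: (AQ (i, j)).
  apply: fin_bigcap_measurable => // -[i j] _ /=.
  apply: sub_sigma_algebra; exists i, j.
  exists [set x | `|x - ratr (Q i j)| < k.+1%:R^-1] => //.
  have -> : [set x : R | `|x - ratr (Q i j)| < k.+1%:R^-1] =
      [set` `](ratr (Q i j) - k.+1%:R^-1), (ratr (Q i j) + k.+1%:R^-1)[].
    move: (k.+1%:R^-1) (ratr _) => del r.
    by apply/seteqP; split=> x /=; rewrite in_itv /= ltr_norml => /andP[? ?];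
      apply/andP; split; lra.
  exact: measurable_itv.
apply: bigcupT_measurable => k; rewrite bigcup_mkcond.
apply: countable_bigcupT_measurable => [|Q]; first exact: countableP.
by case: ifP.
Qed.

End open_matrices.

(** * Measurability of the threshold and of the FDP *)

Section finite_valued.
Context d (T : measurableType d).

(** Cuts the space along the finitely many values of [S], so that no sigma-algebra is needed on [F].
    It handles index sets that depend on the data. *)
Lemma measurable_fun_fin d' (E : measurableType d') (F : finType) (S : T -> F)
    (f : F -> T -> E) :
  (forall a, measurable (S @^-1` [set a])) ->
  (forall a, measurable_fun setT (f a)) ->
  measurable_fun setT (fun x => f (S x) x).
Proof.
move=> mS mf _ B mB; rewrite setTI.
have -> : (fun x => f (S x) x) @^-1` B =
    \bigcup_(a in [set: F]) (S @^-1` [set a] `&` f a @^-1` B).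
  apply/seteqP; split=> [x Bx|x [a _ [/= <-]]//].
  by exists (S x).
apply: fin_bigcup_measurable => // a _; apply: measurableI => //.
by have := mf a measurableT B mB; rewrite setTI.
Qed.

Lemma measurable_fin_set p (b : T -> 'I_p -> bool) (S : {set 'I_p}) :
  (forall j, measurable_fun setT (fun x => b x j)) ->
  measurable ((fun x => [set j | b x j]%SET) @^-1` [set S]).
Proof.
move=> mb.
have -> : (fun x => [set j | b x j]%SET) @^-1` [set S] =
    \bigcap_(j in [set: 'I_p]) [set x | b x j = (j \in S)].
  apply/seteqP; split=> [x /= <- j _ /=|x xS /=]; first by rewrite inE.
  by apply/setP => j; rewrite inE; exact: xS.
apply: fin_bigcap_measurable => // j _.
by have := mb j measurableT [set j \in S]; rewrite setTI; exact.
Qed.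

Context {R : realType} {p : nat}.
Variable W : T -> 'I_p -> R.
Hypothesis mW : forall j, measurable_fun setT (fun x => W x j).

Lemma measurable_admissible q (t : T -> R) : measurable_fun setT t ->
  measurable_fun setT (fun x => admissible q (W x) (t x)).
Proof.
move=> mt.
pose h (P N : {set 'I_p}) := (0 < #|P|)%N && ((1 + #|N|)%:R / #|P|%:R <= q).
pose S1 x := [set j | t x <= W x j]%SET.
pose S2 x := [set j | W x j <= - t x]%SET.
apply: (@measurable_fun_fin _ _ _ S1 (fun P x => h P (S2 x))) => [P|P].
  by apply: measurable_fin_set => j; exact: measurable_fun_ler.
apply: (@measurable_fun_fin _ _ _ S2 (fun N x => h P N)) => [N|//].
apply: measurable_fin_set => j; apply: measurable_fun_ler => //.
exact: measurable_funN.
Qed.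

Lemma measurable_threshold q :
  measurable_fun setT (fun x => threshold q (W x)).
Proof.
rewrite /threshold; under eq_fun do rewrite big_mkcond /=.
elim: (index_enum _) => [|j s IH]; first by under eq_fun do rewrite big_nil;
  exact: measurable_cst.
under eq_fun do rewrite big_cons.
apply: measurable_mine => //; apply: measurable_fun_ifT => //.
- apply: measurable_and; last first.
    by apply: measurable_admissible;
      exact: measurableT_comp (@normr_measurable R setT) _.
  under eq_fun do rewrite -normr_gt0.
  by apply: measurable_fun_ltr => //;
    exact: measurableT_comp (@normr_measurable R setT) _.
- by apply/measurable_EFinP;
  exact: measurableT_comp (@normr_measurable R setT) _.
Qed.

Lemma measurable_fdp q N :
  measurable_fun setT (fun x => fdp N (selected q (W x)) : R).
Proof.
apply: (@measurable_fun_fin _ _ _ (fun x => selected q (W x)) (fun S _ =>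
  fdp N S)) => // S.
apply: measurable_fin_set => j; apply: measurable_fun_lee;
  first exact: measurable_threshold.
exact/measurable_EFinP.
Qed.

End finite_valued.

Section measurable_null_weight.
Context d (T : measurableType d) {R : realType} {p : nat}.
Variable W : T -> 'I_p -> R.
Hypothesis mW : forall j, measurable_fun setT (fun x => W x j).

Lemma measurable_null_weight q N j :
  measurable_fun setT (fun x => null_weight q N j (W x)).
Proof.
have mT : measurable_fun setT (fun x => threshold q (abs_at j (W x))).
  apply: (@measurable_threshold _ _ _ _ (fun x => abs_at j (W x))) => k.
  by rewrite /abs_at; case: (k == j) => //;
    exact: measurableT_comp (@normr_measurable R setT) _.
rewrite /null_weight; apply: measurable_fun_ifT => //.
  apply: measurable_and; first exact: measurable_fun_ltr.
  by apply: measurable_fun_lee => //; exact/measurable_EFinP.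
pose S x := [set k | (k \in N) &&
  ((k != j) && ((W x k)%:E <= - threshold q (abs_at j (W x)))%E)]%SET.
apply: (@measurable_fun_fin _ _ _ _ _ S (fun A _ => (1 + #|A|%:R)^-1 : R)) =>
  // A.
apply: measurable_fin_set => k; do 2 apply: measurable_and => //.
by apply: measurable_fun_lee; [exact/measurable_EFinP|exact: measurableT_comp].
Qed.

End measurable_null_weight.

(** * Integrals against densities, image laws and product laws *)

Section density.
Context d (T : measurableType d) {R : realType}.
Local Open Scope ereal_scope.
Import HBNNSimple.

(** The ladder of indicators, simple functions and monotone limits. It is used for the Gaussian
    density and for conditional probabilities seen as densities. *)
Lemma integral_density (mu nu : {measure set T -> \bar R}) (g : T ->
  R) (f : T -> \bar R) :
  measurable_fun setT g -> (forall x, 0 <= g x)%R ->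
  (forall A, measurable A -> nu A = \int[mu]_(x in A) (g x)%:E) ->
  measurable_fun setT f -> (forall x, 0 <= f x) ->
  \int[nu]_x f x = \int[mu]_x (f x * (g x)%:E).
Proof.
move=> mg g0 nuE mf f0.
have indicE A : measurable A ->
    \int[nu]_x (\1_A x)%:E = \int[mu]_x ((\1_A x)%:E * (g x)%:E).
  move=> mA; rewrite integral_indic// setIT nuE// integral_mkcond.
  by apply: eq_integral => x _; rewrite patchE indicE; case: ifP;
    rewrite ?mul1e ?mul0e.
have mI A : measurable A ->
  measurable_fun setT (fun x => (\1_A x)%:E * (g x)%:E).
  move=> mA; apply: emeasurable_funM; last exact/measurable_EFinP.
  exact/measurable_EFinP/measurable_indic.
have nnE (h : {nnsfun T >-> R}) :
    \int[nu]_x (h x)%:E = \int[mu]_x ((h x)%:E * (g x)%:E).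
  under [LHS]eq_integral do rewrite fimfunE -fsumEFin//.
  rewrite [LHS]ge0_integral_fsum//; last 2 first.
    - by move=> r; exact/measurable_EFinP/measurableT_comp.
    - by move=> n x _; rewrite EFinM nnfun_muleindic_ge0.
  under [RHS]eq_integral.
    move=> x xD; rewrite fimfunE -fsumEFin// ge0_mule_fsuml; last first.
      by move=> r; rewrite EFinM nnfun_muleindic_ge0.
    over.
  rewrite [RHS]ge0_integral_fsum//; last 2 first.
    - move=> r; apply: emeasurable_funM; last exact/measurable_EFinP.
      by apply/measurable_EFinP; do 2 apply/measurableT_comp => //.
    - move=> n x _; apply: mule_ge0; last by rewrite lee_fin.
      by rewrite EFinM nnfun_muleindic_ge0.
  apply: eq_fsbigr => r _.
  rewrite integralZl_indic_nnsfun//.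
  have mr : measurable (h @^-1` [set r]) by [].
  have [r0|r0] := leP 0%R r; last first.
    rewrite preimage_nnfun0// !integral0_eq ?mule0// => x _.
      by rewrite indic0 mulr0 mul0e.
    by rewrite indic0.
  rewrite -[LHS]/(_ * _) indicE// -ge0_integralZl//; [|exact: mI|].
  - by apply: eq_integral => x _; rewrite EFinM muleA.
  - by move=> x _; rewrite mule_ge0// lee_fin.
pose h := nnsfun_approx measurableT mf.
have mh n : measurable_fun setT (fun x => (h n x)%:E * (g x)%:E).
  by apply: emeasurable_funM; exact/measurable_EFinP.
transitivity (limn (fun n => \int[nu]_x (h n x)%:E)).
  rewrite -monotone_convergence//=.
  - apply: eq_integral => x _; apply/esym/cvg_lim => //=.
    exact: cvg_nnsfun_approx.
  - by move=> n; exact/measurable_EFinP.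
  - by move=> n x _; rewrite lee_fin.
  - by move=> x _ m n mn; rewrite lee_fin; exact/lefP/nd_nnsfun_approx.
transitivity (limn (fun n => \int[mu]_x ((h n x)%:E * (g x)%:E))).
  by apply: congr_lim; apply/funext => n; exact: nnE.
rewrite -monotone_convergence//=.
- apply: eq_integral => x _; apply/cvg_lim => //=.
  have hx : (h n x)%:E @[n --> \oo] --> f x by exact: cvg_nnsfun_approx.
  exact: cvgeZr.
- by move=> n x _; rewrite mule_ge0// lee_fin.
- move=> x _ m n mn; apply: lee_wpmul2r; rewrite lee_fin//.
  exact/lefP/nd_nnsfun_approx.
Qed.

End density.
Section laws_of_maps.
Context d (T : measurableType d) {R : realType}.
Local Open Scope ereal_scope.

Definition law d' (E : measurableType d') (P : probability T R) (f : T -> E)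
    (mf : measurable_fun setT f) : probability E R :=
  distribution P
    (HB.pack_for {mfun T >-> E} f (isMeasurableFun.Build _ _ _ _ f mf)).

Lemma lawE d' (E : measurableType d') (P : probability T R) (f : T -> E)
    (mf : measurable_fun setT f) A : law P mf A = P (f @^-1` A).
Proof. by []. Qed.

Lemma ge0_integral_law d' (E : measurableType d') (P : probability T R)
    (f : T -> E) (mf : measurable_fun setT f) (h : E -> \bar R) :
  measurable_fun setT h -> (forall x, 0 <= h x) ->
  \int[law P mf]_x h x = \int[P]_w h (f w).
Proof.
move=> mh h0.
by have := @ge0_integral_pushforward _ _ _ _ _ _ mf P setT h measurableT mh
  (fun y _ => h0 y).
Qed.

Lemma probability_unique (m1 m2 : probability T R) (G : set (set T)) :
  measurable = <<s G >> -> setI_closed G -> G setT ->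
  (forall A, G A -> m1 A = m2 A) -> forall A, measurable A -> m1 A = m2 A.
Proof.
move=> mG GI GT m12 A mA; apply: (measure_unique G (fun=> setT)) => //.
- by rewrite bigcup_const.
- by move=> _ /=; rewrite probability_setT ltry.
Qed.

End laws_of_maps.

Section mutual_independence.
Context d (T : measurableType d) {R : realType} (P : probability T R).
Context d' (E : measurableType d') (I : finType).
Variables (V : I -> T -> E) (nu : I -> probability E R) (G : set (set E)).
Hypothesis mV : forall i, measurable_fun setT (V i).
Hypotheses (mG : measurable = <<s G >>) (GI : setI_closed G) (GT : G setT).
Local Open Scope ereal_scope.

(** One coordinate is released at a time: with the other sets fixed, both sides are finite measures
    of the i-th set that agree on the pi-system [G]. *)
Lemma product_law_generated :
  (forall A : I -> set E, (forall i, G (A i)) ->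
     P [set w | forall i, A i (V i w)] = \prod_i nu i (A i)) ->
  forall A : I -> set E, (forall i, measurable (A i)) ->
    P [set w | forall i, A i (V i w)] = \prod_i nu i (A i).
Proof.
move=> PG A mA.
(* [s] lists the coordinates whose set is already arbitrary; the sets of the others are still in
   [G]. *)
suff H (s : seq I) : forall A : I -> set E, (forall i, measurable (A i)) ->
    (forall i, i \notin s -> G (A i)) ->
    P [set w | forall i, A i (V i w)] = \prod_i nu i (A i).
  by apply: (H (enum I)) => // i; rewrite mem_enum.
elim: s {A mA} => [|i s IH] A mA GA; first by apply: PG => i; exact: GA.
pose F := [set w | forall k, k != i -> A k (V k w)].
have mF : measurable F.
  have -> : F = \bigcap_(k in [set k | k != i]) (V k @^-1` A k).
    by apply/seteqP; split=> w H k; exact: H.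
  apply: fin_bigcap_measurable => [|k _]; first exact: finite_finset.
  by rewrite -[X in measurable X]setTI; exact: mV.
pose B (C : set E) := fun k => if k == i then C else A k.
have FE C : V i @^-1` C `&` F = [set w | forall k, B C k (V k w)].
  apply/seteqP; split=> [w [Cw Fw] k|w H]; rewrite /B.
    by have [->//|ki] := eqVneq k i; exact: Fw.
  split; first by have := H i; rewrite /B eqxx.
  by move=> k /negPf ki; have := H k; rewrite /B ki.
have prodE C : \prod_k nu k (B C k) = nu i C * \prod_(k | k != i) nu k (A k).
  rewrite (bigD1 i)//= /B eqxx; congr (_ * _).
  by apply: eq_bigr => k /negPf ->.
have pr0 : 0 <= \prod_(k | k != i) nu k (A k) by apply: prode_ge0.
have prfin : \prod_(k | k != i) nu k (A k) \is a fin_num.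
  elim/big_ind: _ => // [x y|k _]; first exact: fin_numM.
  exact: fin_num_measure.
pose c : {nonneg R} := NngNum (fine_ge0 pr0).
have [m1 m1E] : exists m1 : {measure set E -> \bar R},
    forall C, m1 C = P (V i @^-1` C `&` F).
  pose m : {measure set E -> \bar R} :=
    pushforward (mrestr P mF) (V i).
  by exists (m (mV i)).
pose m2 : {measure set E -> \bar R} := mscale c (nu i).
have BA : B (A i) = A by apply/funext => k; rewrite /B; case: eqP => [->|].
have m2E C : m2 C = \prod_k nu k (B C k).
  by rewrite prodE muleC /m2 /= /mscale /= fineK.
rewrite -{1 2}BA -FE -m2E -m1E.
apply: (measure_unique G (fun=> setT)) => //.
- by rewrite bigcup_const.
- move=> C GC; rewrite m2E m1E FE; apply: IH.
    move=> k; rewrite /B; case: ifP => // _.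
    by rewrite mG; exact: sub_sigma_algebra.
  move=> k ks; rewrite /B; case: eqP => // /eqP ki.
  by apply: GA; rewrite inE negb_or ki.
- move=> _; apply: (@le_lt_trans _ _ 1); last exact: ltry.
  by rewrite /= m1E preimage_setT setTI; exact: probability_le1.
Qed.

End mutual_independence.
(** * Reflections of the standard Gaussian law *)

Section lebesgue_isometry.
Context {R : realType}.
Local Open Scope ereal_scope.
Local Notation leb := (@lebesgue_measure R).

(** Slopes 1 and -1 suffice: shears translate single coordinates, and a reflection reverses one of
    them. *)
Lemma lebesgue_affine (b : bool) (c : R) (A : set R) : measurable A ->
  leb ((fun x => (-1) ^+ b * x + c)%R @^-1` A) = leb A.
Proof.
have mf : measurable_fun setT (fun x : R => (-1) ^+ b * x + c)%R.
  by apply: measurable_funD => //; apply: measurable_funM.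
pose m : {measure set (measurableTypeR R) -> \bar R} :=
  pushforward leb
    ((fun x : R => (-1) ^+ b * x + c)%R : measurableTypeR R ->
      measurableTypeR R).
move=> mA; apply/esym.
rewrite -[RHS]/(m mf A);
  apply: lebesgue_measure_unique => // _ [[u v] /= uv <-].
rewrite -[RHS]/(leb _) lebesgue_measure_itv /=.
case: b {m mf} => /=.
  have -> : (fun x => (-1) ^+ true * x + c)%R @^-1` `]u, v]%classic
    = `[(c - v)%R, (c - u)%R[%classic.
    by apply/seteqP; split=> x /=;
      rewrite !in_itv /= expr1 mulN1r => /andP[? ?];
      apply/andP; split; lra.
  rewrite lebesgue_measure_itv /= !lte_fin ltrD2l ltrN2; case: ifP => // _.
  by rewrite -!EFinB; congr EFin; lra.
have -> : (fun x => (-1) ^+ false * x + c)%R @^-1` `]u, v]%classic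
  = `](u - c)%R, (v - c)%R]%classic.
  by apply/seteqP; split=> x /=; rewrite !in_itv /= expr0 mul1r => /andP[? ?];
      apply/andP; split; lra.
rewrite lebesgue_measure_itv /= !lte_fin ltrD2r; case: ifP => // _.
by rewrite -!EFinB; congr EFin; lra.
Qed.

Lemma integral_lebesgue_affine (b : bool) (c : R) (f : R -> \bar R) :
  measurable_fun setT f -> (forall x, 0 <= f x) ->
  \int[leb]_x f ((-1) ^+ b * x + c)%R = \int[leb]_x f x.
Proof.
move=> mf f0.
have mh : measurable_fun setT (fun x : R => (-1) ^+ b * x + c)%R.
  by apply: measurable_funD => //; apply: measurable_funM.
have := @ge0_integral_pushforward _ _ (measurableTypeR R)
  (measurableTypeR R) R _ mh leb setT f measurableT mf
  (fun y _ => f0 y).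
rewrite preimage_setT => <-.
pose m : {measure set (measurableTypeR R) -> \bar R} :=
  pushforward leb
    ((fun x : R => (-1) ^+ b * x + c)%R : measurableTypeR R ->
      measurableTypeR R).
rewrite -[LHS]/(\int[m mh]_x f x); apply: eq_measure_integral => A mA _.
exact: lebesgue_affine.
Qed.

(** The weight cancels the Gaussian density up to the constant [normal_peak 1], which leaves an
    integral against Lebesgue measure. *)
Lemma integral_normal_affine (b : bool) (c : R) (f : R -> \bar R) :
  measurable_fun setT f -> (forall x, 0 <= f x) ->
  \int[normal_prob 0 1]_x (f ((-1) ^+ b * x + c)%R * (expR (x ^+ 2 / 2))%:E) =
  \int[normal_prob 0 1]_x (f x * (expR (x ^+ 2 / 2))%:E).
Proof.
move=> mf f0.
have mh : measurable_fun setT (fun x : R => (-1) ^+ b * x + c)%R.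
  by apply: measurable_funD => //; apply: measurable_funM.
have me : measurable_fun setT (fun x : R => (expR (x ^+ 2 / 2))%:E).
  apply/measurable_EFinP; apply: measurableT_comp => //.
  by apply: measurable_funM => //; exact: measurable_funX.
have k (x : R) : (expR (x ^+ 2 / 2) * normal_pdf 0 1 x)%R = normal_peak 1 :> R.
  rewrite /normal_pdf oner_eq0 /= /normal_fun mulrCA -expRD subr0 expr1n.
  by rewrite mulNr subrr expR0 mulr1.
have E (h : R -> \bar R) : measurable_fun setT h -> (forall x, 0 <= h x) ->
    \int[normal_prob 0 1]_x (h x * (expR (x ^+ 2 / 2))%:E) =
    \int[leb]_x (h x * (normal_peak 1)%:E).
  move=> mh' h0; rewrite (@integral_density _ _ R leb (normal_prob 0 1)
    (normal_pdf 0 1)).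
  - by apply: eq_integral => x _; rewrite -muleA -EFinM k.
  - exact: measurable_normal_pdf.
  - by move=> x; exact: normal_pdf_ge0.
  - by [].
  - exact: emeasurable_funM.
  - by move=> x; rewrite mule_ge0// lee_fin expR_ge0.
rewrite !E//; last exact: measurableT_comp.
apply: (integral_lebesgue_affine b c (f := fun x => f x * (normal_peak 1)%:E)).
  by apply: emeasurable_funM.
by move=> x; rewrite mule_ge0// lee_fin normal_peak_ge0.
Qed.

End lebesgue_isometry.
Section matrix_rectangles.
Context d (E : measurableType d) {m n : nat}.

Definition mx_rectangle (A : 'I_m -> 'I_n -> set E) : set 'M[E]_(m, n) :=
  [set M | forall i j, A i j (M i j)].

Definition mx_rectangles : set (set 'M[E]_(m, n)) :=
  [set B | exists2 A, (forall i j, measurable (A i j)) & B = mx_rectangle A].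

Lemma mx_rectangle_measurable A :
  (forall i j, measurable (A i j)) -> measurable (mx_rectangle A).
Proof.
move=> mA.
have -> : mx_rectangle A = \bigcap_(ij in [set: 'I_m * 'I_n])
    [set M : 'M[E]_(m, n) | A ij.1 ij.2 (M ij.1 ij.2)].
  apply/seteqP; split=> M; first by move=> MA [i j] _; exact: MA.
  by move=> MA i j; exact: (MA (i, j)).
apply: fin_bigcap_measurable => // -[i j] _ /=.
by apply: sub_sigma_algebra; exists i, j, (A i j).
Qed.

Lemma mx_rectangles_generate : measurable = <<s mx_rectangles >>.
Proof.
apply/seteqP; split; apply: smallest_sub; try exact: smallest_sigma_algebra.
  move=> _ [i [j [A mA ->]]]; apply: sub_sigma_algebra.
  exists (fun k l => if (k == i) && (l == j) then A else setT).
    by move=> k l; case: ifP.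
  apply/seteqP; split=> [M AM k l|M /(_ i j)]; last by rewrite !eqxx.
  by case: ifP => // /andP[/eqP -> /eqP ->].
move=> _ [A mA ->]; exact: mx_rectangle_measurable.
Qed.

Lemma mx_rectanglesI : setI_closed mx_rectangles.
Proof.
move=> _ _ [A mA ->] [B mB ->].
exists (fun i j => A i j `&` B i j); first by move=> i j; exact: measurableI.
apply/seteqP; split=> [M [AM BM] i j|M H]; first by split.
by split=> i j; have [] := H i j.
Qed.

Lemma mx_rectanglesT : mx_rectangles setT.
Proof. by exists (fun _ _ => setT) => //; apply/seteqP; split. Qed.

End matrix_rectangles.

Arguments mx_rectangles {d} E m n.

Section standard_gaussian.
Context {R : realType} {N : nat}.
Implicit Types (z : 'rV[R]_N) (g : probability 'rV[R]_N R).
Local Open Scope ereal_scope.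

Definition gaussian_on_rectangles g := forall A : 'I_N -> set R,
  (forall j, measurable (A j)) ->
  g (mx_rectangle (fun=> A)) = \prod_j normal_prob 0 1 (A j).

Lemma std_gaussian_rectangle g : std_gaussian g id -> gaussian_on_rectangles g.
Proof.
move=> [gI glaw] A mA.
have := gI (fun ij => A ij.2) (fun ij => mA ij.2).
rewrite (eq_bigr (fun ij => normal_prob 0 1 (A ij.2))) => [|ij _];
  last exact: glaw.
rewrite -(pair_bigA _ (fun (i : 'I_1) j =>
  normal_prob 0 1 (A j))) /= big_ord1 => <-.
congr (g _); apply/seteqP; split=> z H; first by case=> i j; exact: H.
by move=> i j; exact: (H (i, j)).
Qed.

Variable g : probability 'rV[R]_N R.
Hypothesis g_std : gaussian_on_rectangles g.

Definition set_coord (k : 'I_N) (x : R) z : 'rV[R]_N :=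
  \row_j (if j == k then x else z 0%R j).

Lemma measurable_set_coord d (T : measurableType d) k (f : T -> R)
    (h : T -> 'rV[R]_N) :
  measurable_fun setT f -> measurable_fun setT h ->
  measurable_fun setT (fun x => set_coord k (f x) (h x)).
Proof.
move=> mf mh; apply: measurable_fun_mx => i j.
under eq_fun do rewrite mxE.
by case: (j == k) => //; exact: measurable_fun_entry.
Qed.

(** On a rectangle the k-th factor is integrated out to 1 and the fresh draw restores it. This
    reduces a statement about one coordinate to a one-dimensional integral with the others
    frozen. *)
Lemma gaussian_resample k (F : 'rV[R]_N -> \bar R) :
  measurable_fun setT F -> (forall z, 0 <= F z) ->
  \int[g]_z F z = \int[g]_z \int[normal_prob 0 1]_x F (set_coord k x z).
Proof.
move=> mF F0.
have mc : measurable_fun setT 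
    (fun zx : 'rV[R]_N * measurableTypeR R => set_coord k zx.2 zx.1).
  by apply: measurable_set_coord.
pose gN : probability ('rV[R]_N * measurableTypeR R)%type R :=
    (g \x normal_prob 0 1)%E.
have lawE A : measurable A -> law gN mc A = g A.
  apply: (probability_unique (G := mx_rectangles R 1 N)).
  - exact: mx_rectangles_generate.
  - exact: mx_rectanglesI.
  - exact: mx_rectanglesT.
  move=> _ [B mB ->].
  pose B' j := if j == k then setT else B 0%R j.
  have mB' j : measurable (B' j) by rewrite /B'; case: ifP.
  have -> : mx_rectangle B = mx_rectangle (fun=> B 0%R) :> set 'rV[R]_N.
    congr mx_rectangle; apply/funext => i; by rewrite ord1.
  rewrite g_std//.
  rewrite [LHS](_ : _ = gN (mx_rectangle (fun=> B') `*` B 0%R k)); last first.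
    congr (gN _); apply/seteqP; split=> [[z x] /= H|[z x] /= [H Bx] i j].
      split; last by have := H 0%R k; rewrite mxE eqxx.
      by move=> i j; have := H i j; rewrite mxE /B' ord1; case: eqP.
    by rewrite mxE; case: eqP => [->//|/eqP/negPf jk]; have := H i j;
      rewrite /B' jk ord1.
  rewrite /gN /= product_measure1E//; last first.
    exact: mB.
    by apply: mx_rectangle_measurable => _ j; exact: mB'.
  rewrite [X in X * _](g_std mB').
  rewrite [RHS](bigD1 k)//= muleC; congr (_ * _).
  rewrite (bigD1 k)//= {1}/B' eqxx probability_setT mul1e.
  by apply: eq_bigr => j /negPf jk; rewrite /B' jk.
rewrite [LHS](eq_measure_integral (law gN mc)) => [|A mA _];
  last exact/esym/lawE.
rewrite ge0_integral_law// fubini_tonelli1//.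
exact: measurableT_comp.
Qed.

Definition sqnorm z : R := (\sum_j z 0 j ^+ 2)%R.

Lemma measurable_sqnorm : measurable_fun setT sqnorm.
Proof.
apply: measurable_sum => j; apply: measurable_funX.
exact: measurable_mx_entry.
Qed.

Let weight z := expR (sqnorm z / 2).

Let measurable_weight : measurable_fun setT weight.
Proof.
apply: measurableT_comp => //; apply: measurable_funM => //.
exact: measurable_sqnorm.
Qed.

(* Up to a constant factor, [expR (sqnorm z / 2)] times the standard Gaussian
   measure is Lebesgue measure. *)
Definition lebesgue_invariant (t : 'rV[R]_N -> 'rV[R]_N) : Prop :=
  measurable_fun setT t /\
  forall f : 'rV[R]_N -> \bar R, measurable_fun setT f ->
    (forall z, 0 <= f z) ->
    \int[g]_z (f (t z) * (expR (sqnorm z / 2))%:E) =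
    \int[g]_z (f z * (expR (sqnorm z / 2))%:E).

Lemma lebesgue_invariant_comp t1 t2 :
  lebesgue_invariant t1 -> lebesgue_invariant t2 ->
  lebesgue_invariant (t1 \o t2).
Proof.
move=> [m1 i1] [m2 i2]; split; first exact: measurableT_comp.
move=> f mf f0; rewrite -[RHS]i1//.
by apply: (i2 (f \o t1)) => [|z /=]; [exact: measurableT_comp|exact: f0].
Qed.

(** Once coordinate k is resampled, [l] is constant in it and the weight splits into exp(S/2) for
    the other coordinates and exp(x^2/2), which is the one-dimensional affine case. *)
Lemma lebesgue_invariant_coord k (b : bool) (l : 'rV[R]_N -> R) :
  measurable_fun setT l -> (forall x z, l (set_coord k x z) = l z) ->
  lebesgue_invariant (fun z => set_coord k ((-1) ^+ b * z 0 k + l z)%R z).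
Proof.
move=> ml lk; set t := fun z : 'rV[R]_N => set_coord _ _ z.
have mt : measurable_fun setT t.
  apply: measurable_set_coord => //; apply: measurable_funD => //.
  by apply: measurable_funM => //; exact: measurable_mx_entry.
split=> // f mf f0.
have me : measurable_fun setT (fun z =>
  (weight z)%:E) by exact/measurable_EFinP.
have mfe h : measurable_fun setT h ->
  measurable_fun setT (fun z => h z * (weight z)%:E).
  by move=> mh; apply: emeasurable_funM.
have fe0 h z : (forall z, 0 <= h z) -> 0 <= h z * (weight z)%:E.
  by move=> h0; rewrite mule_ge0// lee_fin expR_ge0.
rewrite (@gaussian_resample k) => [|//|z];
  [|exact: mfe (measurableT_comp mf mt)|by apply: (fe0 (f \o t)) => z' /=].
rewrite [RHS](@gaussian_resample k) => [||z]; [|exact: mfe|exact: fe0].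
apply: eq_integral => z _.
pose S := (\sum_(j | j != k) z 0 j ^+ 2)%R.
pose r := expR (S / 2).
have wE x : expR (sqnorm (set_coord k x z) / 2) = (r * expR (x ^+ 2 / 2))%R.
  have -> : sqnorm (set_coord k x z) = (S + x ^+ 2)%R.
    rewrite /sqnorm (bigD1 k)//= mxE eqxx addrC; congr (_ + _)%R.
    by apply: eq_bigr => j /negPf jk; rewrite mxE jk.
  by rewrite mulrDl expRD.
have tE x : t (set_coord k x z) = set_coord k ((-1) ^+ b * x + l z)%R z.
  rewrite /t lk mxE eqxx; apply/rowP => j; rewrite !mxE.
  by case: (j == k).
under eq_integral do rewrite wE tE EFinM muleA.
under [RHS]eq_integral do rewrite wE EFinM muleA.
apply: (integral_normal_affine b (l z) (f := fun x =>
  f (set_coord k x z) * r%:E)).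
  apply: emeasurable_funM => //.
  by apply: (measurableT_comp mf); apply: measurable_set_coord.
by move=> x; rewrite mule_ge0// lee_fin expR_ge0.
Qed.

(** A product of the translations z_k |-> z_k + b_k z_i; since b_i = 0, the coordinate z_i that
    drives them stays fixed throughout. *)
Lemma lebesgue_invariant_shear (i : 'I_N) (b : 'rV[R]_N) :
  (b 0 i = 0)%R -> lebesgue_invariant (fun z => z + z 0 i *: b)%R.
Proof.
move=> bi.
pose bs (s : seq 'I_N) := (\row_j (if j \in s then b 0 j else 0))%R.
suff H s : lebesgue_invariant (fun z => z + z 0 i *: bs s)%R.
  have -> : b = bs (enum 'I_N) by apply/rowP => j; rewrite mxE mem_enum.
  exact: H.
elim: s => [|k s IH].
  have -> : (fun z => z + z 0 i *: bs [::])%R = id.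
    by apply/funext => z; apply/rowP => j; rewrite !mxE mulr0 addr0.
  by split=> //; exact: measurable_id.
have [ks|ks] := boolP (k \in s).
  have -> // : bs (k :: s) = bs s.
  apply/rowP => j; rewrite !mxE inE; case: eqP => [->|//].
  by rewrite ks.
have [ki|ki] := eqVneq k i.
  have -> // : bs (k :: s) = bs s.
  apply/rowP => j; rewrite !mxE inE; case: eqP => [->|//].
  by rewrite (negPf ks) ki bi.
have -> : (fun z => z + z 0 i *: bs (k :: s))%R =
    (fun z => set_coord k ((-1) ^+ false * z 0 k + b 0 k * z 0 i)%R z) \o
    (fun z => z + z 0 i *: bs s)%R.
  apply/funext => z; apply/rowP => j; rewrite /= !mxE inE expr0 mul1r.
  have [->|jk] := eqVneq j k; last by rewrite orFb.
  by rewrite (negPf ks) bi if_same !mulr0 !addr0 mulrC.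
apply: lebesgue_invariant_comp => //.
apply: lebesgue_invariant_coord.
  by apply: measurable_funM => //; exact: measurable_mx_entry.
by move=> x z; rewrite mxE eq_sym (negPf ki).
Qed.

(* With [t] the shear z |-> z + z_i (be - e_i), the map below is
   t o (change of the i-th coordinate only) o t^-1. *)
Lemma lebesgue_invariant_reflection_pivot (i : 'I_N) (al : 'cV[R]_N)
    (be : 'rV[R]_N) :
  (be 0 i = 1)%R -> ((be *m al) 0 0 = 2)%R ->
  lebesgue_invariant (fun z => z - (z *m al) 0 0 *: be)%R.
Proof.
move=> bei beal.
pose b := (be - delta_mx 0 i)%R.
have bi : (b 0 i = 0)%R by rewrite !mxE !eqxx bei subrr.
have bE : be = (delta_mx 0 i + b)%R by rewrite addrC subrK.
pose l z : R := (- \sum_(j | j != i) z 0 j * al j 0)%R.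
have -> : (fun z => z - (z *m al) 0 0 *: be)%R =
    (fun z => z + z 0 i *: b)%R \o
    ((fun z => set_coord i ((-1) ^+ true * z 0 i + l z)%R z) \o
    (fun z => z + z 0 i *: (- b)))%R.
  apply/funext => z /=; set y := (z + _ *: - b)%R.
  have yi : (y 0 i = z 0 i)%R by rewrite !mxE bei !eqxx subrr oppr0 mulr0 addr0.
  have zE : z = (y + z 0 i *: b)%R by rewrite /y scalerN subrK.
  (* Since be.al = 2, the new i-th coordinate - z_i + l y equals z_i - z.al; the last shear then
     gives each other coordinate its share of - (z.al) be. *)
  have lE : (l y = - (z *m al) 0 0 + 2 * z 0 i)%R.
    have : ((z *m al) 0 0 = (y *m al) 0 0 + z 0 i * (2 - al i 0))%R.
      rewrite {1}zE mulmxDl -scalemxAl mxE [X in (_ + X)%R]mxE;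
        congr (_ + _ * _)%R.
      have := beal; rewrite bE mulmxDl -rowE mxE => <-.
      by rewrite [row i al _ _]mxE addrAC subrr add0r.
    have -> : ((y *m al) 0 0 = z 0 i * al i 0 - l y)%R.
      by rewrite mxE (bigD1 i)//= yi /l opprK.
    by move=> ->; ring.
  apply/rowP => j; rewrite [RHS]mxE [X in _ = (_ + X)%R]mxE lE !mxE eqxx.
  rewrite !eqxx bei /= subrr oppr0 mulr0 addr0 expr1 mulN1r.
  set m := (\sum_j0 _)%R.
  by have [->|ji] := eqVneq j i; rewrite ?bei /=; ring.
apply: lebesgue_invariant_comp; first exact: lebesgue_invariant_shear.
apply: lebesgue_invariant_comp; last first.
  by apply: lebesgue_invariant_shear; rewrite mxE bi oppr0.
apply: lebesgue_invariant_coord => [|x z].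
  rewrite /l; under eq_fun do rewrite big_mkcond.
  apply: measurable_funN; apply: measurable_sum => j; case: (j != i) => //.
  by apply: measurable_funM => //; exact: measurable_mx_entry.
by congr (- _)%R; apply: eq_bigr => j /negPf ji; rewrite mxE ji.
Qed.

(** The invariance is applied to h(z) exp(-|z|^2/2); the isometry makes the weights cancel on both
    sides. As be.al = 2, some entry of [be] is nonzero, and rescaling [al] and [be] inversely turns
    it into 1. *)
Lemma gaussian_reflection (al : 'cV[R]_N) (be : 'rV[R]_N) :
  ((be *m al) 0 0 = 2)%R ->
  (forall z, sqnorm (z - (z *m al) 0 0 *: be)%R = sqnorm z) ->
  forall h : 'rV[R]_N -> \bar R, measurable_fun setT h ->
    (forall z, 0 <= h z) ->
    \int[g]_z h (z - (z *m al) 0 0 *: be)%R = \int[g]_z h z.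
Proof.
move=> beal iso h mh h0.
have [i bi] : exists i, (be 0 i != 0)%R.
  apply/existsP; apply: contraT; rewrite negb_exists => /forallP H.
  move: beal; rewrite mxE big1 => [/esym/eqP|j _]; first by rewrite pnatr_eq0.
  by have := H j; rewrite negbK => /eqP ->; rewrite mul0r.
have tE z : (z - (z *m al) 0 0 *: be)%R =
    (z - (z *m (be 0 i *: al)) 0 0 *: ((be 0 i)^-1 *: be))%R.
  by rewrite -scalemxAr [(_ *: (z
    *m al))%R _ _]mxE scalerA mulrAC mulfV// mul1r.
have [mt inv] : lebesgue_invariant (fun z => z - (z *m al) 0 0 *: be)%R.
  under eq_fun do rewrite tE.
  apply: (@lebesgue_invariant_reflection_pivot i); first by rewrite mxE mulVf.
  by rewrite -scalemxAl -scalemxAr scalerA mulVf// scale1r.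
have me : measurable_fun setT (fun z => (expR (- (sqnorm z / 2)))%:E).
  apply/measurable_EFinP; apply: measurableT_comp => //; apply: measurable_funN.
  by apply: measurable_funM => //; exact: measurable_sqnorm.
pose f z := h z * (expR (- (sqnorm z / 2)))%:E.
have fE z : f z * (expR (sqnorm z / 2))%:E = h z.
  by rewrite /f -muleA -EFinM -expRD addNr expR0 mule1.
rewrite -(eq_integral _ _ (fun z _ => fE z)) -inv; last first.
- by move=> z; rewrite mule_ge0// lee_fin expR_ge0.
- exact: emeasurable_funM.
by apply: eq_integral => z _; rewrite -(iso z) fE.
Qed.

End standard_gaussian.
(** * Conditional independence *)

Section density_measure.
Context d (T : measurableType d) {R : realType}.
Local Open Scope ereal_scope.

(** The proofs [mg] and [g0] are arguments so that a measure structure can be attached to the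
    function. *)
Definition density_measure (mu : {measure set T -> \bar R}) (g : T -> \bar R)
    (mg : measurable_fun setT g) (g0 : forall x, 0 <= g x) : set T -> \bar R :=
  fun A => \int[mu]_(x in A) g x.

Variables (mu : {measure set T -> \bar R}) (g : T -> \bar R).
Variables (mg : measurable_fun setT g) (g0 : forall x, 0 <= g x).

Let density0 : density_measure mu mg g0 set0 = 0.
Proof. by rewrite /density_measure integral_set0. Qed.

Let density_ge0 A : 0 <= density_measure mu mg g0 A.
Proof. exact: integral_ge0. Qed.

Let density_sigma_additive : semi_sigma_additive (density_measure mu mg g0).
Proof.
move=> /= F mF tF mUF; rewrite /density_measure; apply: cvg_toP.
  apply: ereal_nondecreasing_is_cvgn => m n mn.
  by apply: lee_sum_nneg_natr => // k _ _; exact: integral_ge0.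
by rewrite ge0_integral_bigcup//=; exact: measurable_funTS.
Qed.

HB.instance Definition _ := isMeasure.Build _ _ _ (density_measure mu mg g0)
  density0 density_ge0 density_sigma_additive.

End density_measure.

Section conditional_probability.
Context d (T : measurableType d) {R : realType} (P : probability T R).
Context d' (U : measurableType d') (V : T -> U).
Hypothesis mV : measurable_fun setT V.
Local Open Scope ereal_scope.

Let Q := law P mV.

Let mpreV G : measurable G -> measurable (V @^-1` G).
Proof. by move=> mG; rewrite -[X in measurable X]setTI; exact: mV. Qed.

Lemma cond_prob_law E g G : cond_prob P V E g -> measurable G ->
  \int[Q]_(u in G) (g u)%:E = P (E `&` V @^-1` G).
Proof.
move=> [mg ig gE] mG; rewrite -gE//.
have mEg : measurable_fun setT (EFin \o g) by exact/measurable_EFinP.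
apply: (@integral_pushforward _ _ _ _ _ _ mV P G (EFin \o g)) => //.
by apply: integrableS ig => //; exact: mpreV.
Qed.

Lemma cond_prob_integrable E g : cond_prob P V E g ->
  Q.-integrable setT (EFin \o g).
Proof.
move=> [mg ig gE].
have mEg : measurable_fun setT (EFin \o g) by exact/measurable_EFinP.
exact: (@integrable_pushforward _ _ _ _ _ _ mV P setT (EFin \o g)).
Qed.

Lemma cond_prob_unique E g1 g2 : cond_prob P V E g1 -> cond_prob P V E g2 ->
  ae_eq Q setT (EFin \o g1) (EFin \o g2).
Proof.
move=> c1 c2; apply: integral_ae_eq => //.
- exact: cond_prob_integrable c1.
- by apply/measurable_EFinP; case: c2.
- by move=> G _ mG; rewrite (cond_prob_law c1)// (cond_prob_law c2).
Qed.

(** A version may be negative somewhere; over that set its integral is both a probability and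
    nonpositive, so E has no mass there and clipping at 0 is harmless. *)
Lemma cond_prob_nonneg E g : measurable E -> cond_prob P V E g ->
  ae_eq Q setT (EFin \o g) (fun u => (Num.max (g u) 0%R)%:E).
Proof.
move=> mE cg; have mg : measurable_fun setT g by case: cg.
have mg' : measurable_fun setT (fun u =>
  Num.max (g u) 0%R) by exact: measurable_maxr.
apply: integral_ae_eq => //.
- exact: cond_prob_integrable cg.
- exact/measurable_EFinP.
move=> G _ mG; rewrite (cond_prob_law cg)//.
pose N := [set u | (g u < 0)%R].
have mN : measurable N.
  have -> : N = setT `&` g @^-1` `]-oo, 0%R[%classic.
    by rewrite setTI; apply/seteqP; split=> u; rewrite /N /= in_itv.
  exact: mg.
have PN : P (E `&` V @^-1` (G `&` N)) = 0.
  apply/eqP; rewrite eq_le measure_ge0 andbT.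
  rewrite -(cond_prob_law cg); last exact: measurableI.
  have gN0 u : (G `&` N) u -> 0 <= (- g u)%:E.
    by move=> [_ /ltW]; rewrite lee_fin oppr_ge0.
  rewrite (eq_integral (fun u => - (- g u)%:E)) => [|u _];
    last by rewrite -EFinN opprK.
  by rewrite integral_ge0N// oppe_le0; exact: integral_ge0.
have -> : \int[Q]_(u in G) (Num.max (g u) 0%R)%:E
  = \int[Q]_(u in G `\` N) (g u)%:E.
  rewrite integral_mkcond [RHS]integral_mkcond; apply: eq_integral => u _.
  rewrite !patchE; have [uG|uG] := boolP (u \in G); last first.
    by rewrite ifF//; apply/negbTE; apply: contra uG; rewrite !inE => -[].
  have [gu|gu] := ltP (g u) 0%R.
    by rewrite ifF//; apply/negbTE; rewrite notin_setE => -[_]; exact.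
  rewrite ifT// inE; split; first by rewrite inE in uG.
  by apply/negP; rewrite -leNgt.
rewrite (cond_prob_law cg); last exact: measurableD.
rewrite (measureDI P (B := V @^-1` N)).
- rewrite -setIA -preimage_setI [X in _ + X]PN adde0; congr (P _).
  by apply/seteqP; split=> w /=; tauto.
- by apply: measurableI => //; exact: mpreV.
- exact: mpreV.
Qed.

End conditional_probability.
Section conditional_independence.
Context d (T : measurableType d) {R : realType} (P : probability T R).
Context d1 (E1 : measurableType d1) d2 (E2 : measurableType d2).
Context d3 (U : measurableType d3) (X : T -> E1) (Y : T -> E2) (V : T -> U).
Hypotheses (mX : measurable_fun setT X) (mY : measurable_fun setT Y).
Hypothesis mV : measurable_fun setT V.
Local Open Scope ereal_scope.

(* Given V, the event [Y \in B] has the conditional probability h whatever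
   the information on X. *)
Lemma cond_independent_density (B : set E2) :
  cond_independent P X Y V -> measurable B ->
  exists h : U -> R, [/\ measurable_fun setT h, forall u, (0 <= h u)%R &
    forall A G, measurable A -> measurable G ->
      P (X @^-1` A `&` V @^-1` G `&` Y @^-1` B) =
      \int[P]_w ((\1_(X @^-1` A `&` V @^-1` G) w * h (V w))%:E)].
Proof.
move=> ci mB.
have mpre d' (E : measurableType d') (f : T -> E) A :
    measurable_fun setT f -> measurable A -> measurable (f @^-1` A).
  by move=> mf mA; rewrite -[X in measurable X]setTI; exact: mf.
have mYB : measurable (Y @^-1` B) by exact: mpre.
have [_ [gB0 [_ cB0 _]]] := ci setT B measurableT mB.
pose h u := Num.max (gB0 u) 0%R.
have mh : measurable_fun setT h by case: cB0 => mg _ _; exact: measurable_maxr.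
have h0 u : (0 <= h u)%R by rewrite le_max lexx orbT.
exists h; split=> // A G mA mG.
have mXA : measurable (X @^-1` A) by exact: mpre.
have [gA [gB [cA cB cAB]]] := ci A B mA mB.
pose a u := Num.max (gA u) 0%R.
have ma : measurable_fun setT a by case: cA => mg _ _; exact: measurable_maxr.
have a0 u : (0 <= a u)%R by rewrite le_max lexx orbT.
have aA := cond_prob_nonneg mV mXA cA.
have hB : ae_eq (law P mV) setT (EFin \o gB) (EFin \o h).
  apply: ae_eq_trans (cond_prob_unique mV cB cB0) _.
  exact: cond_prob_nonneg cB0.
have prodE : ae_eq (law P mV) setT (fun u => (gA u * gB u)%:E)
    (fun u => (a u * h u)%:E).
  apply: filterS2 aA hB => u /= Ha Hb _.
  by rewrite (EFin_inj (Ha I)) (EFin_inj (Hb I)).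
have mind : measurable_fun setT (fun w => (\1_(X @^-1` A) w)%:E : \bar R).
  by apply/measurable_EFinP; exact: measurable_indic.
have ind0 w : 0 <= (\1_(X @^-1` A) w)%:E :> \bar R by rewrite lee_fin.
pose nuX := density_measure P mind ind0.
(* [nu] is the law of V restricted to the event X in A. Its density with respect to the law of V is
   [a], so the integral of a h against that law becomes one of h against [nu]. *)
have [nu [nuE nuI]] : exists nu : {measure set U -> \bar R},
    (forall C, measurable C -> nu C = P (X @^-1` A `&` V @^-1` C)) /\
    (forall f, measurable_fun setT f -> (forall u, 0 <= f u) ->
      \int[nu]_u f u = \int[P]_w (f (V w) * (\1_(X @^-1` A) w)%:E)).
  pose m : {measure set U -> \bar R} := pushforward nuX V.
  exists (m mV); split=> [C mC|f mf f0].
    rewrite -[LHS]/(\int[P]_(w in V @^-1` C) (\1_(X @^-1` A) w)%:E).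
    by rewrite integral_indic//; exact: mpre.
  have := @ge0_integral_pushforward _ _ _ _ R _ mV nuX setT f measurableT mf
    (fun y _ => f0 y).
  rewrite preimage_setT => ->.
  apply: (@integral_density _ _ _ P nuX (\1_(X @^-1` A))) => //.
    exact: measurableT_comp.
  by move=> w; exact: f0.
have dens := @integral_density _ _ _ (law P mV) nu a
  (fun u => (\1_G u * h u)%:E) ma a0.
have -> : \int[P]_w ((\1_(X @^-1` A `&` V @^-1` G) w * h (V w))%:E) =
    \int[nu]_u (\1_G u * h u)%:E.
  rewrite nuI; last 2 first.
  - apply/measurable_EFinP; apply: measurable_funM => //;
    exact: measurable_indic.
  - by move=> u; rewrite lee_fin mulr_ge0.
  apply: eq_integral => w _; rewrite -EFinM indicI; congr EFin.
  by rewrite /= -[\1_(V @^-1` G) w]/(\1_G (V w)) -mulrA mulrC.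
rewrite dens; last 3 first.
- move=> C mC; rewrite nuE// -(cond_prob_law mV cA)//.
  apply: ae_eq_integral => //.
  - by apply/measurable_funTS/measurable_EFinP; case: cA.
  - exact/measurable_funTS/measurable_EFinP.
  - by apply: ae_eq_subset aA.
- apply/measurable_EFinP; apply: measurable_funM => //; exact: measurable_indic.
- by move=> u; rewrite lee_fin mulr_ge0.
rewrite setIAC -(cond_prob_law mV cAB)//.
rewrite [LHS](@ae_eq_integral _ _ _ _ _ (fun u => (a u * h u)%:E)) => //;
  last 3 first.
- by apply/measurable_funTS/measurable_EFinP; case: cAB.
- by apply/measurable_funTS/measurable_EFinP; exact: measurable_funM.
- by apply: ae_eq_subset prodE.
rewrite integral_mkcond; apply: eq_integral => u _.
rewrite patchE indicE; case: ifP => _; rewrite -?EFinM;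
  first by rewrite mul1r mulrC.
by rewrite mul0r mul0r.
Qed.

End conditional_independence.

Section conditional_independence_coordinate.
Context {R : realType} {p : nat} (mu : probability ('rV[R]_p * R)%type R).
Local Open Scope ereal_scope.

Lemma measurable_col' (j : 'I_p) :
  measurable_fun setT (fun x : 'rV[R]_p => col' j x).
Proof.
apply: measurable_fun_mx => i k; under eq_fun do rewrite mxE.
exact: measurable_mx_entry.
Qed.

(** A row is determined by x_j and [col' j x], so a rectangle of rows is an event on x_j intersected
    with one on the other covariates, where [cond_independent_density] applies. Agreement on
    rectangles extends to all F. *)
Lemma null_integral (j : 'I_p) (B : set R) : j \in nulls mu -> measurable B ->
  exists h : 'rV[R]_p.-1 -> R, [/\ measurable_fun setT h,
    forall u, (0 <= h u)%R &
    forall F : 'rV[R]_p -> \bar R, measurable_fun setT F ->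
      (forall x, 0 <= F x) ->
      \int[mu]_xy (F xy.1 * (\1_B xy.2)%:E) =
      \int[mu]_xy (F xy.1 * (h (col' j xy.1))%:E)].
Proof.
rewrite inE => /asboolP ci mB.
have mX : measurable_fun setT (fun xy : 'rV[R]_p * R => xy.1 0%R j).
  by apply: measurable_fun_entry; exact: measurable_fst.
have mV : measurable_fun setT (fun xy : 'rV[R]_p * R => col' j xy.1).
  by apply: measurableT_comp measurable_fst; exact: measurable_col'.
have [h [mh h0 hE]] := cond_independent_density mX measurable_snd mV ci mB.
exists h; split=> // F mF F0.
have mu1 : measurable_fun setT (fun xy : 'rV[R]_p * R =>
  (\1_B xy.2)%:E : \bar R).
  apply/measurable_EFinP.
  apply: (@measurableT_comp _ _ _ _ _ _ (\1_B : R -> R) _ snd).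
    exact: measurable_indic.
  exact: measurable_snd.
have mu2 : measurable_fun setT (fun xy : 'rV[R]_p * R => (h (col' j xy.1))%:E).
  by apply/measurable_EFinP; exact: measurableT_comp.
have pos1 (xy : 'rV[R]_p * R) : 0
  <= (\1_B xy.2)%:E :> \bar R by rewrite lee_fin.
have pos2 (xy : 'rV[R]_p * R) : 0 <= (h (col' j xy.1))%:E by rewrite lee_fin.
have mfst : measurable_fun setT (fst : 'rV[R]_p * R -> 'rV[R]_p).
  exact: measurable_fst.
have ext (g : 'rV[R]_p * R ->
  R) (mg : measurable_fun setT (fun xy => (g xy)%:E))
    (g0 : forall xy, 0 <= (g xy)%:E) :
    exists m : {measure set 'rV[R]_p -> \bar R},
    (forall C, measurable C -> m C = \int[mu]_xy (\1_C xy.1 * g xy)%:E) /\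
    \int[mu]_xy (F xy.1 * (g xy)%:E) = \int[m]_x F x.
  pose nu := density_measure mu mg g0.
  pose m : {measure set 'rV[R]_p -> \bar R} := pushforward nu fst.
  exists (m mfst); split=> [C mC|].
    rewrite -[LHS]/(\int[mu]_(xy in fst @^-1` C) (g xy)%:E) integral_mkcond.
    apply: eq_integral => xy _; rewrite patchE indicE EFinM.
    have -> : (xy \in fst @^-1` C) = (xy.1 \in C) by apply/idP/idP;
      rewrite !inE.
    by case: ifP => _; rewrite ?mul1e ?mul0e.
  have := @ge0_integral_pushforward _ _ _ _ R _ mfst nu setT F measurableT mF
    (fun y _ => F0 y).
  rewrite preimage_setT => ->; apply/esym.
  apply: (@integral_density _ _ _ mu nu g) => //.
  - exact/measurable_EFinP.
  - exact: measurableT_comp.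
  - by move=> xy; exact: F0.
have [m1 [m1E ->]] := ext (fun xy => \1_B xy.2) mu1 pos1.
have [m2 [m2E ->]] := ext (fun xy => h (col' j xy.1)) mu2 pos2.
apply: eq_measure_integral => D mD _.
apply: (measure_unique (mx_rectangles R 1 p) (fun=> setT)) => //.
- exact: mx_rectangles_generate.
- exact: mx_rectanglesI.
- by move=> _; exact: mx_rectanglesT.
- by rewrite bigcup_const.
- move=> _ [A mA ->]; rewrite m1E ?m2E; [|exact: mx_rectangle_measurable..].
  pose G : set 'rV[R]_p.-1 := mx_rectangle (fun i k => A i (lift j k)).
  have mG : measurable G by apply: mx_rectangle_measurable.
  pose X0 (xy : 'rV[R]_p * R) := xy.1 0%R j.
  pose V0 (xy : 'rV[R]_p * R) := col' j xy.1.
  pose D0 : set ('rV[R]_p * R) := X0 @^-1` A 0%R j `&` V0 @^-1` G.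
  have splitE (xy : 'rV[R]_p * R) : mx_rectangle A xy.1 <-> D0 xy.
    split=> [H|[/= Aj AG] i k].
      by split=> /= [|i k]; [exact: H|rewrite mxE; exact: H].
    have [k' ->|->] := unliftP j k; last by rewrite ord1.
    by have := AG i k'; rewrite mxE.
  have ind xy : \1_(mx_rectangle A) xy.1 = \1_D0 xy :> R.
    by rewrite !indicE; congr (nat_of_bool _)%:R; apply/idP/idP;
       rewrite !inE => /splitE.
  have mD0 : measurable D0.
    apply: measurableI; rewrite -[X in measurable X]setTI.
      exact: mX.
    exact: mV.
  under [RHS]eq_integral do rewrite ind.
  rewrite -[RHS](hE _ _ (mA 0%R j) mG).
  transitivity (\int[mu]_xy (\1_(D0 `&` snd @^-1` B) xy)%:E).
    by apply: eq_integral => xy _; rewrite ind indicI.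
  rewrite integral_indic// ?setIT//; apply: measurableI => //.
  by rewrite -[X in measurable X]setTI; exact: measurable_snd.
- move=> _ /=; rewrite m1E//; under eq_integral do rewrite indicT mul1r.
  apply: (@le_lt_trans _ _ (\int[mu]_xy 1)).
    apply: ge0_le_integral => // xy _.
    by rewrite lee_fin indicE lern1 leq_b1.
  rewrite integral_cst// mul1e.
  exact: (le_lt_trans (probability_le1 mu measurableT) (ltry _)).
Qed.

End conditional_independence_coordinate.
(** * Exchangeability of the knockoffs *)

Section gaussian_knockoffs.
Context {R : realType}.

Lemma sqnormE N (z : 'rV[R]_N) : sqnorm z = (z *m z^T) 0 0.
Proof. by rewrite mxE; apply: eq_bigr => j _; rewrite mxE expr2. Qed.

(** As k |al|^2 = 2, the map is the Householder reflection that reverses the direction [al]. *)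
Lemma sqnorm_reflection N (k : R) (al : 'cV[R]_N) (z : 'rV[R]_N) :
  ((k *: al^T) *m al) 0 0 = 2 ->
  sqnorm (z - (z *m al) 0 0 *: (k *: al^T)) = sqnorm z.
Proof.
rewrite -scalemxAl mxE => kal.
set c := (z *m al) 0 0; set n := (al^T *m al) 0 0 in kal.
have trE : (z - c *: (k *: al^T))^T = z^T - c *: (k *: al).
  by apply/matrixP => i l; rewrite !mxE.
rewrite !sqnormE trE.
have zc : (z *m al) 0 0 = c by [].
have cz : (al^T *m z^T) 0 0 = c.
  by rewrite -trmx_mul mxE.
rewrite mulmxBl !mulmxBr -!scalemxAr -!scalemxAl.
have entry (a : R) (M : 'M[R]_1) : (a *: M) 0 0 = a * M 0 0 by rewrite mxE.
have -> (M1 M2 M3 M4 : 'M[R]_1) : (M1 - M2 - (M3 - M4)) 0 0 =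
    M1 0 0 - M2 0 0 - (M3 0 0 - M4 0 0) by rewrite !mxE.
rewrite !entry cz zc -/n.
have -> : k * (c * (k * n)) = c * k * (k * n) by ring.
by rewrite kal; ring.
Qed.

Lemma gaussian_on_rectangles_pair p (g : probability 'rV[R]_p R)
    (mrow : measurable_fun setT
      (fun wz : 'rV[R]_p * 'rV[R]_p => row_mx wz.1 wz.2)) :
  gaussian_on_rectangles g ->
  gaussian_on_rectangles (law ((g \x g)%E : probability _ R) mrow).
Proof.
move=> gG A mA; rewrite lawE.
have -> : (fun wz : 'rV[R]_p * 'rV[R]_p => row_mx wz.1 wz.2) @^-1`
    mx_rectangle (fun=> A) =
    mx_rectangle (fun=> A \o lshift p) `*` mx_rectangle (fun=>
      A \o @rshift p p).
  apply/seteqP; split=> [[w z] /= H|[w z] /= [H1 H2] i j].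
    split=> i j; first by have := H i (lshift p j); rewrite row_mxEl.
    by have := H i (rshift p j); rewrite row_mxEr.
  by case: (split_ordP j) => k ->; rewrite ?row_mxEl ?row_mxEr;
    [exact: H1|exact: H2].
rewrite /= product_measure1E//; last 2 first.
- by apply: mx_rectangle_measurable => _ j; exact: mA.
- by apply: mx_rectangle_measurable => _ j; exact: mA.
rewrite [X in (X * _)%E]gG; last by move=> k; exact: mA.
rewrite [X in (_ * X)%E]gG; last by move=> k; exact: mA.
by rewrite big_split_ord.
Qed.

Lemma invmx_possemidef n (A : 'M[R]_n) : posdef A -> possemidef (invmx A).
Proof.
move=> Apd; have Au := posdef_unitmx Apd; have [AT A0] := posdef_possemidef Apd.
split=> [|x]; first by rewrite trmx_inv AT.
have -> : x^T *m invmx A *m x = (invmx A *m x)^T *m A *m (invmx A *m x).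
  by rewrite trmx_mul trmx_inv AT -!mulmxA mulKVmx.
exact: A0.
Qed.

Section one_row.
Context {p : nat} (s : 'rV[R]_p) (Om0 : 'M[R]_p) (j : 'I_p).
Hypotheses (Om0_pd : posdef Om0) (B2_psd : possemidef (B2mx s Om0)).
Hypothesis sj : 0 < s 0 j.

Let Sh := sqrtmx (invmx Om0).
Let C := Cmx s Om0.
Let B := Bmx s Om0.
Let e : 'cV[R]_p := delta_mx j 0.
Let et : 'rV[R]_p := delta_mx 0 j.

Let ShT : Sh^T = Sh. Proof. exact/trmx_sqrtmx/invmx_possemidef. Qed.
Let ShSh : Sh *m Sh = invmx Om0.
Proof. by case: (sqrtmxP (invmx_possemidef Om0_pd)). Qed.
Let BT : B^T = B. Proof. exact: trmx_sqrtmx. Qed.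
Let BB : B *m B = B2mx s Om0. Proof. by case: (sqrtmxP B2_psd). Qed.
Let OmT : Om0^T = Om0. Proof. by case: Om0_pd. Qed.
Let OmSS : Om0 *m Sh *m Sh = 1%:M.
Proof. by rewrite -mulmxA ShSh mulmxV// posdef_unitmx. Qed.

(* Write (x, xt) = (w Sh, w Sh C + z B) with (w, z) standard Gaussian. Then
   [al] is the functional (w, z) |-> x_j - xt_j, and exchanging x_j and xt_j
   amounts to the orthogonal reflection of (w, z) that sends [al] to - [al]. *)
Let al1 : 'cV[R]_p := s 0 j *: (Sh *m Om0 *m e).
Let al2 : 'cV[R]_p := - (B *m e).
Let al : 'cV[R]_(p + p) := col_mx al1 al2.
Let be : 'rV[R]_(p + p) := (s 0 j)^-1 *: al^T.
Let be1 : 'rV[R]_p := et *m Om0 *m Sh.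
Let be2 : 'rV[R]_p := - ((s 0 j)^-1 *: (et *m B)).

Let sj0 : s 0 j != 0. Proof. by rewrite gt_eqF. Qed.

Let beE : be = row_mx be1 be2.
Proof.
rewrite /be tr_col_mx scale_row_mx; congr row_mx.
  rewrite /al1 linearZ /= scalerA mulVf// scale1r !trmx_mul ShT OmT trmx_delta.
  by rewrite mulmxA.
by rewrite /al2 linearN /= scalerN trmx_mul BT trmx_delta.
Qed.

Let et_diag : et *m diag_mx s = s 0 j *: et.
Proof. by rewrite -rowE row_diag_mx. Qed.

Let etB2 : et *m B2mx s Om0
  = 2 *: (s 0 j *: et) - s 0 j *: (et *m Om0 *m diag_mx s).
Proof.
rewrite mulmxBr -scalemxAr et_diag !mulmxA et_diag -!scalemxAl//.
Qed.

(** |al|^2 is s_j^2 Om0_jj + (B^2)_jj = 2 s_j, the variance of x_j - xt_j: the choice of B^2 is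
    exactly what cancels the term in Om0_jj. *)
Let be_al : (be *m al) 0 0 = 2.
Proof.
have h1 : be1 *m al1 = s 0 j *: (et *m Om0 *m e).
  rewrite /be1 /al1 -scalemxAr !mulmxA -(mulmxA et Om0 Sh).
  by rewrite -(mulmxA et (Om0 *m Sh)) OmSS mulmx1.
have h2 : be2 *m al2 = (s 0 j)^-1 *: (et *m B2mx s Om0 *m e).
  by rewrite /be2 /al2 mulmxN mulNmx opprK -scalemxAl !mulmxA -(mulmxA et B) BB.
have De : diag_mx s *m e = s 0 j *: e.
  by rewrite -[LHS]trmxK trmx_mul tr_diag_mx trmx_delta et_diag linearZ /=
    trmx_delta.
have ete : et *m e = 1%:M.
  by rewrite mul_delta_mx; apply/matrixP => i k; rewrite !ord1 !mxE.
rewrite beE mul_row_col h1 h2 etB2 mulmxBl -!scalemxAl -(mulmxA _ (diag_mx s))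
  De.
rewrite ete -scalemxAr; set Q := et *m Om0 *m e; rewrite !mxE !eqxx mulr1n.
by field.
Qed.

Section swap.
Variables (w z : 'rV[R]_p).

Let m := (w *m al1 + z *m al2) 0 0.
Let x := w *m Sh.
Let xt := x *m C + z *m B.

Let mE : m = x 0 j - xt 0 j.
Proof.
have entry (v : 'rV[R]_p) : (v *m e) 0 0 = v 0 j by rewrite -colE mxE.
have -> : m = s 0 j * (x *m Om0) 0 j - (z *m B) 0 j.
  rewrite /m /al1 /al2 mulmxN -scalemxAr !mulmxA -/x.
  by rewrite mxE [X in X + _]mxE [X in _ + X]mxE !entry.
have xCE : x *m C = x - x *m Om0 *m diag_mx s.
  by rewrite /C /Cmx mulmxBr mulmx1 mulmxA.
have -> : xt 0 j = x 0 j - (x *m Om0) 0 j * s 0 j + (z *m B) 0 j.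
  by rewrite /xt xCE mul_mx_diag mxE [X in X + _]mxE [X in _ + X + _]mxE [X in
    _ - X + _]mxE.
by ring.
Qed.

Let swapE (y : 'rV[R]_p) (c : R) : set_coord j (y 0 j + c) y = y + c *: et.
Proof.
apply/rowP => k; rewrite !mxE eqxx /=.
by have [->|_] := eqVneq k j; rewrite ?mulr1 ?mulr0 ?addr0.
Qed.

(** [be1 *m Sh] is the j-th basis row, so the reflection changes only x_j, by - (x_j - xt_j). *)
Lemma swap_fst : (w - m *: be1) *m Sh = set_coord j (xt 0 j) x.
Proof.
have -> : xt 0 j = x 0 j + - m by rewrite mE; ring.
rewrite swapE mulmxBl -/x -scalemxAl scaleNr; congr (_ - _ *: _).
by rewrite /be1 -(mulmxA et Om0) -(mulmxA et (Om0 *m Sh)) OmSS mulmx1.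
Qed.

(** The changes of x and of z combine through et C + be2 B = - et, so only the j-th knockoff
    coordinate moves, by x_j - xt_j. *)
Lemma swap_snd : set_coord j (xt 0 j) x *m C + (z - m *: be2) *m B =
  set_coord j (x 0 j) xt.
Proof.
have -> : xt 0 j = x 0 j + - m by rewrite mE; ring.
have -> : x 0 j = xt 0 j + m by rewrite mE; ring.
have -> : xt 0 j + m + - m = x 0 j + - m by rewrite mE; ring.
rewrite !swapE mulmxDl mulmxBl -!scalemxAl.
have etC : et *m C = et - et *m Om0 *m diag_mx s.
  by rewrite mulmxBr mulmx1 mulmxA.
have be2B : be2 *m B = et *m Om0 *m diag_mx s - 2 *: et.
  rewrite /be2 mulNmx -scalemxAl -(mulmxA et B) BB etB2 scalerBr !scalerA.
  have -> : (s 0 j)^-1 * (2 * s 0 j) = 2 by field.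
  by rewrite mulVf// scale1r opprB.
rewrite etC be2B /xt.
apply/rowP => k; rewrite [LHS]mxE [in RHS]mxE.
set a := (et *m Om0 *m diag_mx s); rewrite !mxE; ring.
Qed.

End swap.

Lemma knockoff_pair_swap (g : probability 'rV[R]_p R)
    (F : 'rV[R]_p * 'rV[R]_p -> \bar R) :
  gaussian_on_rectangles g -> measurable_fun setT F -> (forall u, 0 <= F u)%E ->
  (\int[g]_w \int[g]_z F (w *m Sh, w *m Sh *m C + z *m B)%R =
   \int[g]_w \int[g]_z
     F (set_coord j ((w *m Sh *m C + z *m B) 0 j) (w *m Sh),
        set_coord j ((w *m Sh) 0 j) (w *m Sh *m C + z *m B))%R)%E.
Proof.
move=> gG mF F0.
have mrow : measurable_fun setT
    (fun wz : 'rV[R]_p * 'rV[R]_p => row_mx wz.1 wz.2).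
  apply: measurable_fun_mx => i k; under eq_fun do rewrite mxE.
  case: (fintype.split k) => l; apply: measurable_fun_entry.
    exact: measurable_fst.
  exact: measurable_snd.
have [G [GG iterE]] : exists G : probability 'rV[R]_(p + p) R,
    gaussian_on_rectangles G /\
    forall f : 'rV[R]_(p + p) -> \bar R, measurable_fun setT f ->
    (forall u, 0 <= f u)%E ->
    (\int[G]_u f u = \int[g]_w \int[g]_z f (row_mx w z))%E.
  exists (law ((g \x g)%E : probability _ R) mrow); split.
    exact: gaussian_on_rectangles_pair.
  move=> f mf f0; rewrite ge0_integral_law// fubini_tonelli1//.
  exact: measurableT_comp.
pose h (u : 'rV[R]_(p + p)) : \bar R :=
  F (lsubmx u *m Sh, lsubmx u *m Sh *m C + rsubmx u *m B).
have ml : measurable_fun setT (fun u : 'rV[R]_(p + p) => lsubmx u).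
  apply: measurable_fun_mx => i k; under eq_fun do rewrite mxE.
  exact: measurable_mx_entry.
have mr : measurable_fun setT (fun u : 'rV[R]_(p + p) => rsubmx u).
  apply: measurable_fun_mx => i k; under eq_fun do rewrite mxE.
  exact: measurable_mx_entry.
have mh : measurable_fun setT h.
  apply: (measurableT_comp mF); apply: measurable_fun_pair.
    exact: measurable_mulmx.
  by apply: measurable_addmx; do ?apply: measurable_mulmx.
have h0 u : (0 <= h u)%E by exact: F0.
have be_al' : (((s 0 j)^-1 *: al^T) *m al) 0 0 = 2 := be_al.
have mref : measurable_fun setT
    (fun u : 'rV[R]_(p + p) => u - (u *m al) 0 0 *: be).
  apply: measurable_fun_mx => i k; under eq_fun do rewrite !mxE.
  apply: measurable_funB; first exact: measurable_mx_entry.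
  apply: measurable_funM => //; apply: measurable_sum => l.
  by apply: measurable_funM => //; exact: measurable_mx_entry.
have E1 := iterE h mh h0.
have E2 := iterE _ (measurableT_comp mh mref) (fun u => h0 _).
have E3 := gaussian_reflection GG be_al (fun z =>
  sqnorm_reflection z be_al') mh h0.
have H := etrans (esym E2) (etrans E3 E1).
have rowE w z : h (row_mx w z) = F (w *m Sh, w *m Sh *m C + z *m B).
  by rewrite /h row_mxKl row_mxKr.
have refE w z : h (row_mx w z - (row_mx w z *m al) 0 0 *: be) =
    F (set_coord j ((w *m Sh *m C + z *m B) 0 j) (w *m Sh),
       set_coord j ((w *m Sh) 0 j) (w *m Sh *m C + z *m B)).
  rewrite beE scale_row_mx opp_row_mx add_row_mx /h row_mxKl row_mxKr.
  by rewrite mul_row_col swap_fst swap_snd.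
transitivity (\int[g]_w \int[g]_z h (row_mx w z))%E.
  by apply: eq_integral => w _; apply: eq_integral => z _; rewrite rowE.
rewrite -H; apply: eq_integral => w _; apply: eq_integral => z _; exact: refE.
Qed.

End one_row.
End gaussian_knockoffs.

(** * Exchangeability within one observation (x, xt, Y) *)

Section row_exchangeability.
Context {R : realType} {p : nat} (s : 'rV[R]_p) (Om0 : 'M[R]_p).
Variables (mu : probability ('rV[R]_p * R)%type R) (g : probability 'rV[R]_p R).
Hypotheses (Om0_pd : posdef Om0) (B2_psd : possemidef (B2mx s Om0)).
Hypothesis gG : gaussian_on_rectangles g.
Hypothesis mu_fst : has_law g (fun z => z *m sqrtmx (invmx Om0))
  (fun A => mu (fst @^-1` A)).

Local Notation rV := 'rV[R]_p.

Let C := Cmx s Om0.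
Let B := Bmx s Om0.

Definition knockoff_row (v : (rV * R) * rV) : (rV * rV) * R :=
  ((v.1.1, v.1.1 *m Cmx s Om0 + v.2 *m Bmx s Om0), v.1.2).

Definition swap_row (j : 'I_p) (u : (rV * rV) * R) : (rV * rV) * R :=
  ((set_coord j (u.1.2 0 j) u.1.1, set_coord j (u.1.1 0 j) u.1.2), u.2).

Lemma measurable_knockoff_row : measurable_fun setT knockoff_row.
Proof.
have m1 : measurable_fun setT (fun v : (rV * R) * rV => v.1.1).
  by apply: measurableT_comp measurable_fst; exact: measurable_fst.
apply: measurable_fun_pair; last first.
  by apply: measurableT_comp measurable_fst; exact: measurable_snd.
apply: measurable_fun_pair => //; apply: measurable_addmx.
  exact: measurable_mulmx.
by apply: measurable_mulmx => //; exact: measurable_snd.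
Qed.

Lemma measurable_swap_pair (j : 'I_p) : measurable_fun setT
  (fun u : rV * rV => (set_coord j (u.2 0 j) u.1, set_coord j (u.1 0 j) u.2)).
Proof.
have m1 : measurable_fun setT (fst : rV * rV -> rV) by exact: measurable_fst.
have m2 : measurable_fun setT (snd : rV * rV -> rV) by exact: measurable_snd.
by apply: measurable_fun_pair; apply: measurable_set_coord => //;
  exact: measurable_fun_entry.
Qed.

Lemma measurable_swap_row j : measurable_fun setT (swap_row j).
Proof.
apply: measurable_fun_pair; last exact: measurable_snd.
exact: (measurableT_comp (measurable_swap_pair j) measurable_fst).
Qed.

Lemma integral_fst (F : rV -> \bar R) : measurable_fun setT F ->
  (forall x, 0 <= F x)%E ->
  (\int[mu]_xy F xy.1 = \int[g]_w F (w *m sqrtmx (invmx Om0)))%E.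
Proof.
move=> mF F0.
have mS : measurable_fun setT (fun w : rV => w *m sqrtmx (invmx Om0)).
  exact: measurable_mulmx.
have mfst : measurable_fun setT (fst : rV * R -> rV) by exact: measurable_fst.
rewrite -(ge0_integral_law mu mfst)// -(ge0_integral_law g mS)//.
by apply: eq_measure_integral => A mA _; exact/esym/mu_fst.
Qed.

Hypothesis s_gt0 : forall j, 0 < s 0 j.

Let indic_pair (E : set (rV * rV)) (A : set R) (v : (rV * rV) * R) :
  \1_(E `*` A) v = \1_E v.1 * \1_A v.2 :> R.
Proof.
rewrite !indicE -natrM mulnb; congr (nat_of_bool _)%:R.
by apply/idP/andP; rewrite !inE => -[].
Qed.

(** The indicator of Y in D is traded for h of the other covariates, which the exchange of the j-th
    coordinates leaves unchanged. What remains concerns the Gaussian pair alone. *)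
Lemma knockoff_row_swap (j : 'I_p) (A : set ((rV * rV) * R)) :
  j \in nulls mu -> measurable A ->
  (mu \x g)%E (knockoff_row @^-1` A) =
  (mu \x g)%E ((swap_row j \o knockoff_row) @^-1` A).
Proof.
move=> jN; move: A.
have mk := measurable_knockoff_row.
have mks := measurableT_comp (measurable_swap_row j) mk.
pose nu : probability ((rV * R) * rV)%type R := (mu \x g)%E.
suff H A : measurable A -> law nu mk A = law nu mks A by exact: H.
apply: (probability_unique (G := [set E `*` D | E in measurable & D in
  measurable])).
- exact: measurable_prod_measurableType.
- move=> _ _ [E1 mE1 [D1 mD1 <-]] [E2 mE2 [D2 mD2 <-]].
  exists (E1 `&` E2); first exact: measurableI.
  exists (D1 `&` D2); first exact: measurableI.
  by rewrite setXI.
- by exists setT => //; exists setT => //; rewrite setXTT.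
move=> _ [E mE [D mD <-]].
have [h [mh h0 hE]] := null_integral jN mD.
have mfst : measurable_fun setT (fst : rV * R -> rV) by exact: measurable_fst.
have rowE (E' : set (rV * rV)) : measurable E' ->
    nu (knockoff_row @^-1` (E' `*` D)) =
    (\int[g]_w \int[g]_z
       (\1_E' (w *m sqrtmx (invmx Om0),
               w *m sqrtmx (invmx Om0) *m C + z *m B)%R *
        h (col' j (w *m sqrtmx (invmx Om0))))%:E)%E.
  move=> mE'.
  have mED : measurable (E' `*` D) by exact: measurableX.
  have mpre : measurable (knockoff_row @^-1` (E' `*` D)).
    by rewrite -[X in measurable X]setTI; exact: mk.
  have -> : nu (knockoff_row @^-1` (E' `*` D)) =
      (\int[nu]_v (\1_(knockoff_row @^-1` (E' `*` D)) v)%:E)%E.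
    by rewrite integral_indic// setIT.
  have mI : measurable_fun setT (fun xz : rV * rV =>
    (xz.1, xz.1 *m C + xz.2 *m B)).
    apply: measurable_fun_pair; first exact: measurable_fst.
    by apply: measurable_addmx; apply: measurable_mulmx.
  have m1E : measurable_fun setT (fun xz : rV * rV =>
      (\1_E' (xz.1, xz.1 *m C + xz.2 *m B))%:E : \bar R).
    apply/measurable_EFinP; apply: (measurableT_comp _ mI).
    exact: measurable_indic.
  (* The probability of the pair (x, xt) lying in E' given x. It does not involve Y, so
     [null_integral] applies to it. *)
  pose kap (x : rV) : \bar R := (\int[g]_z (\1_E' (x, x *m C + z *m B)%R)%:E)%E.
  have kap0 x : (0 <= kap x)%E by apply: integral_ge0 => z _; rewrite lee_fin.
  have mkap : measurable_fun setT kap.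
    by apply: (@measurable_fun_fubini_tonelli_F _ _ _ _ R g (fun xz : rV * rV =>
      (\1_E' (xz.1, xz.1 *m C + xz.2 *m B))%:E)).
  have mz (x : rV) : measurable_fun setT (fun z : rV =>
    (\1_E' (x, x *m C + z *m B)%R)%:E : \bar R).
    exact: (@measurable_fun_pair2 _ _ _ _ _ _ (fun xz : rV * rV =>
      (\1_E' (xz.1, xz.1 *m C + xz.2 *m B))%:E : \bar R) x).
  transitivity (\int[mu]_xy (kap xy.1 * (\1_D xy.2)%:E))%E.
    rewrite fubini_tonelli1//=; last first.
      by apply/measurable_EFinP; exact: measurable_indic.
    apply: eq_integral => xy _; rewrite /kap -ge0_integralZr//.
    apply: eq_integral => z _; rewrite -EFinM; congr EFin.
    exact: (indic_pair E' D (knockoff_row (xy, z))).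
  transitivity (\int[mu]_xy (kap xy.1 * (h (col' j xy.1))%:E))%E.
    exact: hE.
  rewrite (integral_fst (F := fun x => kap x * (h (col' j x))%:E)%E);
    last 2 first.
  - apply: emeasurable_funM => //; apply/measurable_EFinP.
    exact: (measurableT_comp mh (measurable_col' j)).
  - by move=> x; rewrite mule_ge0// lee_fin.
  apply: eq_integral => w _; rewrite /kap -ge0_integralZr//.
  by rewrite lee_fin.
pose sw (u : rV * rV) := (set_coord j (u.2 0 j) u.1, set_coord j (u.1 0 j) u.2).
have msw : measurable_fun setT sw := measurable_swap_pair j.
rewrite -[LHS]/(nu (knockoff_row @^-1` (E `*` D))).
rewrite -[RHS]/(nu (knockoff_row @^-1` ((sw @^-1` E) `*` D))).
rewrite [LHS](rowE _ mE) [RHS](rowE (sw @^-1` E)); last first.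
  by rewrite -[X in measurable X]setTI; exact: msw.
pose F (u : rV * rV) : \bar R := (\1_E u * h (col' j u.1))%:E.
rewrite (knockoff_pair_swap Om0_pd B2_psd (s_gt0 j) (F := F) gG); last 2 first.
- apply/measurable_EFinP; apply: measurable_funM; first exact: measurable_indic.
  apply: (measurableT_comp mh); apply: measurableT_comp measurable_fst.
  exact: measurable_col'.
- by move=> u; rewrite lee_fin mulr_ge0.
apply: eq_integral => w _; apply: eq_integral => z _; rewrite /F /=.
congr (_ * h _)%:E; apply/rowP => k; rewrite !mxE.
by rewrite eq_sym (negPf (neq_lift _ _)).
Qed.

End row_exchangeability.

(** * Exchangeability of the whole design *)

Section design_exchangeability.
Context {R : realType} {n p : nat} (s : 'rV[R]_p) (Om0 : 'M[R]_p).
Variables (mu : probability ('rV[R]_p * R)%type R) (g : probability 'rV[R]_p R).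
Hypotheses (Om0_pd : posdef Om0) (B2_psd : possemidef (B2mx s Om0)).
Hypothesis gG : gaussian_on_rectangles g.
Hypothesis mu_fst : has_law g (fun z => z *m sqrtmx (invmx Om0))
  (fun A => mu (fst @^-1` A)).
Hypothesis s_gt0 : forall j, 0 < s 0 j.
Context d (T : measurableType d) (P : probability T R).
Variables (X : T -> 'M[R]_(n, p)) (y : T -> 'cV[R]_n) (Z : T -> 'M[R]_(n, p)).
Hypotheses (mX : measurable_fun setT X) (my : measurable_fun setT y).
Hypothesis mZ : measurable_fun setT Z.
Hypotheses (Xy_iid : iid_sample P X y mu) (Z_std : std_gaussian P Z).
Hypothesis Z_indep : independent P Z (fun w => (X w, y w)).

Local Notation rV := 'rV[R]_p.

Let mpre d1 (E1 : measurableType d1) d2 (E2 : measurableType d2) (f : E1 ->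
  E2) A :
  measurable_fun setT f -> measurable A -> measurable (f @^-1` A).
Proof. by move=> mf mA; rewrite -[X in measurable X]setTI; exact: mf. Qed.

Let noise_rows (D : 'I_n -> set rV) : (forall i, measurable (D i)) ->
  (P [set w | forall i, D i (row i (Z w))] = \prod_i g (D i))%E.
Proof.
apply: (@product_law_generated _ _ _ _ _ _ _ (fun i w => row i (Z w)) (fun=> g)
  (mx_rectangles R 1 p)).
- by move=> i; exact: measurable_row.
- exact: mx_rectangles_generate.
- exact: mx_rectanglesI.
- exact: mx_rectanglesT.
move=> A AG.
pose B i := projT1 (cid2 (AG i)).
have mB i k l : measurable (B i k l) by exact: (projT2 (cid2 (AG i))).1.
have AE i : A i = mx_rectangle (fun=> B i 0).
  rewrite (projT2 (cid2 (AG i))).2; congr mx_rectangle.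
  by apply/funext => k; rewrite ord1.
have [Zind Zlaw] := Z_std.
under [RHS]eq_bigr do rewrite AE.
under [RHS]eq_bigr => i _ do rewrite gG//.
rewrite pair_big /=.
rewrite -(eq_bigr _ (fun ij _ => Zlaw ij _ (mB ij.1 0 ij.2))).
rewrite -(Zind (fun ij => B ij.1 0 ij.2))//; congr (P _).
apply/seteqP; split=> w H => [[i k] /=|i].
  by have := H i; rewrite AE => /(_ 0 k); rewrite mxE.
by rewrite AE => k l; rewrite mxE; exact: (H (i, l)).
Qed.

Let V (i : 'I_n) (w : T) : (rV * R) * rV :=
  ((row i (X w), y w i 0), row i (Z w)).

Let mV i : measurable_fun setT (V i).
Proof.
apply: measurable_fun_pair; last exact: measurable_row.
by apply: measurable_fun_pair;
  [exact: measurable_row|exact: measurable_fun_entry].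
Qed.

(** On products E_i x D_i the event splits into one on (X, y) and one on Z, which are independent;
    each then factors over the rows. *)
Let rows_law (A : 'I_n -> set ((rV * R) * rV)) : (forall i, measurable (A i)) ->
  (P [set w | forall i, A i (V i w)] = \prod_i (mu \x g) (A i))%E.
Proof.
apply: (@product_law_generated _ _ _ _ _ _ _ V
  (fun=> (mu \x g)%E : probability _ R)
  [set E `*` D | E in measurable & D in measurable]) => //.
- exact: measurable_prod_measurableType.
- move=> _ _ [E1 mE1 [D1 mD1 <-]] [E2 mE2 [D2 mD2 <-]].
  exists (E1 `&` E2); first exact: measurableI.
  exists (D1 `&` D2); first exact: measurableI.
  by rewrite setXI.
- by exists setT => //; exists setT => //; rewrite setXTT.
move=> A' A'G.
have /choice[E HE] : forall i, exists E, measurable E /\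
    exists2 D, measurable D & E `*` D = A' i.
  by move=> i; have [E mE [D mD ED]] := A'G i; exists E; split=> //; exists D.
have /choice[D HD] : forall i, exists D, measurable D /\ E i `*` D = A' i.
  by move=> i; have [_ [D mD ED]] := HE i; exists D.
have mE i : measurable (E i) by case: (HE i).
have mD i : measurable (D i) by case: (HD i).
have AE i : A' i = E i `*` D i by case: (HD i).
pose ZD := [set M : 'M[R]_(n, p) | forall i, D i (row i M)].
pose XE := [set My : 'M[R]_(n, p) * 'cV[R]_n | forall i, E i (row i My.1, My.2
  i 0)].
have mZD : measurable ZD.
  have -> : ZD = \bigcap_(i in [set: 'I_n]) ((fun M => row i M) @^-1` D i).
    by apply/seteqP; split=> M H i => [_|]; exact: H.
  by apply: fin_bigcap_measurable => // i _; apply: mpre => //;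
    exact: measurable_row.
have mXE : measurable XE.
  have -> : XE = \bigcap_(i in [set: 'I_n])
      ((fun My : 'M[R]_(n, p) * 'cV[R]_n => (row i My.1, My.2 i 0)) @^-1` E i).
    by apply/seteqP; split=> M H i => [_|]; exact: H.
  apply: fin_bigcap_measurable => // i _; apply: mpre => //.
  apply: measurable_fun_pair.
    by apply: measurable_row; exact: measurable_fst.
  by apply: measurable_fun_entry; exact: measurable_snd.
have -> : [set w | forall i, A' i (V i w)] =
    Z @^-1` ZD `&` (fun w => (X w, y w)) @^-1` XE.
  apply/seteqP; split=> [w H|w [H1 H2] i].
    by split=> i; have := H i; rewrite AE => -[].
  by rewrite AE; split; [exact: H2|exact: H1].
rewrite Z_indep//.
have [Xind Xlaw] := Xy_iid.
have -> : (P (Z @^-1` ZD) = \prod_i g (D i))%E by exact: noise_rows.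
have -> : (P ((fun w => (X w, y w)) @^-1` XE) = \prod_i mu (E i))%E.
  rewrite -(eq_bigr _ (fun i _ => Xlaw i _ (mE i))).
  by rewrite -(Xind E).
rewrite -big_split; apply: eq_bigr => i _.
by rewrite AE /= muleC; apply/esym; exact: product_measure1E.
Qed.

Definition knockoff_design (w : T) : 'M[R]_(n, p) :=
  X w *m Cmx s Om0 + Z w *m Bmx s Om0.

Lemma measurable_knockoff_design : measurable_fun setT knockoff_design.
Proof. by apply: measurable_addmx; apply: measurable_mulmx. Qed.

(* Encoding the sample as one matrix makes its law determined by rectangles. *)
Let stack (u : 'M[R]_(n, p) * 'M[R]_(n, p) * 'cV[R]_n) : 'M[R]_(n, (p + p) +
  1) :=
  row_mx (row_mx u.1.1 u.1.2) u.2.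

Lemma measurable_swap_cols (A : {set 'I_p}) d' (T' : measurableType d')
    (f h : T' -> 'M[R]_(n, p)) : measurable_fun setT f ->
      measurable_fun setT h ->
  measurable_fun setT (fun x => swap_cols A (f x) (h x)).
Proof.
move=> mf mh; apply: measurable_fun_mx => i j.
under eq_fun do rewrite mxE.
by case: (j \in A); exact: measurable_fun_entry.
Qed.

Let measurable_stack d' (T' : measurableType d')
    (f h : T' -> 'M[R]_(n, p)) (k : T' -> 'cV[R]_n) :
  measurable_fun setT f -> measurable_fun setT h -> measurable_fun setT k ->
  measurable_fun setT (fun x => stack (f x, h x, k x)).
Proof.
move=> mf mh mk; apply: measurable_fun_mx => i j.
rewrite -[j]splitK /stack /=; case: (fintype.split j) => [j'|j'] /=.
  under eq_fun do rewrite row_mxEl.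
  rewrite -[j']splitK; case: (fintype.split j') => [k'|k'] /=.
    by under eq_fun do rewrite row_mxEl; exact: measurable_fun_entry.
  by under eq_fun do rewrite row_mxEr; exact: measurable_fun_entry.
by under eq_fun do rewrite row_mxEr; exact: measurable_fun_entry.
Qed.

Let stack_row (u : (rV * rV) * R) : 'rV[R]_((p + p) + 1) :=
  row_mx (row_mx u.1.1 u.1.2) (const_mx u.2).

Let measurable_stack_row : measurable_fun setT stack_row.
Proof.
apply: measurable_fun_mx => i j.
rewrite -[j]splitK /stack_row /=; case: (fintype.split j) => [j'|j'] /=.
  under eq_fun do rewrite row_mxEl.
  rewrite -[j']splitK; case: (fintype.split j') => [k'|k'] /=.
    under eq_fun do rewrite row_mxEl.
    by apply: measurable_fun_entry; apply: measurableT_comp measurable_fst.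
  under eq_fun do rewrite row_mxEr.
  by apply: measurable_fun_entry; apply: measurableT_comp measurable_fst.
by under eq_fun do rewrite row_mxEr mxE; exact: measurable_snd.
Qed.

Let row_stack u i : row i (stack u) =
  stack_row ((row i u.1.1, row i u.1.2), u.2 i 0).
Proof.
rewrite /stack /stack_row !row_row_mx /=; congr row_mx.
by apply/rowP => k; rewrite !mxE ord1.
Qed.

Variable j : 'I_p.
Hypothesis j_null : j \in nulls mu.

Let data w := (X w, knockoff_design w, y w).
Let swapped w := (swap_cols [set j]%SET (X w) (knockoff_design w),
  swap_cols [set j]%SET (knockoff_design w) (X w), y w).

Let data_row w i : ((row i (data w).1.1, row i (data w).1.2), (data w).2 i 0) =
  knockoff_row s Om0 (V i w).
Proof. by rewrite /data /knockoff_row /= linearD /= !row_mul. Qed.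

Let swapped_row w i :
  ((row i (swapped w).1.1, row i (swapped w).1.2), (swapped w).2 i 0) =
  swap_row j (knockoff_row s Om0 (V i w)).
Proof.
rewrite -data_row /swap_row /swapped /data /=.
have E (M M' : 'M[R]_(n, p)) : row i (swap_cols [set j]%SET M M') =
    set_coord j ((row i M') 0 j) (row i M).
  by apply/rowP => k; rewrite !mxE inE; case: eqP => [->|].
by rewrite !E.
Qed.

(** Exchanging two columns exchanges the j-th coordinates in every row, and the rows are
    independent: the probability of a rectangle is a product, each factor of which is unchanged. *)
Lemma design_swap (F : 'M[R]_(n, p) * 'M[R]_(n, p) * 'cV[R]_n -> \bar R) :
  measurable_fun setT F -> (forall u, 0 <= F u)%E ->
  (\int[P]_w F (X w, knockoff_design w, y w) =
   \int[P]_w F (swap_cols [set j]%SET (X w) (knockoff_design w),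
                swap_cols [set j]%SET (knockoff_design w) (X w), y w))%E.
Proof.
move=> mF F0; have mk := measurable_knockoff_design.
pose unstack (M : 'M[R]_(n, (p + p) + 1)) := (lsubmx (lsubmx M), rsubmx
  (lsubmx M), rsubmx M).
have stackK u : unstack (stack u) = u.
  by rewrite /unstack /stack !row_mxKl !row_mxKr; case: u => -[].
have munstack : measurable_fun setT unstack.
  apply: measurable_fun_pair; [apply: measurable_fun_pair|];
    apply: measurable_fun_mx => i k; under eq_fun do rewrite !mxE;
    exact: measurable_mx_entry.
have m1 : measurable_fun setT (stack \o data) by exact: measurable_stack.
have m2 : measurable_fun setT (stack \o swapped).
  by apply: measurable_stack => //; exact: measurable_swap_cols.
have mFu : measurable_fun setT (F \o unstack) by exact: measurableT_comp.
have Fu0 u : (0 <= (F \o unstack) u)%E by exact: F0.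
have -> : (\int[P]_w F (X w, knockoff_design w, y w) =
    \int[law P m1]_u (F \o unstack) u)%E.
  by rewrite ge0_integral_law//; apply: eq_integral => w _; rewrite /= stackK.
have -> : (\int[P]_w F (swap_cols [set j]%SET (X w) (knockoff_design w),
                swap_cols [set j]%SET (knockoff_design w) (X w), y w) =
    \int[law P m2]_u (F \o unstack) u)%E.
  by rewrite ge0_integral_law//; apply: eq_integral => w _; rewrite /= stackK.
apply: eq_measure_integral => A mA _.
apply: (probability_unique (G := mx_rectangles R n ((p + p) + 1))) => //.
- exact: mx_rectangles_generate.
- exact: mx_rectanglesI.
- exact: mx_rectanglesT.
move=> _ [B mB ->].
pose Bi i : set ((rV * rV) * R) := stack_row @^-1` (mx_rectangle (fun=> B i)).
have mBi i : measurable (Bi i).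
  by apply: mpre => //; apply: mx_rectangle_measurable => _; exact: mB.
have rectE u : mx_rectangle B (stack u) <->
    forall i, Bi i ((row i u.1.1, row i u.1.2), u.2 i 0).
  rewrite /Bi /=; split=> [H i k l|H i k]; first by rewrite -row_stack mxE;
    exact: H.
  by have := H i 0 k; rewrite -row_stack mxE.
transitivity (\prod_i (mu \x g) (knockoff_row s Om0 @^-1` Bi i))%E.
  rewrite -rows_law; last first.
    by move=> i; apply: mpre => //; exact: measurable_knockoff_row.
  rewrite -[LHS]/(P _); congr (P _); apply/seteqP; split=> w.
    by move=> /rectE H i; have := H i; rewrite data_row.
  by move=> H; apply/rectE => i; rewrite data_row; exact: H.
transitivity (\prod_i (mu \x g) ((swap_row j \o knockoff_row s Om0) @^-1` Bi
  i))%E.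
  by apply: eq_bigr => i _; apply: knockoff_row_swap.
rewrite -rows_law; last first.
  move=> i; apply: mpre => //; apply: measurableT_comp.
    exact: measurable_swap_row.
  exact: measurable_knockoff_row.
rewrite -[RHS]/(P _); congr (P _); apply/seteqP; split=> w.
  by move=> H; apply/rectE => i; rewrite swapped_row; exact: H.
by move=> /rectE H i; have := H i; rewrite swapped_row.
Qed.

End design_exchangeability.
Section statistics.
Context {R : realType} {n p : nat} (S : {set 'I_p}) (st : @knockoff_stat R n p
  S).

Definition stat_vector (y : 'cV[R]_n) (X Xt : 'M[R]_(n, p)) : 'I_p -> R :=
  extend0 (Wstat st y (subcol S X) (subcol S Xt)).

Lemma stat_vector_swap y X Xt j :
  stat_vector y (swap_cols [set j]%SET X Xt) (swap_cols [set j]%SET Xt X) =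
  flip_at j (stat_vector y X Xt).
Proof.
pose A := [set k : 'I_#|S| | enum_val k == j]%SET.
have subE (M M' : 'M[R]_(n, p)) :
    subcol S (swap_cols [set j]%SET M M')
      = swap_cols A (subcol S M) (subcol S M').
  by apply/matrixP => i k; rewrite !mxE !inE.
apply/funext => k; rewrite /stat_vector !subE /flip_at /extend0.
(* Outside S the statistic is 0, its own opposite, so the flip is consistent there as well. *)
case: pickP => [l /eqP lk|_]; last by case: ifP => //; rewrite oppr0.
by rewrite Wstat_swap inE lk.
Qed.

Lemma measurable_stat_vector d (T : measurableType d) (y : T -> 'cV[R]_n)
    (X Xt : T -> 'M[R]_(n, p)) (j : 'I_p) :
  measurable_fun setT y -> measurable_fun setT X -> measurable_fun setT Xt ->
  measurable_fun setT (fun w => stat_vector (y w) (X w) (Xt w) j).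
Proof.
move=> my mX mXt; rewrite /stat_vector /extend0; case: pickP => [k _|//].
apply: (measurableT_comp (Wstat_measurable st k)
  (g := fun w => (y w, subcol S (X w), subcol S (Xt w)))).
by do ?apply: measurable_fun_pair => //; exact: measurable_subcol.
Qed.

End statistics.

(** * FDR control with the true precision matrix *)

Section oracle.
Context {R : realType} {n p : nat} (s : 'rV[R]_p) (Om0 : 'M[R]_p).
Variables (mu : probability ('rV[R]_p * R)%type R).
Hypotheses (Om0_pd : posdef Om0) (B2_psd : possemidef (B2mx s Om0)).
Hypothesis mu_gauss : gaussian_law (invmx Om0) (fun A => mu (fst @^-1` A)).
Hypothesis s_gt0 : forall j, 0 < s 0 j.
Context d (T : measurableType d) (P : probability T R).
Variables (X : T -> 'M[R]_(n, p)) (y : T -> 'cV[R]_n) (Z : T -> 'M[R]_(n, p)).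
Hypotheses (mX : measurable_fun setT X) (my : measurable_fun setT y).
Hypothesis mZ : measurable_fun setT Z.
Hypotheses (Xy_iid : iid_sample P X y mu) (Z_std : std_gaussian P Z).
Hypothesis Z_indep : independent P Z (fun w => (X w, y w)).
Variables (S : {set 'I_p}) (st : @knockoff_stat R n p S).

Let W w := stat_vector st (y w) (X w) (knockoff_design s Om0 X Z w).

Let mW j : measurable_fun setT (fun w => W w j).
Proof. by apply: measurable_stat_vector => //;
  exact: measurable_knockoff_design. Qed.

Lemma null_weight_flip q j : j \in nulls mu ->
  (\int[P]_w (null_weight q (nulls mu) j (W w))%:E =
   \int[P]_w (null_weight q (nulls mu) j (flip_at j (W w)))%:E)%E.
Proof.
move=> jN; have [g [g_std mu_fst]] := mu_gauss.
have gG := std_gaussian_rectangle g_std.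
pose F (u : 'M[R]_(n, p) * 'M[R]_(n, p) * 'cV[R]_n) : \bar R :=
  (null_weight q (nulls mu) j (stat_vector st u.2 u.1.1 u.1.2))%:E.
have mF : measurable_fun setT F.
  apply/measurable_EFinP; apply: measurable_null_weight => k.
  apply: measurable_stat_vector; first exact: measurable_snd.
    by apply: measurableT_comp measurable_fst; exact: measurable_fst.
  by apply: measurableT_comp measurable_fst; exact: measurable_snd.
have F0 u : (0 <= F u)%E by rewrite lee_fin null_weight_ge0.
have := design_swap Om0_pd B2_psd gG mu_fst s_gt0 mX my mZ Xy_iid Z_std
  Z_indep jN mF F0.
rewrite /F /= => ->.
by apply: eq_integral => w _; rewrite stat_vector_swap.
Qed.

Lemma oracle_fdr q : 0 <= q ->
  (\int[P]_w (knockoff_fdp q (nulls mu) s st Om0 (X w) (y w) (Z w))%:E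
    <= q%:E)%E.
Proof.
move=> q0; set N := nulls mu.
have mnw j : measurable_fun setT (fun w =>
  (null_weight q N j (W w))%:E : \bar R).
  by apply/measurable_EFinP; exact: measurable_null_weight.
have mnf j : measurable_fun setT (fun w =>
  (null_weight q N j (flip_at j (W w)))%:E : \bar R).
  apply/measurable_EFinP; apply: measurable_null_weight => k.
  by rewrite /flip_at; case: (k == j) => //; exact: measurable_funN.
have nw0 j V : (0 <= (null_weight q N j V)%:E)%E by rewrite lee_fin
  null_weight_ge0.
apply: (@le_trans _ _ (\int[P]_w (q%:E * \sum_(j in N) (null_weight q N j (W
  w))%:E))%E).
  apply: ge0_le_integral => //.
  - by move=> w _; rewrite lee_fin fdp_ge0.
  - apply/measurable_EFinP; exact: measurable_fdp.
  - apply: emeasurable_funM => //.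
    under eq_fun do rewrite big_mkcond.
    by apply: emeasurable_sum => j; case: (j \in N).
  - by move=> w _; rewrite sumEFin -EFinM lee_fin; exact: fdp_le_null_weight.
rewrite ge0_integralZl//; last 2 first.
- under eq_fun do rewrite big_mkcond.
  by apply: emeasurable_sum => j; case: (j \in N).
- by move=> w _; apply: sume_ge0.
rewrite -[leRHS]mule1 lee_wpmul2l ?lee_fin//.
under eq_integral do rewrite big_mkcond.
rewrite ge0_integral_sum//; last 2 first.
- by move=> j; case: (j \in N).
- by move=> j w _; case: (j \in N).
rewrite (eq_bigr (fun j => \int[P]_w (if j \in N then
    (null_weight q N j (flip_at j (W w)))%:E else 0)))%E; last first.
  by move=> j _; have [jN|//] := boolP (j \in N); exact: null_weight_flip.
rewrite -ge0_integral_sum//; last 2 first.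
- by move=> j; case: (j \in N).
- by move=> j w _; case: (j \in N).
apply: (@le_trans _ _ (\int[P]_w 1)%E).
  apply: ge0_le_integral => //.
  - by move=> w _; apply: sume_ge0 => j _; case: (j \in N).
  - by apply: emeasurable_sum => j; case: (j \in N).
  - move=> w _; rewrite -big_mkcond sumEFin lee_fin;
    exact: sum_null_weight_flip.
by rewrite integral_cst// mul1e; exact: probability_le1.
Qed.

End oracle.
(** * The two folds *)

Section nonmeasurable_majorant.
Context d (T : measurableType d) {R : realType} (mu : {measure set T ->
  \bar R}).
Local Open Scope ereal_scope.
Import HBNNSimple.

(* The integral of a nonnegative function is a lower integral, hence monotone
   without any measurability assumption. *)
Lemma le_lower_integral (f1 f2 : T -> \bar R) :
  (forall x, 0 <= f1 x) -> (forall x, f1 x <= f2 x) ->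
  \int[mu]_x f1 x <= \int[mu]_x f2 x.
Proof.
move=> f10 f12; have f20 x : 0 <= f2 x by exact: le_trans (f12 x).
rewrite !ge0_integralTE//; apply: ereal_sup_le => _ [h hf <-].
exists h => // x.
exact: le_trans (hf x) (f12 x).
Qed.

End nonmeasurable_majorant.

Section lipschitz_measurable.
Context {R : realType} {m n : nat}.

Lemma frobenius_near (e : R) : 0 < e -> exists2 e', 0 < e' &
  forall A : 'M[R]_(m, n), (forall i j, `|A i j| < e') -> frobenius A < e.
Proof.
move=> e0; exists (e / ((m * n)%:R + 1)); first by rewrite divr_gt0// ltr_wpDl.
move=> A Ae; have k0 : 0 < (m * n)%:R + 1 :> R by rewrite ltr_wpDl.
apply: (@le_lt_trans _ _ ((m * n)%:R * (e / ((m * n)%:R + 1)))).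
  apply: frobenius_le_entries => [|i j]; last exact/ltW.
  by rewrite divr_ge0// ltW.
by rewrite mulrCA gtr_pMr// ltr_pdivrMr// mul1r ltrDl.
Qed.

(** The function is controlled only on G. As in McShane's extension, its superlevel set is the
    preimage of the open set U where some f A - k |M - A| exceeds t. *)
Lemma lipschitz_on_measurable (G : set 'M[R]_(m, n)) (f : 'M[R]_(m, n) -> R)
    (k : R) d (T : measurableType d) (phi : T -> 'M[R]_(m, n)) :
  0 < k ->
  (forall A B, G A -> G B -> `|f A - f B| <= k * frobenius (A - B)) ->
  measurable_fun setT phi -> (forall x, G (phi x)) ->
  measurable_fun setT (f \o phi).
Proof.
move=> k0 fk mphi Gphi.
apply: (measurability _ (RGenOInfty.measurableE R)) => //.
move=> _ [_ [t ->] <-]; rewrite setTI.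
pose U := [set M : 'M[R]_(m, n) |
  exists2 A, G A & k * frobenius (M - A) < f A - t].
have -> : (f \o phi) @^-1` `]t, +oo[%classic = phi @^-1` U.
  apply/seteqP; split=> x /=; rewrite in_itv /= andbT.
    by move=> tf; exists (phi x) => //; rewrite subrr frobenius0 mulr0 subr_gt0.
  move=> [A GA lt]; have := fk _ _ (Gphi x) GA.
  by rewrite ler_norml => /andP[+ _]; lra.
rewrite -[X in measurable X]setTI; apply: mphi => //.
apply: open_mx_measurable => M [A GA MA].
pose e := (f A - t - k * frobenius (M - A)) / k.
have e0 : 0 < e by rewrite divr_gt0// subr_gt0.
have [e' e'0 He'] := frobenius_near e0.
exists e' => // M' MM'; exists A => //.
have -> : M' - A = (M' - M) + (M - A) by rewrite addrA subrK.
have h1 : frobenius (M' - M) < e by apply: He' => i j; rewrite !mxE.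
have h2 := frobeniusD (M' - M) (M - A).
have h3 : k * e = f A - t - k * frobenius (M - A) by rewrite /e mulrC divfK//
  gt_eqF.
have h4 : k * frobenius (M' - M) < k * e by rewrite ltr_pM2l.
have h5 : k * frobenius (M' - M + (M - A))
  <= k * (frobenius (M' - M) + frobenius (M - A)).
  by rewrite ler_pM2l.
by rewrite mulrDr in h5; lra.
Qed.

(** The complement is open: a vector x of norm at most 1 showing that the norm of M - A exceeds t
    still shows it for matrices near M. *)
Lemma spectral_ball_measurable (A : 'M[R]_(m, n)) (t : R) :
  measurable [set M : 'M[R]_(m, n) | spectral_norm (M - A) <= t].
Proof.
rewrite -[X in measurable X]setCK; apply: measurableC.
apply: open_mx_measurable => M /= /spectral_norm_leP.
move=> /existsNP[x /not_implyP[x1 /negP]]; rewrite -ltNge => tx.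
have e0 : 0 < frobenius ((M - A) *m x) - t by rewrite subr_gt0.
have [e' e'0 He'] := frobenius_near e0.
exists e' => // M' MM' /spectral_norm_leP/(_ x x1).
apply/negP; rewrite -ltNge.
have h1 : frobenius (M - M') < frobenius ((M - A) *m x) - t.
  by apply: He' => i j; rewrite !mxE distrC.
have := frobeniusD ((M' - A) *m x) ((M - M') *m x).
rewrite -mulmxDl addrC addrA subrK.
have := frobeniusM (M - M') x.
have : frobenius (M - M') * frobenius x <= frobenius (M - M').
  by rewrite ler_piMr// frobenius_ge0.
lra.
Qed.

End lipschitz_measurable.

Section independence.
Context d (T : measurableType d) {R : realType} (P : probability T R).
Local Open Scope ereal_scope.

Lemma independent_generated d1 (E1 : measurableType d1) d2 (E2 :
  measurableType d2)
    (U : T -> E1) (V : T -> E2) (G : set (set E2)) :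
  measurable_fun setT U -> measurable_fun setT V ->
  measurable = <<s G >> -> setI_closed G -> G setT ->
  (forall A B, measurable A -> G B ->
    P (U @^-1` A `&` V @^-1` B) = P (U @^-1` A) * P (V @^-1` B)) ->
  independent P U V.
Proof.
move=> mU mV mG GI GT PG A B mA mB.
have mUA : measurable (U @^-1` A) by rewrite -[X in measurable X]setTI;
  exact: mU.
have c0 : 0 <= P (U @^-1` A) by exact: measure_ge0.
have cfin : P (U @^-1` A) \is a fin_num by exact: fin_num_measure.
pose c : {nonneg R} := NngNum (fine_ge0 c0).
have [m1 m1E] : exists m1 : {measure set E2 -> \bar R},
    forall C, m1 C = P (V @^-1` C `&` U @^-1` A).
  pose m : {measure set E2 -> \bar R} := pushforward (mrestr P mUA) V.
  by exists (m mV).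
pose m2 : {measure set E2 -> \bar R} := mscale c (law P mV).
have m2E C : m2 C = P (U @^-1` A) * P (V @^-1` C).
  by rewrite /m2 /= /mscale /= fineK.
rewrite setIC -m1E -m2E; apply: (measure_unique G (fun=> setT)) => //.
- by rewrite bigcup_const.
- by move=> C GC; rewrite m1E m2E setIC; exact: PG.
- move=> _; apply: (@le_lt_trans _ _ 1); last exact: ltry.
  by rewrite /= m1E preimage_setT setTI; exact: probability_le1.
Qed.

(** The joint law is a product, so Fubini integrates over V with U frozen. This stands for
    conditioning on the first fold. *)
Lemma independent_integral d1 (E1 : measurableType d1) d2 (E2 : measurableType
  d2)
    (U : T -> E1) (V : T ->
      E2) (mU : measurable_fun setT U) (mV : measurable_fun setT V)
    (f : E1 * E2 -> \bar R) :
  independent P U V -> measurable_fun setT f -> (forall u, 0 <= f u) ->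
  \int[P]_w f (U w, V w) = \int[law P mU]_u \int[P]_w f (u, V w).
Proof.
move=> ind mf f0; have mUV := measurable_fun_pair mU mV.
rewrite -(ge0_integral_law P mUV)//.
transitivity (\int[(law P mU \x law P mV)]_u f u).
  apply: eq_measure_integral => A mA _; apply/esym.
  by apply: product_measure_unique => // B C mB mC; exact: ind.
rewrite fubini_tonelli1//; apply: eq_integral => u _.
rewrite /fubini_F ge0_integral_law//; exact: measurable_fun_pair2.
Qed.

End independence.

(** * The FDR of RANK under a uniform bound near Om0 *)

Section rank_bound.
Context {R : realType} {n p : nat} (s : 'rV[R]_p) (Om0 : 'M[R]_p).
Context d (T : measurableType d) (P : probability T R).
Variables (X1 X2 : T -> 'M[R]_(n, p)) (y1 y2 : T -> 'cV[R]_n).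
Variable Z : T -> 'M[R]_(n, p).
Hypotheses (mX1 : measurable_fun setT X1) (my1 : measurable_fun setT y1).
Hypotheses (mX2 : measurable_fun setT X2) (my2 : measurable_fun setT y2).
Hypothesis mZ : measurable_fun setT Z.
Hypothesis folds_indep :
  independent P (fun w => (X1 w, y1 w)) (fun w => (X2 w, y2 w)).
Hypothesis Z_indep :
  independent P Z (fun w => ((X1 w, y1 w), (X2 w, y2 w))).
Variables (q : R) (N : {set 'I_p}) (st : forall S, @knockoff_stat R n p S).
Variables (K : nat) (t c b : R).
Hypotheses (c0 : 0 < c) (b0 : 0 <= b).
Hypothesis B2_ge : forall Om : 'M[R]_p, Om^T = Om ->
  spectral_norm (Om - Om0) <= t -> quad_ge c (B2mx s Om).
Hypothesis fdr_le : forall (S : {set 'I_p}) (Om : 'M[R]_p),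
  (#|S| <= K)%N -> posdef Om -> spectral_norm (Om - Om0) <= t ->
  (\int[P]_w (knockoff_fdp q N s (st S) Om (X2 w) (y2 w) (Z w))%:E <= b%:E)%E.

Local Notation D := ('M[R]_(n, p) * 'cV[R]_n)%type.
Local Notation fold := (D * 'M[R]_(n, p))%type.

Lemma second_fold_indep :
  independent P (fun w => (X1 w, y1 w)) (fun w => ((X2 w, y2 w), Z w)).
Proof.
have m1 : measurable_fun setT (fun w =>
  (X1 w, y1 w)) by exact: measurable_fun_pair.
have m2 : measurable_fun setT (fun w =>
  (X2 w, y2 w)) by exact: measurable_fun_pair.
apply: (independent_generated (G := [set E `*` F | E in measurable & F in
  measurable])) => //.
- exact: measurable_fun_pair.
- exact: measurable_prod_measurableType.
- move=> _ _ [E1 mE1 [D1 mD1 <-]] [E2 mE2 [D2 mD2 <-]].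
  exists (E1 `&` E2); first exact: measurableI.
  exists (D1 `&` D2); first exact: measurableI.
  by rewrite setXI.
- by exists setT => //; exists setT => //; rewrite setXTT.
move=> A _ mA [E mE [F mF <-]].
have H1 := Z_indep mF (measurableX mA mE).
have H2 := Z_indep mF (measurableX measurableT mE).
have E1 : (fun w => (X1 w, y1 w)) @^-1` A `&` (fun w =>
  (X2 w, y2 w, Z w)) @^-1` (E `*` F)
  = Z @^-1` F `&` (fun w => ((X1 w, y1 w), (X2 w, y2 w))) @^-1` (A `*` E).
  by apply/seteqP; split=> w /=; tauto.
have E2 : (fun w => (X2 w, y2 w, Z w)) @^-1` (E `*` F)
  = Z @^-1` F `&` (fun w => ((X1 w, y1 w), (X2 w, y2 w))) @^-1` (setT `*` E).
  by apply/seteqP; split=> w /=; tauto.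
have E3 : (fun w => ((X1 w, y1 w), (X2 w, y2 w))) @^-1` (A `*` E) =
  (fun w => (X1 w, y1 w)) @^-1` A `&` (fun w => (X2 w, y2 w)) @^-1` E by [].
have E4 : (fun w => ((X1 w, y1 w), (X2 w, y2 w))) @^-1` (setT `*` E) =
  (fun w => (X2 w, y2 w)) @^-1` E by apply/seteqP; split=> w /=; tauto.
by rewrite E1 E2 H1 H2 E3 E4 folds_indep// muleCA.
Qed.

(** The constant is crude and depends on the dimension, which is harmless: the bound serves only the
    measurability of B at the estimated matrix. *)
Lemma sqrtmx_B2mx_lipschitz (A B : 'M[R]_p) :
  A^T = A -> spectral_norm (A - Om0) <= t ->
  B^T = B -> spectral_norm (B - Om0) <= t ->
  frobenius (Bmx s A - Bmx s B) <=
  (Num.sqrt c)^-1 * (frobenius (diag_mx s) * frobenius (diag_mx s)) *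
    frobenius (A - B).
Proof.
move=> AT At BT Bt.
have [Apsd AE] := sqrtmxP (quad_ge_possemidef (ltW c0) (B2_ge AT At)).
have [Bpsd BE] := sqrtmxP (quad_ge_possemidef (ltW c0) (B2_ge BT Bt)).
have := square_root_lipschitz c0 Apsd Bpsd; rewrite BE => /(_ (B2_ge BT Bt)).
rewrite AE -mulrA ler_pdivlMl ?sqrtr_gt0// => /le_trans; apply.
have -> : B2mx s A - B2mx s B = - (diag_mx s *m (A - B) *m diag_mx s).
  by rewrite mulmxBr mulmxBl opprB /B2mx opprB addrC addrA subrK.
rewrite frobeniusN; apply: le_trans (frobeniusM _ _) _.
apply: le_trans (ler_wpM2r (frobenius_ge0 _) (frobeniusM _ _)) _.
by rewrite le_eqVlt; apply/orP; left; apply/eqP; ring.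
Qed.

Variables (Omhat : D -> 'M[R]_p) (Stilde : D -> {set 'I_p}).
Hypotheses (mOmhat : measurable_fun setT Omhat) (Omhat_pd : forall x, posdef
  (Omhat x)).
Hypothesis mStilde : forall S, measurable (Stilde @^-1` [set S]).
Hypothesis t0 : 0 <= t.
Hypothesis Om0T : Om0^T = Om0.

Let good (x : D) : bool := (spectral_norm (Omhat x - Om0)
  <= t) && (#|Stilde x| <= K)%N.

Let mgood : measurable_fun setT good.
Proof.
apply: measurable_and.
  apply: (measurable_fun_bool true); rewrite setTI.
  have -> : (fun x => spectral_norm (Omhat x - Om0) <= t) @^-1` [set true] =
    Omhat @^-1` [set M | spectral_norm (M - Om0) <= t] by apply/seteqP;
      split=> x.
  by rewrite -[X in measurable X]setTI; apply: mOmhat => //;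
    exact: spectral_ball_measurable.
exact: (@measurable_fun_fin _ _ _ _ _ Stilde (fun S _ => (#|S| <= K)%N)).
Qed.

(* Discarding the bad values of [Omhat] keeps [Om'] in a set on which the
   square root is Lipschitz, which gives the measurability of [Bmx s (Om' x)].
     *)
Let Om' (x : D) : 'M[R]_p := if good x then Omhat x else Om0.

Let mOm' : measurable_fun setT Om'.
Proof. by apply: measurable_fun_ifT. Qed.

Let Om'T x : (Om' x)^T = Om' x.
Proof. by rewrite /Om'; case: ifP => // _; case: (Omhat_pd x). Qed.

Let Om'_near x : spectral_norm (Om' x - Om0) <= t.
Proof.
rewrite /Om'; case: ifPn => [/andP[]//|_]; rewrite subrr.
by apply/spectral_norm_leP => v _; rewrite mul0mx frobenius0.
Qed.

Let mBmx : measurable_fun setT (fun x => Bmx s (Om' x)).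
Proof.
apply: measurable_fun_mx => i j.
pose k := (Num.sqrt c)^-1 * (frobenius (diag_mx s) * frobenius (diag_mx s)).
apply: (@lipschitz_on_measurable _ _ _
  [set A | A^T = A /\ spectral_norm (A - Om0) <= t] (fun A =>
    Bmx s A i j) (k + 1)) => //.
- rewrite ltr_wpDl// mulr_ge0 ?invr_ge0 ?sqrtr_ge0//.
  by rewrite mulr_ge0 ?frobenius_ge0.
move=> A B [AT At] [BT Bt].
apply: le_trans (le_trans (sqrtmx_B2mx_lipschitz AT At BT Bt) _); last first.
  by rewrite ler_wpM2r ?frobenius_ge0// lerDl.
by have := frobenius_entry (Bmx s A - Bmx s B) i j; rewrite !mxE.
Qed.

Let fdp_at (S : {set 'I_p}) (u : D * fold) : R :=
  knockoff_fdp q N s (st S) (Om' u.1) u.2.1.1 u.2.1.2 u.2.2.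

Let mfdp_at S : measurable_fun setT (fdp_at S).
Proof.
have m1 : measurable_fun setT (fun u : D * fold =>
  u.1) by exact: measurable_fst.
have mX : measurable_fun setT (fun u : D * fold => u.2.1.1).
  apply: measurableT_comp; first exact: measurable_fst.
  by apply: measurableT_comp; [exact: measurable_fst|exact: measurable_snd].
have my : measurable_fun setT (fun u : D * fold => u.2.1.2).
  apply: measurableT_comp; first exact: measurable_snd.
  by apply: measurableT_comp; [exact: measurable_fst|exact: measurable_snd].
have mZ' : measurable_fun setT (fun u : D * fold => u.2.2).
  by apply: measurableT_comp; exact: measurable_snd.
apply: (@measurable_fdp _ (D * fold)%type R p
  (fun u : D * fold => stat_vector (st S) u.2.1.2 u.2.1.1
  (u.2.1.1 *m Cmx s (Om' u.1) + u.2.2 *m Bmx s (Om' u.1)))) => j.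
apply: measurable_stat_vector => //; apply: measurable_addmx.
  apply: measurable_mulmx => //; rewrite /Cmx; apply: measurable_addmx => //.
  apply: measurable_oppmx; apply: measurable_mulmx => //.
  exact: measurableT_comp mOm' m1.
by apply: measurable_mulmx => //; exact: measurableT_comp mBmx m1.
Qed.

(** A measurable majorant of the FDP: on bad first folds it takes the value 1, the largest possible
    FDP. *)
Let f (u : D * fold) : \bar R :=
  (if good u.1 then fdp_at (Stilde u.1) u else 1)%:E.

Let mf : measurable_fun setT f.
Proof.
have m1 : measurable_fun setT (fun u : D * fold =>
  u.1) by exact: measurable_fst.
apply/measurable_EFinP; apply: measurable_fun_ifT => //.
  exact: measurableT_comp mgood m1.
apply: (@measurable_fun_fin _ _ _ _ _ (fun u => Stilde u.1) fdp_at) => // S.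
have -> : (fun u : D * fold => Stilde u.1) @^-1` [set S] =
  (fun u => u.1) @^-1` (Stilde @^-1` [set S]) by [].
by rewrite -[X in measurable X]setTI; exact: m1.
Qed.

Let f_ge0 u : (0 <= f u)%E.
Proof. by rewrite lee_fin; case: ifP => // _; exact: fdp_ge0. Qed.

Lemma fdr_rank_le :
  {ae P, forall w, (#|Stilde (X1 w, y1 w)| <= K)%N} ->
  FDR_rank P q N s st X1 y1 X2 y2 Z Omhat Stilde <=
  b + (1 - fine (P [set w | spectral_norm (Omhat (X1 w, y1 w) - Om0) <= t])).
Proof.
move=> aeK.
pose D1 w : D := (X1 w, y1 w).
have mD1 : measurable_fun setT D1 by exact: measurable_fun_pair.
pose W2 w : fold := ((X2 w, y2 w), Z w).
have mW2 : measurable_fun setT W2.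
  by apply: measurable_fun_pair => //; exact: measurable_fun_pair.
pose bad : set T := [set w | ~~ good (D1 w)].
pose close : set T := [set w | spectral_norm (Omhat (D1 w) - Om0) <= t].
have mclose : measurable close.
  have -> : close = (Omhat \o D1) @^-1` [set M | spectral_norm (M - Om0)
    <= t] by [].
  rewrite -[X in measurable X]setTI; apply: measurableT_comp => //.
  exact: spectral_ball_measurable.
have mbad : measurable bad.
  have -> : bad = ~` ((good \o D1) @^-1` [set true]).
    by apply/seteqP; split=> w /=; rewrite /bad /= => /negP.
  by apply: measurableC; rewrite -[X in measurable X]setTI;
    exact: measurableT_comp.
have Pbad : (P bad <= 1 - P close)%E.
  rewrite -probability_setC//.
  (* The reduced model is small only almost surely, so the bad event is covered by the complement of
     [close] and a null set. *)
  have [M [mM M0 MK]] := aeK.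
  have -> : P (~` close) = P (~` close `|` M).
    by rewrite measureU0//; exact: measurableC.
  apply: le_measure; rewrite ?inE//.
    by apply: measurableU => //; exact: measurableC.
  move=> w; rewrite /bad /= negb_and => /orP[/negP|wK]; first by left.
  by right; apply: MK => /=; apply/negP.
have E_le : (\int[P]_w (knockoff_fdp q N s (st (Stilde (D1 w))) (Omhat (D1 w))
    (X2 w) (y2 w) (Z w))%:E <= b%:E + P bad)%E.
  (* The left integrand is not known to be measurable where the estimate is bad; lower integrals can
     still be compared. *)
  apply: (@le_trans _ _ (\int[P]_w f (D1 w, W2 w))%E).
    apply: le_lower_integral => w; rewrite lee_fin; first exact: fdp_ge0.
    rewrite /fdp_at /Om' /=; case: ifPn => [->|_]; first exact: lexx.
    by rewrite /knockoff_fdp fdp_le1.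
  rewrite (independent_integral mD1 mW2 second_fold_indep mf f_ge0).
  (* For a bad first fold, 1 <= b + 1 because b >= 0, which allows a single formula for both
     cases. *)
  pose bnd (x : D) : \bar R := (b%:E + (\1_[set x | ~~ good x] x)%:E)%E.
  have mbg : measurable [set x : D | ~~ good x].
    have -> : [set x : D | ~~ good x] = ~` (good @^-1` [set true]).
      by apply/seteqP; split=> w /=; rewrite /= => /negP.
    by apply: measurableC; rewrite -[X in measurable X]setTI; exact: mgood.
  apply: (@le_trans _ _ (\int[law P mD1]_x bnd x)%E).
    apply: le_lower_integral => x; first exact: integral_ge0.
    rewrite /bnd indicE; have [gx|gx] := boolP (good x).
      rewrite memNset/=; last by rewrite /= gx.
      rewrite adde0; move/andP: (gx) => [gt gK].
      have := fdr_le gK (Omhat_pd x) gt; apply: le_trans.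
      by rewrite le_eqVlt; apply/orP; left; apply/eqP;
        apply: eq_integral => w _;
        rewrite /f /fdp_at /Om' /= gx.
    rewrite mem_set//= (eq_integral (fun=> 1%:E)) => [|w _]; last first.
      by rewrite /f /= (negPf gx).
    rewrite integral_cst// mul1e -EFinD.
    apply: (le_trans (probability_le1 P measurableT)).
    by rewrite lee_fin lerDr.
  rewrite /bnd ge0_integralD//; last first.
    by apply/measurable_EFinP; exact: measurable_indic.
  rewrite integral_cst// integral_indic// setIT.
  rewrite [X in (b%:E * X)%E](_ : _ = 1%E) ?mule1//; exact: probability_setT.
rewrite /FDR_rank unlock.
set I := (\int[P]_w _)%E.
have I0 : (0 <= I)%E by apply: integral_ge0 => w _; rewrite lee_fin fdp_ge0.
have I_le : (I <= b%:E + (1 - P close))%E.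
  by apply: le_trans E_le _; rewrite leeD2l.
have cfin : P close \is a fin_num by exact: fin_num_measure.
have cE : P close = (fine (P close))%:E by rewrite fineK.
rewrite -/close; rewrite cE in I_le *.
rewrite -EFinB -EFinD in I_le.
have Ifin : I \is a fin_num by rewrite ge0_fin_numE//;
  exact: (le_lt_trans I_le (ltry _)).
by rewrite -lee_fin fineK.
Qed.

End rank_bound.

(** * The FDR functions as integrals, and the conclusion *)

Section fdr_integrals.
Context {R : realType} {n p : nat} (s : 'rV[R]_p).
Context d (T : measurableType d) (P : probability T R).
Variables (X : T -> 'M[R]_(n, p)) (y : T -> 'cV[R]_n) (Z : T -> 'M[R]_(n, p)).
Hypotheses (mX : measurable_fun setT X) (my : measurable_fun setT y).
Hypothesis mZ : measurable_fun setT Z.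
Variables (q : R) (N : {set 'I_p}) (st : forall S, @knockoff_stat R n p S).

Lemma integral_le1 (f : T -> R) : (forall w, 0 <= f w <= 1) ->
  (\int[P]_w (f w)%:E <= 1)%E.
Proof.
move=> f01; apply: (@le_trans _ _ (\int[P]_w 1)%E).
  by apply: le_lower_integral => w; have /andP[f0 f1] := f01 w; rewrite lee_fin.
by rewrite integral_cst// mul1e; exact: probability_le1.
Qed.

Lemma FDR_integral Om S : (FDR P q N s st X y Z Om S)%:E =
  (\int[P]_w (knockoff_fdp q N s (st S) Om (X w) (y w) (Z w))%:E)%E.
Proof.
rewrite /FDR unlock fineK// ge0_fin_numE.
  by apply: le_lt_trans (ltry 1); apply: integral_le1 => w;
    rewrite fdp_ge0 fdp_le1.
by apply: integral_ge0 => w _; rewrite lee_fin fdp_ge0.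
Qed.

Lemma FDR_rank_le1 (X1 : T -> 'M[R]_(n, p)) (y1 : T -> 'cV[R]_n) Omhat Stilde :
  FDR_rank P q N s st X1 y1 X y Z Omhat Stilde <= 1.
Proof.
rewrite /FDR_rank unlock; set I := (\int[P]_w _)%E.
have I1 : (I <= 1)%E by apply: integral_le1 => w; rewrite fdp_ge0 fdp_le1.
have I0 : (0 <= I)%E by apply: integral_ge0 => w _; rewrite lee_fin fdp_ge0.
rewrite -lee_fin fineK// ge0_fin_numE//; exact: le_lt_trans (ltry 1).
Qed.

End fdr_integrals.

(** The empty set, which occurs when a_n < 0 leaves no matrix in the ball, has supremum 0 by
    convention. *)
Lemma sup_norm_le (R : realType) (A : set R) (b : R) :
  0 <= b -> (forall x, A x -> 0 <= x <= b) -> `|sup A| <= b.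
Proof.
move=> b0 Ab; have [->|/set0P[x Ax]] := eqVneq A set0;
  first by rewrite sup0 normr0.
have supA : has_sup A by split; [exists x|exists b => z /Ab/andP[]].
rewrite ger0_norm; first by apply: ge_sup; [exists x|move=> z /Ab/andP[]].
by have /andP[x0 _] := Ab x Ax; apply: le_trans x0 _;
  exact: (sup_upper_bound supA).
Qed.

Theorem theorem2 (R : realType) (p : nat -> nat)
    (Om0 : forall n, 'M[R]_(p n)) (s : forall n, 'rV[R]_(p n))
    (mu : forall n, probability ('rV[R]_(p n) * R)%type R)
    (d : nat -> measure_display) (T : forall n, measurableType (d n))
    (P : forall n, probability (T n) R)
    (X1 X2 : forall n, {RV (P n) >-> 'M[R]_(n, p n)})
    (y1 y2 : forall n, {RV (P n) >-> 'cV[R]_n})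
    (Z : forall n, {RV (P n) >-> 'M[R]_(n, p n)})
    (q : R)
    (st : forall n (S : {set 'I_(p n)}), @knockoff_stat R n (p n) S)
    (K : nat -> nat) (C2 : R) (a : nat -> R)
    (* the joint law mu n of (x, Y) *)
    (hOm0 : forall n, posdef (Om0 n))
    (hx : forall n, gaussian_law (invmx (Om0 n))
                      (fun A => mu n (fst @^-1` A)))
    (hs0 : forall n j, 0 <= s n 0 j)
    (hsS : forall n,
      posdef (invmx (Om0 n) - 2%:R^-1 *: diag_mx (s n)))
    (* two independent folds of size n, and the noise matrix *)
    (hfold1 : forall n, iid_sample (P n) (X1 n) (y1 n) (mu n))
    (hfold2 : forall n, iid_sample (P n) (X2 n) (y2 n) (mu n))
    (hfolds : forall n,
      independent (P n) (fun w => (X1 n w, y1 n w)) (fun w => (X2 n w, y2 n w)))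
    (hZ : forall n, std_gaussian (P n) (Z n))
    (hZindep : forall n,
      independent (P n) (Z n)
        (fun w => ((X1 n w, y1 n w), (X2 n w, y2 n w))))
    (hq : 0 < q < 1)
    (* assumptions on Om0 and s *)
    (heig : exists lo hi : R, 0 < lo /\
      forall n b, eigenvalue (Om0 n) b -> lo <= b <= hi)
    (heigB : exists2 c : R, 0 < c &
      forall n b, eigenvalue (B2mx (s n) (Om0 n)) b -> c <= b)
    (hKpos : forall n, (0 < K n)%N)
    (hK : K @ \oo --> \oo)
    (hC2 : 0 < C2)
    (ha : a @ \oo --> (0 : R)) :
  let FDRn n Om S :=
    FDR (P n) q (nulls (mu n)) (s n) (st n) (X2 n) (y2 n) (Z n) Om S in
  let H n Om S := Hmx (s n) (Om0 n) Om S in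
  (exists2 L : R, 0 < L & \forall n \near \oo,
    forall (S : {set 'I_(p n)}) (Om : 'M[R]_(p n)),
      (#|S| <= K n)%N -> posdef Om ->
      spectral_norm (Om - Om0 n) <= C2 * a n ->
      `|FDRn n Om S - FDRn n (Om0 n) S|
        <= L * frobenius (H n Om S - H n (Om0 n) S)) ->
  (fun n => sup [set r : R |
      exists (S : {set 'I_(p n)}) (Om : 'M[R]_(p n)),
        [/\ (#|S| <= K n)%N, posdef Om,
            spectral_norm (Om - Om0 n) <= C2 * a n &
            r = `|FDRn n Om S - FDRn n (Om0 n) S|]] : R^o)
    =O_\oo (fun n => Num.sqrt (K n)%:R * a n : R^o)
  /\
  (forall (c1 : R)
      (Omhat : forall n, 'M[R]_(n, p n) * 'cV[R]_n -> 'M[R]_(p n))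
      (Stilde : forall n, 'M[R]_(n, p n) * 'cV[R]_n -> {set 'I_(p n)}),
    0 < c1 ->
    (forall n, measurable_fun setT (Omhat n)) ->
    (forall n D, posdef (Omhat n D)) ->
    (forall n S, measurable (Stilde n @^-1` [set S])) ->
    (fun n => 1 - fine (P n [set w |
        spectral_norm (Omhat n (X1 n w, y1 n w) - Om0 n) <= C2 * a n]) : R^o)
      =O_\oo (fun n => (p n)%:R `^ (- c1) : R^o) ->
    (forall n, {ae P n, forall w, (#|Stilde n (X1 n w, y1 n w)| <= K n)%N}) ->
    (fun n => Num.sqrt (K n)%:R * a n) @ \oo --> (0 : R) ->
    exists r1 r2 : nat -> R^o,
      [/\ r1 =O_\oo (fun n => Num.sqrt (K n)%:R * a n : R^o),
          r2 =O_\oo (fun n => (p n)%:R `^ (- c1) : R^o) &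
          forall n,
            FDR_rank (P n) q (nulls (mu n)) (s n) (st n)
              (X1 n) (y1 n) (X2 n) (y2 n) (Z n) (Omhat n) (Stilde n)
            <= q + r1 n + r2 n]).
Proof.
move=> FDRn H [L L0 Lip].
have [lo [hi [lo0 ev]]] := heig; have [c c0 evB] := heigB.
pose k : R := 2 / lo.
pose M : R := k + (2 + `|hi| * k) * (k ^+ 2 / c).
have k0 : 0 <= k by rewrite divr_ge0// ltW.
have M0 : 0 <= M.
  rewrite /M addr_ge0// mulr_ge0//; first by rewrite addr_ge0// mulr_ge0.
  by rewrite divr_ge0 ?sqr_ge0// ltW.
(* L comes from the Lipschitz condition, M from the perturbation of H and C2 from the radius of the
   ball; the added 1 makes positivity immediate. *)
pose B : R := L * M * C2 + 1.
have LMC0 : 0 <= L * M * C2 by rewrite !mulr_ge0// ltW.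
have B0 : 0 < B by rewrite ltr_wpDl.
have small : \forall n \near \oo, C2 * a n * k ^+ 2 <= c / 2.
  have e0 : 0 < c / 2 / (C2 * (k ^+ 2 + 1)).
    by rewrite !divr_gt0// mulr_gt0// ltr_wpDl// sqr_ge0.
  have small_a : \forall n \near \oo, `|a n| < c / 2 / (C2 * (k ^+ 2 + 1)).
    exact: (cvgr0_norm_lt (V := R^o) a ha _ e0).
  apply: filterS small_a => n an.
  have h1 : C2 * (k ^+ 2 + 1) * `|a n| <= c / 2.
    rewrite mulrC -ler_pdivlMr; first exact: ltW.
    by rewrite mulr_gt0// ltr_wpDl// sqr_ge0.
  apply: le_trans h1; rewrite -mulrA -mulrA ler_wpM2l ?(ltW hC2)//.
  rewrite mulrC; apply: (@le_trans _ _ (k ^+ 2 * `|a n|)).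
    by rewrite ler_wpM2l ?sqr_ge0// ler_norm.
  by rewrite ler_wpM2r// lerDl.
pose ok n := C2 * a n * k ^+ 2 <= c / 2 /\
  forall (S : {set 'I_(p n)}) (Om : 'M[R]_(p n)),
    (#|S| <= K n)%N -> posdef Om -> spectral_norm (Om - Om0 n) <= C2 * a n ->
    `|FDRn n Om S - FDRn n (Om0 n) S|
      <= L * frobenius (H n Om S - H n (Om0 n) S).
have okn : \forall n \near \oo, ok n.
  by apply: filterS2 small Lip => n; split.
pose rate n := Num.sqrt (K n)%:R * a n.
have perturb n (S : {set 'I_(p n)}) (Om : 'M[R]_(p n)) : ok n ->
    (#|S| <= K n)%N -> posdef Om -> spectral_norm (Om - Om0 n) <= C2 * a n ->
    `|FDRn n Om S - FDRn n (Om0 n) S| <= B * `|rate n|.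
  move=> [sm lip] SK Ompd Omt; apply: le_trans (lip S Om SK Ompd Omt) _.
  have OmT : Om^T = Om by case: Ompd.
  (* The presence of Om in the ball forces a_n >= 0, so [rate n] is its own absolute value. *)
  have t0 : 0 <= C2 * a n := le_trans (spectral_norm_ge0 _) Omt.
  have a0 : 0 <= a n by rewrite pmulr_rge0 in t0.
  have := frobenius_Hmx_sub lo0 c0 (hs0 n) (hOm0 n) (ev n) (evB n) OmT Omt S sm.
  rewrite -/k -/M => hH.
  have hS : Num.sqrt #|S|%:R <= Num.sqrt (K n)%:R :> R.
    by rewrite ler_wsqrtr// ler_nat.
  rewrite /rate ger0_norm ?mulr_ge0 ?sqrtr_ge0//.
  apply: (@le_trans _ _ (L * M * C2 * (Num.sqrt (K n)%:R * a n))); last first.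
    by rewrite ler_wpM2r ?mulr_ge0 ?sqrtr_ge0// lerDl.
  have -> : L * M * C2 * (Num.sqrt (K n)%:R * a n) =
      L * (M * Num.sqrt (K n)%:R * (C2 * a n)) by ring.
  rewrite ler_wpM2l ?(ltW L0)//; apply: le_trans hH _.
  by rewrite ler_wpM2r// ler_wpM2l.
split.
  apply/eqO_exP; exists B => //; apply: filterS okn => n okn.
  apply: sup_norm_le; first by rewrite mulr_ge0// ltW.
  by move=> _ [S [Om [SK Ompd Omt ->]]]; rewrite normr_ge0; exact: perturb.
move=> c1 Omhat Stilde c10 mOmhat Omhat_pd mStilde hprob hcard _.
pose bad n := 1 - fine (P n [set w |
  spectral_norm (Omhat n (X1 n w, y1 n w) - Om0 n) <= C2 * a n]).
pose rank n := FDR_rank (P n) q (nulls (mu n)) (s n) (st n)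
  (X1 n) (y1 n) (X2 n) (y2 n) (Z n) (Omhat n) (Stilde n).
have [q0 q1] : 0 <= q /\ q < 1 by case/andP: hq => /ltW.
(* The final inequality is claimed for every n, while [ok n] holds only eventually: at the other n
   the first remainder absorbs the whole excess, which does not affect its order. *)
exists (fun n => if `[< ok n >] then B * `|rate n| else rank n - q - bad n),
  bad.
split=> //.
  apply/eqO_exP; exists B => //; apply: filterS okn => n okn.
  by rewrite asboolT// ger0_norm// mulr_ge0// ltW.
move=> n; rewrite -/(rank n); case: asboolP => [okn'|_]; last by lra.
have b0 : 0 <= q + B * `|rate n| by rewrite addr_ge0// mulr_ge0// ltW.
(* If the radius is negative the event of a good estimate is empty, so [bad n] is 1 and the trivial
   bound on the FDR is enough. *)
have [t0|t0] := leP 0 (C2 * a n); last first.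
  have -> : bad n = 1.
    rewrite /bad (_ : [set w | _] = set0) ?measure0 ?subr0//.
    apply/seteqP; split=> w //=; apply/negP; rewrite -ltNge.
    exact: lt_le_trans t0 (spectral_norm_ge0 _).
  by have := FDR_rank_le1 (s n) (P n) (X2 n) (y2 n) (Z n) q (nulls (mu n)) (st
    n)
    (X1 n) (y1 n) (Omhat n) (Stilde n); rewrite -/(rank n); lra.
have mX1 : measurable_fun setT (X1 n) by exact: measurable_funPT.
have mX2 : measurable_fun setT (X2 n) by exact: measurable_funPT.
have my1 : measurable_fun setT (y1 n) by exact: measurable_funPT.
have my2 : measurable_fun setT (y2 n) by exact: measurable_funPT.
have mZ : measurable_fun setT (Z n) by exact: measurable_funPT.
have Z2 : independent (P n) (Z n) (fun w => (X2 n w, y2 n w)).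
  move=> A A' mA mA'.
  by have := hZindep n A (setT `*` A') mA (measurableX measurableT mA');
    rewrite (_ : (fun w =>
      (X1 n w, y1 n w, (X2 n w, y2 n w))) @^-1` (setT `*` A') =
      (fun w => (X2 n w, y2 n w)) @^-1` A')//; apply/seteqP; split=> w /=;
        tauto.
have Om0T : (Om0 n)^T = Om0 n by case: (hOm0 n).
have B2_ge := B2mx_quad_ge0 (hOm0 n) (evB n).
have oracle (S : {set 'I_(p n)}) : FDRn n (Om0 n) S <= q.
  rewrite -lee_fin FDR_integral; apply: oracle_fdr => //.
  - exact: quad_ge_possemidef (ltW c0) B2_ge.
  - exact: (s_gt0 c0 (hs0 n) (hOm0 n) (evB n)).
have c20 : 0 < c / 2 by rewrite divr_gt0.
apply: (fdr_rank_le mX1 my1 mX2 my2 mZ (hfolds n) (hZindep n) c20 b0 _ _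
  (mOmhat n) (Omhat_pd n) (mStilde n) t0 Om0T (hcard n)).
- move=> Om OmT Omt; 
  by apply: (B2mx_quad_ge lo0 c0 (hs0 n) (hOm0 n) (ev n) (evB n) OmT Omt);
    case: okn'.
- move=> S Om SK Ompd Omt; rewrite -FDR_integral lee_fin.
  have := perturb n S Om okn' SK Ompd Omt.
  rewrite ler_norml lerBlDr => /andP[_ le_FDR]; apply: le_trans le_FDR _.
  by rewrite addrC lerD2r; exact: oracle.
Qed.
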